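(* Let $P,Q,N>0$ and $\sigma_u^2\ge 0$, and consider the Gaussian state amplification channel with noisy state observations with these parameters (see context). Put $$Q'=\frac{Q^2}{Q+\sigma_u^2},\qquad N'=\frac{Q\sigma_u^2}{Q+\sigma_u^2}.$$ For $\alpha\ge 0$ and $\beta\in[0,1]$ let $$g=\sqrt{(1-\beta)P/Q'},\qquad r=\begin{bmatrix}(1+g)Q'+N'\\ \alpha(1+g)Q'\end{bmatrix},$$ $$\Sigma=\begin{bmatrix}(1+g)^2Q'+\beta P+N'+N & \beta P+\alpha(1+g)^2Q'\\ \beta P+\alpha(1+g)^2Q' & \beta P+\alpha^2(1+g)^2Q'\end{bmatrix}.$$ Then the rate--state-distortion pair $(R,D)$, $R\ge 0$, is achievable if there exist $\alpha\ge 0$ and $\beta\in[0,1]$ such that $$R<\frac12\log_2\frac{\beta P\left(\beta P+(1+g)^2Q'+N'+N\right)}{(N'+N)\left(\beta P+\alpha^2(1+g)^2Q'\right)+(1-\alpha)^2\beta(1+g)^2PQ'}$$ and $$D\ge Q'+N'-r^{\mathrm T}\Sigma^{-1}r .$$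
   Context: Channel model. For $i=1,2,\dots$ the channel output is $Y_i=X_i+S_i+Z_i$, where $X_i\in\mathbb R$ is the channel input, $S_i\sim\mathrm N(0,Q)$ i.i.d. is the state, and $Z_i\sim\mathrm N(0,N)$ i.i.d. is the noise. The sender observes noncausally (the whole block in advance) the sequence $V_i=S_i+U_i$, where $U_i\sim\mathrm N(0,\sigma_u^2)$ i.i.d. The sequences $\{S_i\},\{Z_i\},\{U_i\}$ are mutually independent. Codes. A $(2^{nR},n)$ code consists of an encoder (measurable map) sending a message $m\in\{1,\dots,2^{\lceil nR\rceil}\}$ and an observation $v^n\in\mathbb R^n$ to an input sequence $x^n\in\mathbb R^n$, and a decoder (measurable map) sending $y^n\in\mathbb R^n$ to a message estimate $\hat m\in\{1,\dots,2^{\lceil nR\rceil}\}$ and a state estimate $\hat s^n\in\mathbb R^n$. The message $M$ is uniformly distributed on the message set and independent of $(S^n,U^n,Z^n)$. Only codes satisfying the average power constraint $\frac1n\sum_{i=1}^n\mathsf E[X_i^2]\le P$ are considered. Achievability. A pair $(R,D)$ is achievable if there is a sequence of $(2^{nR},n)$ codes with $\lim_{n\to\infty}\mathsf P\{\hat M\ne M\}=0$ and $\limsup_{n\to\infty}\frac1n\sum_{i=1}^n\mathsf E\left[(S_i-\hat S_i)^2\right]\le D$. Convention. For $\beta=0$ the right-hand side of the rate condition is read as $-\infty$, so no pair $(R,D)$ arises from $\beta=0$; for $\beta\in(0,1]$ the matrix $\Sigma$ is invertible. *)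

(* Defs.v *)
From HB Require Import structures.
From mathcomp Require Import all_boot all_order all_algebra finmap.
From mathcomp Require Import all_classical all_reals all_analysis.
Set Implicit Arguments.
Unset Strict Implicit.
Unset Printing Implicit Defensive.
Import Order.TTheory GRing.Theory Num.Theory.
Import numFieldNormedType.Exports.
Local Open Scope classical_set_scope.
Local Open Scope ring_scope.

(* An alias of the ordinal type, because a measurable type has to be pointed,
   which 'I_(2 ^ k) is not canonically. *)
Definition message (k : nat) : Type := 'I_(2 ^ k).

Lemma message_gt0 (k : nat) : (0 < 2 ^ k)%N. Proof. by rewrite expn_gt0. Qed.

HB.instance Definition _ (k : nat) := Finite.copy (message k) 'I_(2 ^ k).
HB.instance Definition _ (k : nat) :=
  isPointed.Build (message k) (Ordinal (message_gt0 k)).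
HB.instance Definition _ (k : nat) :=
  @isMeasurable.Build default_measure_display (message k) discrete_measurable
    discrete_measurable0 discrete_measurableC discrete_measurableU.

(* N(0, v), parametrized by the variance. The degenerate case is separate
   because normal_prob with scale 0 is uniform on [0, 1], not dirac. *)
Definition gaussian (R : realType) (v : R) : set R -> \bar R :=
  if v == 0 then dirac (0 : R) else normal_prob 0 (Num.sqrt v).

Section independence.
Context d (Omega : measurableType d) (R : realType) (Pr : probability Omega R).

Definition sigma_rv d' (T : measurableType d') (X : Omega -> T)
    : set_system Omega :=
  preimage_set_system setT X measurable.

Definition sigma_process d' (T : measurableType d') (X : nat -> Omega -> T)
    : set_system Omega :=
  <<s \bigcup_i sigma_rv (X i) >>.

Definition mutually_independent (I : choiceType) (F : I -> set_system Omega)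
    : Prop :=
  forall (J : {fset I}) (A : I -> set Omega),
    (forall i, i \in J -> F i (A i)) ->
    Pr (\bigcap_(i in [set` J]) A i) = (\prod_(i <- J) Pr (A i))%E.

(* Equality only on measurable sets: off them both sides are junk values. *)
Definition has_law (X : {RV Pr >-> R}) (nu : set R -> \bar R) : Prop :=
  forall A : set R, measurable A -> distribution Pr X A = nu A.

End independence.

(* Time indices start at 0. *)
Definition block (R : realType) (Omega : Type) (X : nat -> Omega -> R)
    (n : nat) (w : Omega) : n.-tuple R :=
  [tuple X i w | i < n].

(* A nonnegative integer whenever rate >= 0, so the absolute value is only a
   cast from int to nat. *)
Definition message_bits (R : realType) (rate : R) (n : nat) : nat :=
  `|Num.ceil (n%:R * rate)|%N.

(* A code of length n with 2 ^ k messages: the encoder maps (m, v^n) to x^n, the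
   decoder maps y^n to (message estimate, state estimate). *)
Record channel_code (R : realType) (k n : nat) := ChannelCode {
  enc : {mfun (message k * n.-tuple R)%type >-> n.-tuple R};
  dec : {mfun n.-tuple R >-> (message k * n.-tuple R)%type} }.

Section channel.
Context d (Omega : measurableType d) (R : realType) (Pr : probability Omega R).

(* S: state, U: observation noise, Z: channel noise, of respective variances
   Q, vU and N. *)
Record channel_model (Q N vU : R) (S U Z : nat -> {RV Pr >-> R}) : Prop := {
  state_law : forall i, has_law (S i) (gaussian Q);
  obs_noise_law : forall i, has_law (U i) (gaussian vU);
  noise_law : forall i, has_law (Z i) (gaussian N);
  state_indep : mutually_independent Pr (fun i : nat => sigma_rv (S i));
  obs_noise_indep : mutually_independent Pr (fun i : nat => sigma_rv (U i));
  noise_indep : mutually_independent Pr (fun i : nat => sigma_rv (Z i));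
  processes_indep :
    mutually_independent Pr
      (tnth [tuple sigma_process S; sigma_process Z; sigma_process U]) }.

Record message_model (S U Z : nat -> {RV Pr >-> R}) (n k : nat)
    (M : {RV Pr >-> message k}) : Prop := {
  message_uniform : forall m : message k, Pr (M @^-1` [set m]) = (((2 ^ k)%N%:R)^-1)%:E;
  message_indep :
    mutually_independent Pr
      (tnth [tuple sigma_rv M;
                   sigma_rv (fun w => (block S n w, block U n w, block Z n w))]) }.

Section performance.
Variables (S U Z : nat -> {RV Pr >-> R}) (n k : nat) (M : {RV Pr >-> message k}).
Variable c : channel_code R k n.

Definition observation (w : Omega) : n.-tuple R :=
  block (fun i w => S i w + U i w) n w.

Definition input (w : Omega) : n.-tuple R := enc c (M w, observation w).

Definition output (w : Omega) : n.-tuple R :=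
  [tuple tnth (input w) i + S i w + Z i w | i < n].

Definition message_estimate (w : Omega) : message k := (dec c (output w)).1.

Definition state_estimate (w : Omega) : n.-tuple R := (dec c (output w)).2.

Definition average_power : \bar R :=
  ((n%:R^-1)%:E * \sum_(i < n) 'E_Pr[fun w => (tnth (input w) i ^+ 2)%R])%E.

Definition error_probability : \bar R :=
  Pr [set w | message_estimate w <> M w].

Definition average_distortion : \bar R :=
  ((n%:R^-1)%:E *
   \sum_(i < n) 'E_Pr[fun w => ((S i w - tnth (state_estimate w) i) ^+ 2)%R])%E.

End performance.
End channel.

(* The codes are chosen before the probability space: power, error probability
   and distortion depend only on the joint law of (M, S^n, U^n, Z^n), so they
   agree on all realizations of the model. *)
Definition achievable (R : realType) (P Q N vU rate D : R) : Prop :=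
  exists c : forall n, channel_code R (message_bits rate n) n,
    forall (d : measure_display) (Omega : measurableType d)
      (Pr : probability Omega R) (S U Z : nat -> {RV Pr >-> R})
      (M : forall n, {RV Pr >-> message (message_bits rate n)}),
      channel_model Q N vU S U Z ->
      (forall n, message_model S U Z n (M n)) ->
      [/\ forall n, (average_power S U (M n) (c n) <= P%:E)%E,
          error_probability S U Z (M n) (c n) @[n --> \oo] --> 0%E &
          (limn_esup (fun n => average_distortion S U Z (M n) (c n))
             <= D%:E)%E].

Section formulas.
Context (R : realType).
Implicit Types P Q N vU alpha beta : R.

(* Writing T_i = E[S_i | V_i], Q' and N' are the variances of T_i and of
   S_i - T_i. *)
Definition Qprime Q vU : R := Q ^+ 2 / (Q + vU).

Definition Nprime Q vU : R := Q * vU / (Q + vU).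

Definition gain P Q vU beta : R :=
  Num.sqrt ((1 - beta) * P / Qprime Q vU).

(* With A ~ N(0, beta P) independent of everything else and T = E[S | V], the
   test channel has input X = A + g T and auxiliary variable
   W = A + alpha (1 + g) T; corr_vec is the vector of covariances of S with
   (Y, W), and cov_mx the covariance matrix of (Y, W). *)
Definition corr_vec P Q vU alpha beta : 'cV[R]_2 :=
  let Q' := Qprime Q vU in let N' := Nprime Q vU in
  let g := gain P Q vU beta in
  \col_(i < 2) [:: (1 + g) * Q' + N'; alpha * (1 + g) * Q']`_i.

Definition cov_mx P Q N vU alpha beta : 'M[R]_2 :=
  let Q' := Qprime Q vU in let N' := Nprime Q vU in
  let g := gain P Q vU beta in
  \matrix_(i < 2, j < 2)
    (nth [::]
      [:: [:: (1 + g) ^+ 2 * Q' + beta * P + N' + N;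
              beta * P + alpha * (1 + g) ^+ 2 * Q'];
          [:: beta * P + alpha * (1 + g) ^+ 2 * Q';
              beta * P + alpha ^+ 2 * (1 + g) ^+ 2 * Q'] ] i)`_j.

Definition log2 (x : R) : R := ln x / ln 2.

(* At beta = 0 the numerator vanishes while ln 0 = 0 in the library, hence the
   explicit -oo. *)
Definition rate_bound P Q N vU alpha beta : \bar R :=
  let Q' := Qprime Q vU in let N' := Nprime Q vU in
  let g := gain P Q vU beta in
  if beta == 0 then -oo%E else
  (2^-1 * log2 (beta * P * (beta * P + (1 + g) ^+ 2 * Q' + N' + N) /
                ((N' + N) * (beta * P + alpha ^+ 2 * (1 + g) ^+ 2 * Q') +
                 (1 - alpha) ^+ 2 * beta * (1 + g) ^+ 2 * P * Q')))%:E.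

Definition distortion_bound P Q N vU alpha beta : R :=
  let r := corr_vec P Q vU alpha beta in
  Qprime Q vU + Nprime Q vU -
    (r^T *m invmx (cov_mx P Q N vU alpha beta) *m r) 0 0.

End formulas.

(* Main.v *)
(* The code is a dirty paper code. Let A ~ N(0, b) with b slightly
   below beta P, and put W = A + ka V, X = A + kax V and Y = X + S + Z. Every
   message owns a list of words w, and the encoder picks the first one which fits
   v: the powers of w, of w - ka v and of the input w + kx v are right. The decoder
   picks the first word of the whole codebook for which y - c w is short, where c W
   is the best linear estimate of Y, and estimates the state by k1 y + k2 w.

   Instead of drawing the codebook at random, its words are chosen one after the
   other. For w ~ N(0, Var W)^n independent of the channel, a change of variables
   shows that, up to factors exp(o(n)), the event that w fits v is p = (b / Var W)^(n/2)
   times less likely than for the jointly Gaussian pair, and that the same factor p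
   relates the probabilities of fitting and failing (by Chernoff bounds), or of
   fitting and being confused with a given earlier word (a Gaussian ball
   estimate, (rho / Var Y)^(n/2) with rho = Var(Y - c W)). Hence, as long as a
   probability 3 delta is uncovered, some word covers a new event while failing
   only on a fraction delta of it. About 1 / p words per message are enough, so
   confusions stay rare if 2^(2 R) Var W rho < b Var Y, which is the rate condition.

   On failure the distortion is controlled by an exponential moment of S_i^2 and
   by the decoder's bound on the power of its estimate. Codes for D + 1 / j with
   j tending to infinity are combined diagonally. *)

Require Import Defs.
From HB Require Import structures.
From mathcomp Require Import all_boot all_order all_algebra finmap.
From mathcomp Require Import all_classical all_reals all_analysis measurable_realfun.
From mathcomp Require Import ring lra.
Set Implicit Arguments.
Unset Strict Implicit.
Unset Printing Implicit Defensive.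
Import Order.TTheory GRing.Theory Num.Theory.
Import numFieldNormedType.Exports.
Import HBNNSimple.
Local Open Scope classical_set_scope.
Local Open Scope ring_scope.

(** A word fits a given observation only with exponentially small probability, about p. It can
    therefore be charged only with failures among the environments that it newly covers, and these
    have to be a small fraction of an event which is itself tiny: a bound on bad events that does
    not carry the factor p would say nothing. Hence flaws and confusions are estimated under the
    jointly Gaussian law and carried back with p in front. The two-sided power tests of the encoder
    serve this comparison. They confine the likelihood ratio between the independent and the joint
    law to a window of relative width exp(2 n eta), so that p cancels.

    When a word is chosen, the earlier words are constants. A confusion bound that is uniform in the
    earlier word is thus enough, and no law of a random codebook ever has to be formed. The choice
    bounds the failure probability of every single message, not only of an average message, and it
    refers only to the law of (S^n, U^n, Z^n), so that one codebook serves all realizations of the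
    model. *)

Lemma ge0_integral_density d (T : measurableType d) (R : realType)
    (mu nu : {measure set T -> \bar R}) (g : T -> R) :
    measurable_fun setT g -> (forall x, 0 <= g x) ->
    (forall A, measurable A -> nu A = (\int[mu]_(x in A) (g x)%:E)%E) ->
  forall f : T -> \bar R, measurable_fun setT f -> (forall x, (0 <= f x)%E) ->
  (\int[nu]_x f x = \int[mu]_x (f x * (g x)%:E))%E.
Proof.
move=> mg g0 nuE f mf f0.
have mgE : measurable_fun setT (EFin \o g) by exact/measurable_EFinP.
pose f_ := nnsfun_approx measurableT mf.
have cf x : (f_ n x)%:E @[n --> \oo] --> f x.
  by apply: cvg_nnsfun_approx => // *; exact: f0.
transitivity (limn (fun n => \int[nu]_x (f_ n x)%:E)%E).
  rewrite -monotone_convergence//.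
  - by apply: eq_integral => x _; apply/esym/cvg_lim => //; exact: cf.
  - by move=> n; exact/measurable_EFinP/measurable_funP.
  - by move=> n y _; rewrite lee_fin.
  - by move=> y _ m n mn; rewrite lee_fin; exact/lefP/nd_nnsfun_approx.
rewrite [X in limn X](_ : _ =
    (fun n => \int[mu]_x ((f_ n x)%:E * (g x)%:E))%E); last first.
  apply/funext => n.
  under eq_integral do rewrite fimfunE -fsumEFin//.
  rewrite ge0_integral_fsum//; last 2 first.
  - by move=> y; exact/measurable_EFinP/measurable_funM.
  - by move=> y x _; rewrite nnfun_muleindic_ge0.
  under [RHS]eq_integral do rewrite fimfunE -fsumEFin//.
  under [RHS]eq_integral.
    move=> x _; rewrite ge0_mule_fsuml; last first.
      by move=> y; rewrite nnfun_muleindic_ge0.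
    over.
  rewrite [RHS]ge0_integral_fsum//; last 2 first.
  - move=> y; apply: emeasurable_funM => //.
    exact/measurable_EFinP/measurable_funM.
  - move=> y x _; apply: mule_ge0; last by rewrite lee_fin.
    by rewrite nnfun_muleindic_ge0.
  apply: eq_fsbigr => r /[!inE] -[x _ fr].
  have r0 : (0 <= r)%R by rewrite -fr.
  have mr : measurable (f_ n @^-1` [set r]) by [].
  under eq_integral do rewrite EFinM.
  rewrite ge0_integralZl//; last exact/measurable_EFinP.
  rewrite integral_indic// setIT nuE//.
  under [RHS]eq_integral do rewrite EFinM -muleA.
  rewrite ge0_integralZl//; last 2 first.
  - by apply: emeasurable_funM => //; exact/measurable_EFinP.
  - by move=> y _; rewrite mule_ge0// lee_fin.
  congr (_ * _)%E.
  rewrite integral_mkcond; apply: eq_integral => y _.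
  rewrite patchE indicE; case: ifPn => _; by rewrite ?mul1e ?mul0e.
rewrite -monotone_convergence//.
- apply: eq_integral => x _; apply/cvg_lim => //.
  apply: cvgeZr => //; exact: cf.
- move=> n; apply: emeasurable_funM => //.
  exact/measurable_EFinP/measurable_funP.
- by move=> n y _; rewrite mule_ge0 ?lee_fin.
- move=> y _ m n mn; rewrite lee_wpmul2r ?lee_fin//.
  exact/lefP/nd_nnsfun_approx.
Qed.

Lemma measurable_prode d (T : measurableType d) (R : realType) n (h : 'I_n -> T -> \bar R) :
  (forall i, measurable_fun setT (h i)) ->
  measurable_fun setT (fun x => (\prod_(i < n) h i x)%E).
Proof.
move=> mh; elim: n h mh => [|n IH] h mh.
  by under eq_fun do rewrite big_ord0; exact: measurable_cst.
under eq_fun do rewrite big_ord_recl.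
by apply: emeasurable_funM => //; exact: IH.
Qed.

(** * Laws of i.i.d. tuples *)

Section tuple_probability.
Context d (T : measurableType d) (R : realType) (P : probability T R).

Definition tcons n (p : T * n.-tuple T) : n.+1.-tuple T := [tuple of p.1 :: p.2].

Lemma measurable_tcons n : measurable_fun setT (@tcons n).
Proof. by apply: measurable_cons; [exact: measurable_fst|exact: measurable_snd]. Qed.

HB.instance Definition _ n :=
  isMeasurableFun.Build _ _ _ _ (@tcons n) (@measurable_tcons n).

(** The [n]-fold product of [P], built by recursion on [n] so that Tonelli peels off the first
    coordinate in every induction. *)
Fixpoint tuple_prob n : probability (n.-tuple T) R :=
  if n is m.+1 then distribution (P \x tuple_prob m)%E (@tcons m)
  else dirac [tuple].

Lemma ge0_integral_tuple0 (f : 0.-tuple T -> \bar R) :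
  measurable_fun setT f -> (\int[tuple_prob 0]_x f x = f [tuple])%E.
Proof. by move=> mf; rewrite /= integral_dirac// diracT mul1e. Qed.

Lemma ge0_integral_tupleS n (f : n.+1.-tuple T -> \bar R) :
  measurable_fun setT f -> (forall x, (0 <= f x)%E) ->
  (\int[tuple_prob n.+1]_x f x =
   \int[P]_x \int[tuple_prob n]_y f (tcons (x, y)))%E.
Proof.
move=> mf f0; rewrite /= ge0_integral_distribution//.
rewrite fubini_tonelli1//; last by move=> x /=; exact: f0.
by apply: measurableT_comp => //; exact: measurable_tcons.
Qed.

Lemma measurable_tconsr n (x : T) :
  measurable_fun setT (fun y : n.-tuple T => tcons (x, y)).
Proof.
exact: (measurableT_comp (@measurable_tcons n) (pair1_measurable x)).
Qed.

Lemma tnth_tcons0 n x (y : n.-tuple T) : tnth (tcons (x, y)) ord0 = x.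
Proof. by []. Qed.

Lemma tnth_tconsS n x (y : n.-tuple T) i :
  tnth (tcons (x, y)) (lift ord0 i) = tnth y i.
Proof. by rewrite /tcons/= tnthS. Qed.

Lemma ge0_integral_tuple_prod n (f : 'I_n -> T -> \bar R) :
  (forall i, measurable_fun setT (f i)) -> (forall i x, (0 <= f i x)%E) ->
  (\int[tuple_prob n]_x \prod_(i < n) f i (tnth x i) =
   \prod_(i < n) \int[P]_x f i x)%E.
Proof.
have mprod m (h : 'I_m -> T -> \bar R) (mh : forall i, measurable_fun setT (h i)) :
    measurable_fun setT (fun x : m.-tuple T => (\prod_(i < m) h i (tnth x i))%E).
  by apply: measurable_prode => i; apply: measurableT_comp => //; exact: measurable_tnth.
elim: n f => [|n IH] f mf f0.
  rewrite ge0_integral_tuple0 ?big_ord0//.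
  exact: mprod.
rewrite ge0_integral_tupleS//; last 2 first.
- exact: mprod.
- by move=> x; exact: prode_ge0.
rewrite big_ord_recl -IH//.
under eq_integral => x _.
  under eq_integral => y _.
    rewrite big_ord_recl tnth_tcons0.
    under eq_bigr do rewrite tnth_tconsS.
    over.
  rewrite ge0_integralZl//; last 2 first.
  - exact: (mprod n (fun i => f (lift ord0 i))).
  - by move=> y _; exact: prode_ge0.
  over.
rewrite ge0_integralZr//.
by apply: integral_ge0 => y _; exact: prode_ge0.
Qed.

Definition tbox n (A : 'I_n -> set T) : set (n.-tuple T) :=
  [set x | forall i, A i (tnth x i)].

Lemma measurable_tbox n (A : 'I_n -> set T) :
  (forall i, measurable (A i)) -> measurable (tbox A).
Proof.
move=> mA.
rewrite (_ : tbox A = \big[setI/setT]_(i < n) ((@tnth n T ^~ i) @^-1` A i)).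
  apply: bigsetI_measurable => i _.
  by rewrite -[X in measurable X]setTI; exact: measurable_tnth.
apply/seteqP; split => x; rewrite -bigcap_seq => H; first by move=> i _; exact: H.
by move=> i; apply: H; exact: mem_index_enum.
Qed.

Lemma tuple_prob_box n (A : 'I_n -> set T) :
  (forall i, measurable (A i)) ->
  (tuple_prob n (tbox A) = \prod_(i < n) P (A i))%E.
Proof.
move=> mA.
under eq_bigr => i _ do rewrite -[A i]setIT -integral_indic//.
rewrite -ge0_integral_tuple_prod//; last first.
  by move=> i; exact/measurable_EFinP.
rewrite -[tbox A]setIT -integral_indic//; last exact: measurable_tbox.
apply: eq_integral => x _; have [xA|xA] := pselect (tbox A x).
  rewrite indicE mem_set// big1// => i _.
  by rewrite indicE mem_set.
rewrite indicE memNset//; have /existsNP[i Ai] := xA.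
by rewrite (bigD1 i)//= indicE memNset// mul0e.
Qed.

(** Boxes form a pi-system, and a coordinate event is a box with a single nontrivial side, so that
    boxes generate the sigma-algebra of tuples. This later identifies the law of a block from the
    independence of its entries. *)
Lemma tuple_prob_unique n (m : {measure set (n.-tuple T) -> \bar R}) :
  (forall A : 'I_n -> set T, (forall i, measurable (A i)) ->
    (m (tbox A) = \prod_(i < n) P (A i))%E) ->
  forall B, measurable B -> m B = tuple_prob n B.
Proof.
move=> mE B mB.
pose G := [set tbox A | A in [set A : 'I_n -> set T | forall i, measurable (A i)]].
have GT : G setT.
  by exists (fun=> setT) => //=; apply/seteqP; split.
apply: (measure_unique G (fun=> setT)) => //.
- rewrite eqEsubset; split.
    apply: smallest_sub; first exact: smallest_sigma_algebra.
    move=> X; rewrite -bigcup_seq => -[i _ [A mA <-]].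
    apply: sub_sigma_algebra.
    exists (fun j => if j == i then A else setT) => [j|]; first by case: ifP.
    apply/seteqP; split => [x Ax|x [_ Ax] j]; last by case: ifPn => // /eqP ->.
    by split => //; have := Ax i; rewrite eqxx.
  apply: smallest_sub; first exact: sigma_algebra_measurable.
  by move=> _ [A mA <-]; exact: measurable_tbox.
- move=> _ _ [A mA <-] [A' mA' <-].
  exists (fun i => A i `&` A' i) => [i|]; first exact: measurableI.
  by apply/seteqP; split => [x Ax|x [Ax A'x] i]; split => // i; case: (Ax i).
- by rewrite bigcup_const//; exists 0%N.
- by move=> _ [A mA <-]; rewrite mE//; exact/esym/tuple_prob_box.
- move=> _; rewrite -[X in m X](_ : tbox (fun=> setT) = _); last by apply/seteqP; split.
  rewrite mE// big1 ?ltry// => i _; exact: probability_setT.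
Qed.

End tuple_probability.

Lemma integral_cst_prob d (T : measurableType d) (R : realType)
  (P : probability T R) (c : \bar R) : (\int[P]_x c = c)%E.
Proof.
transitivity (c * P setT)%E; first exact: integral_cst.
by rewrite probability_setT mule1.
Qed.

(** * Gaussian integrals on the line *)

Section gauss.
Context {R : realType}.
Local Notation leb := (@lebesgue_measure R).
Implicit Types (f : R -> \bar R) (u v b s t l m rho : R).

(** Lebesgue measure is characterized by its values on half-open intervals. A negative [l] exchanges
    the open and the closed end, hence two cases. *)
Lemma lebesgue_affine l t f : l != 0 -> measurable_fun setT f ->
    (forall x, (0 <= f x)%E) ->
  (`|l|%:E * \int[leb]_x f (l * x + t)%R = \int[leb]_x f x)%E.
Proof.
move=> l0 mf f0.
pose phi (x : measurableTypeR R) : measurableTypeR R := l * x + t.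
have mphi : measurable_fun setT phi.
  by apply: measurable_funD => //; exact: measurable_funM.
pose pm : {measure set (measurableTypeR R) -> \bar R} :=
  measure_function_pushforward__canonical__measure_function_Measure leb mphi.
pose m : {measure set (measurableTypeR R) -> \bar R} :=
  mscale (NngNum (normr_ge0 l)) pm.
have mE A : measurable A -> leb A = m A.
  apply: lebesgue_measure_unique => //= _ [[x y]] _ <-.
  rewrite /m /= /mscale/= /pushforward.
  have [lgt0|llt0|/eqP] := ltgtP l 0; last by rewrite (negPf l0).
  - rewrite (_ : _ @^-1` _ = `[(y - t) / l, (x - t) / l[%classic); last first.
      apply/seteqP; split => z /=; rewrite !in_itv/= /phi;
      by rewrite ler_ndivrMr// ltr_ndivlMr// [z * l]mulrC lerBrDr ltrBlDr andbC.
    rewrite !lebesgue_measure_itv/= !lte_fin.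
    rewrite ltr_nM2r ?invr_lt0// ltrD2r; case: ifP => _; last by rewrite mule0.
    rewrite -EFinM -mulrBl ltr0_norm//; congr EFin; field; exact: l0.
  - rewrite (_ : _ @^-1` _ = `](x - t) / l, (y - t) / l]%classic); last first.
      apply/seteqP; split => z /=; rewrite !in_itv/= /phi;
      by rewrite ltr_pdivrMr// ler_pdivlMr// [z * l]mulrC ltrBlDr lerBrDr.
    rewrite !lebesgue_measure_itv/= !lte_fin.
    rewrite ltr_pM2r ?invr_gt0// ltrD2r; case: ifP => _; last by rewrite mule0.
    rewrite -EFinM -mulrBl gtr0_norm//; congr EFin; field; exact: l0.
rewrite [RHS](eq_measure_integral m); last by move=> A mA _; exact: mE.
rewrite ge0_integral_mscale//; congr (_ * _)%E.
by rewrite [RHS](ge0_integral_pushforward mphi leb measurableT mf).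
Qed.

(* Library normal laws live on [measurableTypeR R], whose measurable sets are
   those of [R] but with another display. *)
Definition of_measurableTypeR (x : measurableTypeR R) : R := x.

Lemma measurable_of_measurableTypeR : measurable_fun setT of_measurableTypeR.
Proof. by move=> _ A mA; rewrite setTI. Qed.

HB.instance Definition _ := isMeasurableFun.Build _ _ _ _
  of_measurableTypeR measurable_of_measurableTypeR.

Definition gauss v : probability R R :=
  if v == 0 then dirac (0 : R) : probability R R
  else distribution (normal_prob 0 (Num.sqrt v)) of_measurableTypeR.

Lemma gaussianE v A : gaussian v A = gauss v A.
Proof. by rewrite /gaussian /gauss; case: ifP. Qed.

Definition gpdf v (x : R) : R := (Num.sqrt (2 * pi * v))^-1 * expR (- x ^+ 2 / (2 * v)).

Lemma gpdf_ge0 v x : 0 <= gpdf v x.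
Proof. by rewrite mulr_ge0// ?invr_ge0 ?sqrtr_ge0 ?expR_ge0. Qed.

Lemma measurable_gpdf v : measurable_fun setT (gpdf v).
Proof.
apply: measurable_funM => //; apply: measurableT_comp => //.
by apply: measurable_funM => //; apply: measurableT_comp => //; exact: measurable_funX.
Qed.

Lemma normal_pdf_gpdf v : 0 < v -> normal_pdf 0 (Num.sqrt v) = gpdf v.
Proof.
move=> v0; apply/funext => x; rewrite normal_pdfE ?gt_eqF ?sqrtr_gt0//.
rewrite /normal_peak /normal_fun /gpdf sqr_sqrtr ?ltW// subr0.
by congr ((Num.sqrt _)^-1 * expR (_ / _)); rewrite -mulr_natl; ring.
Qed.

Lemma integral_gpdf v m : 0 < v -> (\int[leb]_x (gpdf v (x - m))%:E = 1)%E.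
Proof.
move=> v0; have := integral_normal_pdf 0 (Num.sqrt v).
rewrite normal_pdf_gpdf// => <-.
rewrite -[RHS](@lebesgue_affine 1 (- m)) ?oner_neq0//; last 2 first.
- by apply/measurable_EFinP; exact: measurable_gpdf.
- by move=> x; rewrite lee_fin gpdf_ge0.
by rewrite normr1 mul1e; apply: eq_integral => x _; rewrite mul1r.
Qed.

Lemma ge0_integral_gauss v f : 0 < v -> measurable_fun setT f ->
    (forall x, (0 <= f x)%E) ->
  (\int[gauss v]_x f x = \int[leb]_x (f x * (gpdf v x)%:E))%E.
Proof.
move=> v0 mf f0; rewrite /gauss gt_eqF// ge0_integral_distribution//.
apply: (@ge0_integral_density _ _ _ leb (normal_prob 0 (Num.sqrt v)) (gpdf v)) => //.
- exact: measurable_gpdf.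
- exact: gpdf_ge0.
- move=> A mA; transitivity (\int[leb]_(x in A) (normal_pdf 0 (Num.sqrt v) x)%:E)%E; first by [].
  by apply: eq_integral => x _; rewrite normal_pdf_gpdf.
Qed.

Lemma ge0_integral_gauss0 f : measurable_fun setT f ->
  (\int[gauss 0]_x f x = f 0%R)%E.
Proof. by move=> mf; rewrite /gauss eqxx integral_dirac// diracT mul1e. Qed.

Local Opaque gauss.

Lemma measurable_shift l t : measurable_fun setT (fun x : R => l * x + t).
Proof. by apply: measurable_funD => //; exact: measurable_funM. Qed.

Lemma measurable_gauss_conv v f : measurable_fun setT f ->
  (forall x, (0 <= f x)%E) ->
  measurable_fun setT (fun x : R => \int[gauss v]_y f (x + y)%R)%E.
Proof.
move=> mf f0.
apply: (@measurable_fun_fubini_tonelli_F _ _ _ _ _ (gauss v)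
  (fun z : R * R => f (z.1 + z.2))) => //.
by apply: measurableT_comp => //; exact: measurable_funD.
Qed.

Lemma gauss_scale l v f : 0 <= v -> measurable_fun setT f ->
    (forall x, (0 <= f x)%E) ->
  (\int[gauss v]_x f (l * x)%R = \int[gauss (l ^+ 2 * v)]_x f x)%E.
Proof.
rewrite le_eqVlt => /predU1P[<-|v0] mf f0.
  rewrite mulr0 !ge0_integral_gauss0 ?mulr0//.
  by apply: measurableT_comp => //; exact: measurable_funM.
have [->|l0] := eqVneq l 0.
  rewrite expr0n/= mul0r [RHS]ge0_integral_gauss0//.
  under eq_integral do rewrite mul0r.
  exact: integral_cst_prob.
have lv0 : 0 < l ^+ 2 * v by rewrite mulr_gt0// exprn_even_gt0.
have mfl : measurable_fun setT (fun x : R => f (l * x)).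
  by apply: measurableT_comp => //; exact: measurable_funM.
rewrite [LHS](ge0_integral_gauss v0 mfl (fun x => f0 _)).
rewrite [RHS](ge0_integral_gauss lv0 mf f0) -[RHS](@lebesgue_affine l 0 _ l0); last 2 first.
- by apply: emeasurable_funM => //; apply/measurable_EFinP; exact: measurable_gpdf.
- by move=> x; rewrite mule_ge0// lee_fin gpdf_ge0.
rewrite -ge0_integralZl; last 4 first.
- exact: measurableT.
- apply: emeasurable_funM.
    by apply: measurableT_comp => //; exact: measurable_shift.
  apply/measurable_EFinP; apply: measurableT_comp; first exact: measurable_gpdf.
  exact: measurable_shift.
- by move=> x _; rewrite mule_ge0// lee_fin gpdf_ge0.
- by rewrite lee_fin.
apply: eq_integral => x _; rewrite addr0 muleCA; congr (_ * _)%E.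
rewrite -EFinM /gpdf; congr EFin; rewrite [RHS]mulrA; congr (_ * expR _).
  have -> : 2 * pi * (l ^+ 2 * v) = l ^+ 2 * (2 * pi * v) by ring.
  rewrite [in RHS](sqrtrM (2 * pi * v) (sqr_ge0 l)) sqrtr_sqr invfM mulrA divff ?mul1r//.
  by rewrite normr_eq0.
by field; rewrite l0 gt_eqF.
Qed.

Lemma gauss_conv u v f : 0 <= u -> 0 <= v -> measurable_fun setT f ->
    (forall x, (0 <= f x)%E) ->
  (\int[gauss u]_x \int[gauss v]_y f (x + y)%R = \int[gauss (u + v)]_x f x)%E.
Proof.
rewrite le_eqVlt => /predU1P[<-|u0] v0 mf f0.
  rewrite [LHS](ge0_integral_gauss0 (measurable_gauss_conv v mf f0)) add0r.
  by apply: eq_integral => x _; rewrite add0r.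
move: v0; rewrite le_eqVlt => /predU1P[<-|v0].
  rewrite addr0; apply: eq_integral => x _; rewrite [LHS]ge0_integral_gauss0 ?addr0//.
  by apply: measurableT_comp => //; exact: measurable_funD.
have uv0 : 0 < u + v by exact: addr_gt0.
have mg w : measurable_fun setT (fun x : R => (gpdf w x)%:E).
  by apply/measurable_EFinP; exact: measurable_gpdf.
have mfs x : measurable_fun setT (fun y : R => f (x + y)).
  by apply: measurableT_comp => //; exact: measurable_funD.
have i0 x : (0 <= \int[gauss v]_y f (x + y)%R)%E by exact: integral_ge0.
rewrite [LHS](ge0_integral_gauss u0 (measurable_gauss_conv _ mf f0) i0).
rewrite [RHS](ge0_integral_gauss uv0 mf f0).
transitivity (\int[leb]_x \int[leb]_y
    (f y * (gpdf u x * gpdf v (y - x))%:E))%E.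
  apply: eq_integral => x _.
  rewrite (ge0_integral_gauss v0 (mfs x) (fun y => f0 _)).
  rewrite -(@lebesgue_affine 1 (- x) _ (oner_neq0 _)); last 2 first.
  - by apply: emeasurable_funM.
  - by move=> y; rewrite mule_ge0// lee_fin gpdf_ge0.
  rewrite normr1 mul1e -ge0_integralZr; last 4 first.
  - exact: measurableT.
  - apply: emeasurable_funM.
      by apply: (measurableT_comp (mfs x)); exact: measurable_shift.
    by apply: (measurableT_comp (mg v)); exact: measurable_shift.
  - by move=> y _; rewrite mule_ge0// lee_fin gpdf_ge0.
  - by rewrite lee_fin gpdf_ge0.
  apply: eq_integral => y _.
  by rewrite mul1r [x + _]addrC subrK -muleA -EFinM [gpdf v _ * _]mulrC.
pose h (z : measurableTypeR R * measurableTypeR R) :=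
  (f z.2 * (gpdf u z.1 * gpdf v (z.2 - z.1))%:E)%E.
have mh : measurable_fun setT h.
  apply: emeasurable_funM; first exact: measurableT_comp.
  apply/measurable_EFinP; apply: measurable_funM.
    by apply: measurableT_comp; first exact: measurable_gpdf.
  apply: measurableT_comp; first exact: measurable_gpdf.
  exact: measurable_funB.
have h0 z : (0 <= h z)%E by rewrite mule_ge0// lee_fin mulr_ge0// gpdf_ge0.
rewrite [LHS](@fubini_tonelli _ _ _ _ _ leb leb h mh h0).
apply: eq_integral => y _; rewrite /h/=.
rewrite ge0_integralZl; last 4 first.
- exact: measurableT.
- apply/measurable_EFinP; apply: measurable_funM; first exact: measurable_gpdf.
  apply: measurableT_comp; first exact: measurable_gpdf.
  exact: measurable_funB.
- by move=> x _; rewrite lee_fin mulr_ge0// gpdf_ge0.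
- exact: f0.
congr (_ * _)%E.
(* Completing the square in [x]: given that the sum is [y], the first summand has law N(u y / (u +
   v), u v / (u + v)). The density of this conditional law integrates to 1 and leaves the density of
   N(0, u + v) at [y]. *)
rewrite -[RHS]mule1 -(@integral_gpdf (u * v / (u + v)) (u / (u + v) * y)); last first.
  by rewrite divr_gt0// mulr_gt0.
rewrite -ge0_integralZl; last 4 first.
- exact: measurableT.
- by apply: (measurableT_comp (mg _)); exact: measurable_funB.
- by move=> x _; rewrite lee_fin gpdf_ge0.
- by rewrite lee_fin gpdf_ge0.
apply: eq_integral => x _; rewrite -EFinM; congr EFin.
rewrite /gpdf mulrACA -expRD [RHS]mulrACA -expRD; congr (_ * expR _).
  rewrite -!invfM -!sqrtrM ?mulr_ge0 ?pi_ge0 ?ltW//.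
  congr (Num.sqrt _)^-1; field; exact: lt0r_neq0.
by field; rewrite !gt_eqF.
Qed.

(** Tilting N(0, v) by exp(l x^2) gives N(0, v / (1 - 2 l v)) up to the constant on the right. *)
Lemma gauss_expR_sqr v l : 0 <= v -> 2 * l * v < 1 ->
  (\int[gauss v]_x (expR (l * x ^+ 2))%:E = ((Num.sqrt (1 - 2 * l * v))^-1)%:E)%E.
Proof.
have me : measurable_fun setT (fun x : R => (expR (l * x ^+ 2))%:E).
  apply/measurable_EFinP; apply: measurableT_comp => //.
  by apply: measurable_funM => //; exact: measurable_funX.
rewrite le_eqVlt => /predU1P[<- _|v0 lv].
  by rewrite [LHS]ge0_integral_gauss0// expr0n/= !mulr0 expR0 subr0 sqrtr1 invr1.
have lv0 : 0 < 1 - 2 * l * v by rewrite subr_gt0.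
rewrite [LHS](ge0_integral_gauss v0 me); last by move=> x; rewrite lee_fin expR_ge0.
rewrite -[RHS]mule1 -(@integral_gpdf (v / (1 - 2 * l * v)) 0); last by rewrite divr_gt0.
rewrite -ge0_integralZl; last 4 first.
- exact: measurableT.
- apply/measurable_EFinP; apply: measurableT_comp; first exact: measurable_gpdf.
  exact: measurable_funB.
- by move=> x _; rewrite lee_fin gpdf_ge0.
- by rewrite lee_fin invr_ge0 sqrtr_ge0.
apply: eq_integral => x _; rewrite -!EFinM /gpdf subr0; congr EFin.
rewrite mulrCA -expRD [RHS]mulrA; congr (_ * expR _).
  rewrite -!invfM -!sqrtrM ?mulr_ge0 ?pi_ge0 ?ltW//.
  congr (Num.sqrt _)^-1; field; exact: lt0r_neq0.
field; by rewrite !gt_eqF.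
Qed.

(* The exponent [y ^ 2 / 2 v] cancels the density of [gauss v]. *)
Lemma gauss_expR_sqr_shift v rho m : 0 < v -> 0 < rho ->
  (\int[gauss v]_y (expR (y ^+ 2 / (2 * v) - (y - m) ^+ 2 / (2 * rho)))%:E =
   (Num.sqrt (rho / v))%:E)%E.
Proof.
move=> v0 rho0.
rewrite [LHS](ge0_integral_gauss v0); last 2 first.
- apply/measurable_EFinP; apply: measurableT_comp => //.
  apply: measurable_funB; apply: measurable_funM => //; apply: measurable_funX => //.
  exact: measurable_funB.
- by move=> x; rewrite lee_fin expR_ge0.
rewrite -[RHS]mule1 -(integral_gpdf m rho0).
rewrite -ge0_integralZl; last 4 first.
- exact: measurableT.
- apply/measurable_EFinP; apply: measurableT_comp; first exact: measurable_gpdf.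
  exact: measurable_funB.
- by move=> x _; rewrite lee_fin gpdf_ge0.
- by rewrite lee_fin sqrtr_ge0.
apply: eq_integral => x _; rewrite -!EFinM /gpdf; congr EFin.
rewrite mulrCA -expRD [RHS]mulrA; congr (_ * expR _); last by ring.
have -> : 2 * pi * rho = (rho / v) * (2 * pi * v) by field; rewrite gt_eqF.
have rv0 : 0 <= rho / v by rewrite divr_ge0// ltW.
rewrite [in RHS](sqrtrM (2 * pi * v) rv0) invfM mulrA divff ?mul1r//.
by rewrite gt_eqF// sqrtr_gt0 divr_gt0.
Qed.

(** The density of N(0, s) at [x + t] divided by the density of N(0, b) at [x]. *)
Definition gauss_ratio s b (x t : R) : R :=
  Num.sqrt (b / s) * expR (x ^+ 2 / (2 * b) - (x + t) ^+ 2 / (2 * s)).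

Lemma gauss_ratio_ge0 s b x t : 0 <= gauss_ratio s b x t.
Proof. by rewrite mulr_ge0// ?sqrtr_ge0 ?expR_ge0. Qed.

Lemma measurable_gauss_ratio s b t : measurable_fun setT (gauss_ratio s b ^~ t).
Proof.
apply: measurable_funM => //; apply: measurableT_comp => //.
apply: measurable_funB; apply: measurable_funM => //; apply: measurable_funX => //.
exact: measurable_funD.
Qed.

Lemma gauss_shift s b t f : 0 < s -> 0 < b -> measurable_fun setT f ->
    (forall x, (0 <= f x)%E) ->
  (\int[gauss s]_x f x =
   \int[gauss b]_x ((gauss_ratio s b x t)%:E * f (x + t)%R))%E.
Proof.
move=> s0 b0 mf f0.
have mft : measurable_fun setT (fun x : R => f (x + t)).
  by apply: measurableT_comp => //; exact: measurable_funD.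
rewrite [LHS](ge0_integral_gauss s0 mf f0) [RHS](ge0_integral_gauss b0); last 2 first.
- by apply: emeasurable_funM => //; apply/measurable_EFinP; exact: measurable_gauss_ratio.
- by move=> x; rewrite mule_ge0// lee_fin gauss_ratio_ge0.
rewrite -[LHS](@lebesgue_affine 1 t _ (oner_neq0 _)); last 2 first.
- by apply: emeasurable_funM => //; apply/measurable_EFinP; exact: measurable_gpdf.
- by move=> x; rewrite mule_ge0// lee_fin gpdf_ge0.
rewrite normr1 mul1e; apply: eq_integral => x _; rewrite mul1r.
rewrite muleC -muleA [(f _ * _)%E]muleC muleA; congr (_ * _)%E.
rewrite -EFinM; congr EFin; rewrite /gauss_ratio /gpdf.
rewrite mulrACA -expRD; congr (_ * expR _); last by ring.
have -> : 2 * pi * b = (b / s) * (2 * pi * s) by field; rewrite gt_eqF.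
have bs0 : 0 <= b / s by rewrite divr_ge0// ltW.
rewrite [in RHS](sqrtrM (2 * pi * s) bs0) invfM mulrA divff ?mul1r//.
by rewrite gt_eqF// sqrtr_gt0 divr_gt0.
Qed.

End gauss.

(** * Probabilities of boolean events *)

Section probability_of_predicate.
Context d (T : measurableType d) (R : realType) (P : probability T R).
Implicit Types a b : T -> bool.

(** Events are boolean because the encoder and the decoder branch on them; their probabilities are
    real so that linear arithmetic applies. *)
Definition pr b : R := fine (P [set x | b x]).

Lemma measurable_pred b : measurable_fun setT b -> measurable [set x | b x].
Proof.
move=> mb; rewrite (_ : [set x | b x] = setT `&` b @^-1` [set true]).
  exact: mb.
by rewrite setTI; apply/seteqP; split.
Qed.

Lemma prE b : measurable_fun setT b -> P [set x | b x] = (pr b)%:E.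
Proof.
by move=> mb; rewrite /pr fineK//; apply: fin_num_measure; exact: measurable_pred.
Qed.

Lemma pr_ge0 b : 0 <= pr b.
Proof. exact/fine_ge0/measure_ge0. Qed.

Lemma pr_le1 b : measurable_fun setT b -> pr b <= 1.
Proof.
by move=> mb; rewrite -lee_fin -prE//; apply: probability_le1; exact: measurable_pred.
Qed.

Lemma le_pr a b : measurable_fun setT a -> measurable_fun setT b ->
  (forall x, a x -> b x) -> pr a <= pr b.
Proof.
move=> ma mb ab; rewrite -lee_fin -!prE//.
by apply: le_measure; rewrite ?inE; [exact: measurable_pred|exact: measurable_pred|].
Qed.

Lemma pr_or a b : measurable_fun setT a -> measurable_fun setT b ->
  pr (fun x => a x || b x) <= pr a + pr b.
Proof.
move=> ma mb; rewrite -lee_fin EFinD -!prE//; last exact: measurable_or.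
rewrite (_ : [set x | a x || b x] = [set x | a x] `|` [set x | b x]).
  by apply: measureU2; exact: measurable_pred.
by apply/seteqP; split => x /= /orP.
Qed.

Lemma pr_or_disjoint a b : measurable_fun setT a -> measurable_fun setT b ->
  (forall x, a x -> ~~ b x) -> pr (fun x => a x || b x) = pr a + pr b.
Proof.
move=> ma mb ab; apply: EFin_inj; rewrite EFinD -!prE//; last exact: measurable_or.
rewrite (_ : [set x | a x || b x] = [set x | a x] `|` [set x | b x]).
  apply: measureU; [exact: measurable_pred|exact: measurable_pred|].
  by apply/seteqP; split => x //= [ax bx]; have := ab _ ax; rewrite bx.
by apply/seteqP; split => x /= /orP.
Qed.

Lemma pr_false : pr xpred0 = 0.
Proof. by rewrite /pr (_ : [set x | false] = set0) ?measure0//; apply/seteqP; split. Qed.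

Lemma measurable_has (I : Type) (h : I -> T -> bool) (s : seq I) :
  (forall i, measurable_fun setT (h i)) ->
  measurable_fun setT (fun x => has (h^~ x) s).
Proof.
move=> mh; elim: s => [|i s IH] /=; first exact: measurable_cst.
exact: measurable_or.
Qed.

Lemma pr_and_has (I : Type) a (h : I -> T -> bool) (s : seq I) :
  measurable_fun setT a -> (forall i, measurable_fun setT (h i)) ->
  pr (fun x => a x && has (h^~ x) s) <= \sum_(i <- s) pr (fun x => a x && h i x).
Proof.
move=> ma mh; elim: s => [|i s IH] /=.
  rewrite big_nil (_ : (fun x => _) = xpred0) ?pr_false//.
  by apply/funext => x; rewrite andbF.
rewrite big_cons; under eq_fun do rewrite andb_orr.
apply: le_trans (pr_or _ _) _; first exact: measurable_and.
  by apply: measurable_and => //; exact: measurable_has.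
by rewrite lerD2l.
Qed.

End probability_of_predicate.

(** * Greedy choice of a codebook *)

Section greedy_codebook.
Context dW dE (W : measurableType dW) (E : measurableType dE) (R : realType).
Variables (nu : probability W R) (mu : probability E R).
Variables (fit flaw : W * E -> bool) (hit : W -> W * E -> bool).
Hypotheses (mfit : measurable_fun setT fit) (mflaw : measurable_fun setT flaw)
  (mhit : forall w, measurable_fun setT (hit w)).

Definition covered (ws : seq W) (e : E) : bool := has (fun w => fit (w, e)) ws.

(* [prev] collects the words preceding [ws] in the decoder's list; [b] tells
   whether [ws] having no word that fits [e] counts as a failure. *)
Fixpoint fail (b : bool) (prev ws : seq W) (e : E) : bool :=
  if ws is w :: ws' then
    if fit (w, e) then flaw (w, e) || has (fun w' => hit w' (w, e)) prev
    else fail b (rcons prev w) ws' e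
  else b.

Let msec (h : W * E -> bool) w : measurable_fun setT h ->
  measurable_fun setT (fun e => h (w, e)).
Proof. by move=> mh; exact: measurableT_comp. Qed.

Lemma measurable_covered ws : measurable_fun setT (covered ws).
Proof. by apply: measurable_has => w; exact: msec. Qed.

Lemma measurable_fail b prev ws : measurable_fun setT (fail b prev ws).
Proof.
elim: ws prev => [|w ws IH] prev /=; first exact: measurable_cst.
apply: measurable_fun_ifT => //; first exact: msec.
apply: measurable_or; first exact: msec.
by apply: (measurable_has _ (h := fun w' e => hit w' (w, e))) => w'; exact: msec.
Qed.

(** A new word at the end changes the outcome only for environments that no earlier word of the list
    covers. Its cost can thus be compared with its gain in coverage, which is what makes the choice
    from left to right possible. *)
Lemma fail_rcons prev ws w e : fail false prev (rcons ws w) e =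
  fail false prev ws e || [&& ~~ covered ws e, fit (w, e) &
    flaw (w, e) || has (fun w' => hit w' (w, e)) (prev ++ ws)].
Proof.
elim: ws prev => [|w' ws IH] prev /=; first by rewrite cats0; case: ifP.
case: ifP => _ /=; first by rewrite orbF.
by rewrite IH cat_rcons.
Qed.

Lemma fail_true prev ws e :
  fail true prev ws e = fail false prev ws e || ~~ covered ws e.
Proof. by elim: ws prev => //= w ws IH prev; case: ifP => //=; rewrite orbF. Qed.

Lemma covered_rcons ws w e : covered (rcons ws w) e = covered ws e || fit (w, e).
Proof. by rewrite /covered has_rcons orbC. Qed.

(** [p] is the scale at which a word drawn from [nu] fits. The rates [eps] of flaws and [tau] of
    confusions with one earlier word are relative to [p], so that [p] drops out of the comparison of
    cost and gain. *)
Variables (p delta eps tau : R).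
Hypotheses (p0 : 0 < p) (delta0 : 0 < delta).
Hypothesis fit_lb : forall U : E -> bool, measurable_fun setT U ->
  ((p * (pr mu U - delta))%:E <=
   \int[nu]_w (pr mu (fun e => U e && fit (w, e)))%:E)%E.
Hypothesis flaw_ub :
  (\int[nu]_w (pr mu (fun e => fit (w, e) && flaw (w, e)))%:E <= (p * eps)%:E)%E.
Hypothesis hit_ub : forall w',
  (\int[nu]_w (pr mu (fun e => fit (w, e) && hit w' (w, e)))%:E <= (p * tau)%:E)%E.

Lemma measurable_pr_section (h : W * E -> bool) : measurable_fun setT h ->
  measurable_fun setT (fun w => (pr mu (fun e => h (w, e)))%:E).
Proof.
move=> mh; have := measurable_fun_xsection mu (measurable_pred mh).
apply: eq_measurable_fun => w _ /=.
rewrite -prE; last exact: msec.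
by congr (mu _); apply/seteqP; split => e; rewrite /xsection/= inE.
Qed.

(* Otherwise the integrals over [w] of both sides contradict [fit_lb] against
   [flaw_ub] and [hit_ub]. *)
Lemma greedy_step (U : E -> bool) (prev : seq W) :
    measurable_fun setT U -> 3 * delta < pr mu U ->
    eps + (size prev)%:R * tau <= delta ^+ 2 ->
  exists w, p * delta ^+ 2 + pr mu (fun e => [&& U e, fit (w, e) &
      flaw (w, e) || has (fun w' => hit w' (w, e)) prev])
    <= delta * pr mu (fun e => U e && fit (w, e)).
Proof.
move=> mU U3 small; apply: contrapT => /forallNP none.
have mUfit : measurable_fun setT (fun z : W * E => U z.2 && fit z).
  by apply: measurable_and => //; exact: measurableT_comp.
have mG0 : measurable_fun setT (fun z : W * E => fit z && flaw z).
  exact: measurable_and.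
have mG w' : measurable_fun setT (fun z : W * E => fit z && hit w' z).
  exact: measurable_and.
pose F w := pr mu (fun e => U e && fit (w, e)).
pose G0 w := pr mu (fun e => fit (w, e) && flaw (w, e)).
pose G w' w := pr mu (fun e => fit (w, e) && hit w' (w, e)).
have FG w : delta * F w <= p * delta ^+ 2 + (G0 w + \sum_(w' <- prev) G w' w).
  have /negP := none w; rewrite -ltNge => /ltW /le_trans; apply.
  rewrite lerD2l.
  apply: (@le_trans _ _ (pr mu (fun e => (fit (w, e) && flaw (w, e)) ||
      (fit (w, e) && has (fun w' => hit w' (w, e)) prev)))).
    apply: le_pr.
    - apply: measurable_and => //; apply: measurable_and; first exact: msec.
      apply: measurable_or; first exact: msec.
      by apply: (measurable_has _ (h := fun w' e => hit w' (w, e))) => w'; exact: msec.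
    - apply: measurable_or; first exact: (msec w mG0).
      apply: measurable_and; first exact: msec.
      by apply: (measurable_has _ (h := fun w' e => hit w' (w, e))) => w'; exact: msec.
    - by move=> e /and3P[_ -> ->].
  apply: le_trans (pr_or _ _ _) _; first exact: (msec w mG0).
    apply: measurable_and; first exact: msec.
    by apply: (measurable_has _ (h := fun w' e => hit w' (w, e))) => w'; exact: msec.
  rewrite lerD2l; apply: (pr_and_has _ (h := fun w' e => hit w' (w, e))).
    exact: msec.
  by move=> w'; exact: msec.
have IG : (\int[nu]_w (\sum_(w' <- prev) G w' w)%:E <=
    (p * ((size prev)%:R * tau))%:E)%E.
  under eq_integral do rewrite -sumEFin.
  rewrite ge0_integral_sum//; last 2 first.
  - by move=> w'; exact: (measurable_pr_section (mG w')).
  - by move=> w' w _; rewrite lee_fin pr_ge0.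
  elim: prev {small none FG} => [|w' s IH]; first by rewrite big_nil mul0r mulr0.
  rewrite big_cons/= -natr1 mulrDl mul1r mulrDr EFinD [leLHS]addeC.
  by apply: leeD => //; exact: hit_ub.
have mGs : measurable_fun setT (fun w => (\sum_(w' <- prev) G w' w)%:E).
  under eq_fun do rewrite -sumEFin.
  by apply: emeasurable_sum => w'; exact: (measurable_pr_section (mG w')).
have : (\int[nu]_w (delta * F w)%:E <=
    \int[nu]_w ((p * delta ^+ 2)%:E + ((G0 w)%:E + (\sum_(w' <- prev) G w' w)%:E)))%E.
  apply: ge0_le_integral => //.
  - by move=> w _; rewrite lee_fin mulr_ge0 ?pr_ge0// ltW.
  - apply/measurable_EFinP; apply: measurable_funM => //; apply/measurable_EFinP.
    exact: (measurable_pr_section mUfit).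
  - apply: emeasurable_funD => //; apply: emeasurable_funD => //.
    exact: (measurable_pr_section mG0).
  - by move=> w _; rewrite -!EFinD lee_fin.
rewrite ge0_integralD//; last 3 first.
- by move=> w _; rewrite lee_fin mulr_ge0 ?exprn_ge0// ltW.
- by move=> w _; rewrite adde_ge0// lee_fin ?pr_ge0// sumr_ge0// => *; exact: pr_ge0.
- by apply: emeasurable_funD => //; exact: (measurable_pr_section mG0).
rewrite ge0_integralD//; last 3 first.
- by move=> w _; rewrite lee_fin pr_ge0.
- exact: (measurable_pr_section mG0).
- by move=> w _; rewrite lee_fin sumr_ge0// => *; exact: pr_ge0.
rewrite integral_cst_prob.
have -> : (\int[nu]_w (delta * F w)%:E = delta%:E * \int[nu]_w (F w)%:E)%E.
  rewrite -ge0_integralZl//.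
  - exact: (measurable_pr_section mUfit).
  - by move=> w _; rewrite lee_fin pr_ge0.
  - by rewrite lee_fin ltW.
move=> le1.
have : ((delta * (p * (pr mu U - delta)))%:E <=
    (p * delta ^+ 2 + (p * eps + p * ((size prev)%:R * tau)))%:E)%E.
  rewrite EFinM; apply: le_trans; last first.
    rewrite !EFinD; apply: le_trans le1 _.
    by rewrite leeD2l//; apply: leeD.
  by rewrite lee_pmul2l//; exact: fit_lb.
rewrite lee_fin; apply/negP; rewrite -ltNge.
(* As [pr mu U - delta] exceeds [2 * delta], the left side exceeds [2 * p * delta ^+ 2], while the
   right side is at most that: this is the origin of the threshold [3 * delta]. *)
have h : delta * (3 * delta) < delta * pr mu U by rewrite ltr_pM2l.
rewrite -!mulrDr mulrCA ltr_pM2l//; lra.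
Qed.

(* Each word given by [greedy_step] covers a set of probability at least
   [p * delta], so that at most [1 / (p * delta)] words are needed. *)
Lemma greedy_list (i : nat) (prev : seq W) :
    eps + (size prev + i)%:R * tau <= delta ^+ 2 -> 0 <= tau ->
  exists ws : seq W, [/\ (size ws <= i)%N,
    pr mu (fail false prev ws) <= delta * pr mu (covered ws) &
    pr mu (fun e => ~~ covered ws e) <= 3 * delta \/
    i%:R * (p * delta) <= pr mu (covered ws)].
Proof.
move=> + tau0; elim: i => [|i IH] small.
  exists [::]; split => //; last by right; rewrite mul0r pr_ge0.
  rewrite (_ : fail _ _ _ = xpred0) ?pr_false; last by apply/funext.
  by rewrite mulr_ge0 ?pr_ge0// ltW.
have [|ws [sws fws cws]] := IH.
  apply: le_trans small; rewrite lerD2l ler_wpM2r// ler_nat.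
  by rewrite leq_add2l.
have [small_u|big_u] := leP (pr mu (fun e => ~~ covered ws e)) (3 * delta).
  by exists ws; split => //; [exact: leqW|left].
case: cws => cws; first by move: big_u; rewrite ltNge cws.
have mcov := measurable_covered ws.
have [] := @greedy_step (fun e => ~~ covered ws e) (prev ++ ws) _ big_u.
- exact: measurable_neg.
- apply: le_trans small; rewrite lerD2l ler_wpM2r// ler_nat size_cat leq_add2l.
  exact: leqW.
move=> w.
set G := pr mu _; set F := pr mu _ => FG.
have mF : measurable_fun setT (fun e => ~~ covered ws e && fit (w, e)).
  by apply: measurable_and; [exact: measurable_neg|exact: msec].
have covE : pr mu (covered (rcons ws w)) = pr mu (covered ws) + F.
  rewrite -pr_or_disjoint//; last by move=> e ->.
  congr pr; apply/funext => e; rewrite covered_rcons.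
  by case: (covered ws e).
have G0 : 0 <= G by exact: pr_ge0.
exists (rcons ws w); rewrite size_rcons; split => //.
- rewrite covE; apply: (@le_trans _ _ (pr mu (fail false prev ws) + G)).
    rewrite (funext (fail_rcons prev ws w)).
    apply: pr_or; first exact: measurable_fail.
    apply: measurable_and; first exact: measurable_neg.
    apply: measurable_and; first exact: msec.
    apply: measurable_or; first exact: msec.
    by apply: (measurable_has _ (h := fun w' e => hit w' (w, e))) => w'; exact: msec.
  have pd0 : 0 <= p * delta ^+ 2 by rewrite mulr_ge0 ?exprn_ge0// ltW.
  by rewrite mulrDr; lra.
- right; rewrite covE -natr1 mulrDl mul1r lerD//.
  have : p * delta ^+ 2 <= delta * F by lra.
  by rewrite expr2 mulrCA ler_pM2l.
Qed.

(** The list of a message is chosen with all lists of smaller messages, at most [M * L] words in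
    total, as predecessors. It cannot run out of words, for [L] of them would cover more than
    probability 1. Of the bound [4 * delta], one [delta] is for covered environments and [3 * delta]
    for uncovered ones. *)
Lemma greedy_codebook (M L : nat) : 1 < L%:R * (p * delta) -> 0 <= tau ->
    eps + (M * L)%:R * tau <= delta ^+ 2 ->
  exists ws : nat -> seq W, forall m, (m < M)%N -> (size (ws m) <= L)%N /\
    pr mu (fail true (flatten [seq ws j | j <- iota 0 m]) (ws m)) <= 4 * delta.
Proof.
move=> L1 tau0; elim: M => [|M IH] small; first by exists (fun=> [::]).
have [|ws wsP] := IH.
  apply: le_trans small; rewrite lerD2l ler_wpM2r// ler_nat leq_mul2r.
  by rewrite leqnSn orbT.
pose prev := flatten [seq ws j | j <- iota 0 M].
have sprev : (size prev <= M * L)%N.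
  rewrite size_flatten /shape -map_comp sumnE big_map.
  rewrite -[M in leqRHS](size_iota 0) -sum1_size big_distrl/= big_seq [leqRHS]big_seq.
  apply: leq_sum => j; rewrite mem_iota mul1n => /andP[_ jM].
  by have [] := wsP j jM.
have [|w [sw fw cw]] := @greedy_list L prev _ tau0.
  apply: le_trans small; rewrite lerD2l ler_wpM2r// ler_nat mulSn addnC.
  by rewrite leq_add2l.
have mcov := measurable_covered w.
have cw' : pr mu (fun e => ~~ covered w e) <= 3 * delta.
  case: cw => // cw; have := pr_le1 mu mcov.
  by rewrite leNgt (lt_le_trans L1 cw).
exists (fun j => if (j < M)%N then ws j else w) => m.
rewrite ltnS => mM.
have -> : flatten [seq (if (j < M)%N then ws j else w) | j <- iota 0 m] =
          flatten [seq ws j | j <- iota 0 m].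
  congr flatten; apply/eq_in_map => j; rewrite mem_iota add0n => /andP[_ jm].
  by rewrite (leq_trans jm mM).
move: mM; rewrite leq_eqVlt => /predU1P[->|mM]; last by rewrite mM; exact: wsP.
rewrite ltnn; split => //.
rewrite (funext (fail_true _ w)).
apply: le_trans (pr_or _ _ _) _; first exact: measurable_fail.
  exact: measurable_neg.
have : delta * pr mu (covered w) <= delta by rewrite ler_piMr ?pr_le1// ltW.
lra.
Qed.

End greedy_codebook.

Definition first_match (T U : Type) (a : T -> bool) (f : T -> U) (u : U)
    (s : seq T) : U :=
  foldr (fun t acc => if a t then f t else acc) u s.

Lemma measurable_first_match d d' (T : measurableType d) (U : measurableType d')
    (I : Type) (a : I -> T -> bool) (f : I -> T -> U) (u : U) (s : seq I) :
    (forall i, measurable_fun setT (a i)) -> (forall i, measurable_fun setT (f i)) ->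
  measurable_fun setT (fun x => first_match (a^~ x) (f^~ x) u s).
Proof.
move=> ma mf; elim: s => [|i s IH]; first exact: measurable_cst.
exact: measurable_fun_ifT.
Qed.

(** Outside [fail], the first fitting word of the list is also the first word of the whole codebook
    that is typical for the output: it is typical for its own output, since otherwise it would be
    flawed, and no predecessor hits. Words after it, in particular [gl2], are never reached. The
    values [f] and [g] are arbitrary because encoder and decoder return different things. *)
Lemma fail_first_match dW dE (W : measurableType dW) (E : measurableType dE)
    (Y I : Type) (fit flaw : W * E -> bool) (typ : W -> Y -> bool)
    (y : W * E -> Y) (m : I) (gl1 gl2 : seq (I * W)) (ws : seq W) (e : E) :
    (forall w, ~~ typ w (y (w, e)) -> flaw (w, e)) ->
    ~~ fail fit flaw (fun w z => typ w (y z)) true (unzip2 gl1) ws e ->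
  exists w, [/\ fit (w, e), ~~ flaw (w, e),
    forall (U : Type) (f : W -> U) u,
      first_match (fun w => fit (w, e)) f u ws = f w &
    forall (V : Type) (g : I * W -> V) v,
      first_match (fun iw => typ iw.2 (y (w, e))) g v
        (gl1 ++ [seq (m, w) | w <- ws] ++ gl2) = g (m, w)].
Proof.
move=> typ_flaw; elim: ws gl1 => //= w ws IH gl1.
case: ifPn => [fitw|_].
  rewrite negb_or => /andP[nflaw nhit]; exists w; split => // V g v.
  elim: gl1 nhit {IH} => [|[i w'] gl1 IH] /=.
    by move=> _; case: ifPn => // /typ_flaw; rewrite (negPf nflaw).
  by rewrite negb_or => /andP[/negPf -> nhit]; exact: IH.
move=> nf; have [|w0 [h1 h2 h3 h4]] := IH (rcons gl1 (m, w)).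
  by rewrite /unzip2 map_rcons.
by exists w0; split => // V g v; rewrite -(h4 V g v) cat_rcons.
Qed.

Local Opaque gauss tuple_prob.

(** * Gaussian vectors *)

Section gaussian_vectors.
Context {R : realType}.
Implicit Types (n : nat) (u v b s l : R).

Definition gvec n v : probability (n.-tuple R) R := tuple_prob (gauss v) n.

Definition vadd n (x t : n.-tuple R) : n.-tuple R :=
  [tuple tnth x i + tnth t i | i < n].

Lemma measurable_comp_tnth d d' (T : measurableType d) (U : measurableType d')
    n (f : T -> n.-tuple U) i :
  measurable_fun setT f -> measurable_fun setT (fun x => tnth (f x) i).
Proof. by move=> mf; exact: (measurableT_comp (measurable_tnth i) mf). Qed.

Lemma measurable_mktuple d d' (T : measurableType d) (U : measurableType d')
    n (f : 'I_n -> T -> U) :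
  (forall i, measurable_fun setT (f i)) ->
  measurable_fun setT (fun x => [tuple f i x | i < n]).
Proof.
move=> mf; apply/measurable_fun_tnthP => i.
by apply: (eq_measurable_fun (f i)) (mf i) => x _; rewrite /comp tnth_mktuple.
Qed.

Lemma measurable_vadd d (T : measurableType d) n (f g : T -> n.-tuple R) :
  measurable_fun setT f -> measurable_fun setT g ->
  measurable_fun setT (fun x => vadd (f x) (g x)).
Proof.
move=> mf mg; apply: measurable_mktuple => i.
by apply: measurable_funD; exact: measurable_comp_tnth.
Qed.

Lemma tnth_behead_lift n (t : n.+1.-tuple R) i :
  tnth [tuple of behead t] i = tnth t (lift ord0 i).
Proof. by rewrite [in RHS](tuple_eta t) tnthS. Qed.

Lemma vadd_tcons n x (y : n.-tuple R) (t : n.+1.-tuple R) :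
  vadd (tcons (x, y)) t = tcons (x + thead t, vadd y [tuple of behead t]).
Proof.
apply: eq_from_tnth => i; rewrite tnth_mktuple.
case: (unliftP ord0 i) => [j|] ->; last by rewrite !tnth_tcons0.
by rewrite !tnth_tconsS tnth_mktuple tnth_behead_lift.
Qed.

(** Product form of [gauss_shift]. Two variances occur because a word taken alone has variance Var
    W, whereas its part independent of the observation has only variance [b]. *)
Lemma gvec_shift n s b (t : n.-tuple R) (f : n.-tuple R -> \bar R) :
    0 < s -> 0 < b -> measurable_fun setT f -> (forall x, (0 <= f x)%E) ->
  (\int[gvec n s]_w f w =
   \int[gvec n b]_x ((\prod_(i < n) (gauss_ratio s b (tnth x i) (tnth t i))%:E) *
     f (vadd x t)))%E.
Proof.
move=> s0 b0; elim: n t f => [|n IH] t f mf f0.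
  rewrite [LHS](ge0_integral_tuple0 (gauss s) mf).
  rewrite [RHS](ge0_integral_tuple0 (gauss b)); last first.
    apply: emeasurable_funM.
      by apply: measurable_prode => -[].
    by apply: (measurableT_comp mf); exact: measurable_vadd.
  by rewrite big_ord0 mul1e; congr f; exact/esym/tuple0.
have mr m (t' : m.-tuple R) : measurable_fun setT (fun x : m.-tuple R =>
    (\prod_(i < m) (gauss_ratio s b (tnth x i) (tnth t' i))%:E)%E).
  apply: measurable_prode => i; apply/measurable_EFinP.
  by apply: (measurableT_comp (measurable_gauss_ratio _ _ _)); exact: measurable_tnth.
have r0 m (t' x : m.-tuple R) :
    (0 <= \prod_(i < m) (gauss_ratio s b (tnth x i) (tnth t' i))%:E)%E.
  by apply: prode_ge0 => i _; rewrite lee_fin gauss_ratio_ge0.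
rewrite [LHS](ge0_integral_tupleS (gauss s) mf f0).
rewrite [RHS](ge0_integral_tupleS (gauss b)); last 2 first.
- apply: emeasurable_funM; first exact: mr.
  by apply: (measurableT_comp mf); exact: measurable_vadd.
- by move=> x; rewrite mule_ge0.
pose t' : n.-tuple R := [tuple of behead t].
have mft x : measurable_fun setT (fun y : n.-tuple R => f (tcons (x, y))).
  exact: (measurableT_comp mf (measurable_tconsr x)).
under [LHS]eq_integral => x _.
  rewrite (IH t' _ (mft x) (fun=> f0 _)).
  over.
pose h (z : R * n.-tuple R) :=
  ((\prod_(i < n) (gauss_ratio s b (tnth z.2 i) (tnth t' i))%:E) *
   f (tcons (z.1, vadd z.2 t')))%E.
have mh : measurable_fun setT h.
  apply: emeasurable_funM; first exact: (measurableT_comp (mr n t') measurable_snd).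
  apply: (measurableT_comp mf); apply: (measurableT_comp (@measurable_tcons _ _ _)).
  by apply: measurable_fun_pair => //; exact: measurable_vadd.
have h0 z : (0 <= h z)%E by rewrite mule_ge0.
rewrite [LHS](@gauss_shift _ s b (thead t)
  (fun x => \int[gvec n b]_y h (x, y))%E s0 b0); last 2 first.
- exact: (@measurable_fun_fubini_tonelli_F _ _ _ _ _ (gvec n b) h mh h0).
- by move=> x; exact: integral_ge0.
apply: eq_integral => x _.
rewrite -ge0_integralZl; last 4 first.
- exact: measurableT.
- exact: (measurableT_comp mh).
- by move=> y _; exact: h0.
- by rewrite lee_fin gauss_ratio_ge0.
apply: eq_integral => y _; rewrite /h/= big_ord_recl muleA vadd_tcons.
congr (_ * _ * _)%E; apply: eq_bigr => i _; by rewrite tnth_tconsS tnth_behead_lift.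
Qed.

(** Convolution with N(0, v): integrating out one independent vector acts on the factor of each
    coordinate by this operator. *)
Definition conv v (f : R -> \bar R) (x : R) : \bar R := (\int[gauss v]_y f (x + y)%R)%E.

Lemma conv_ge0 v f x : (forall y, (0 <= f y)%E) -> (0 <= conv v f x)%E.
Proof. by move=> f0; exact: integral_ge0. Qed.

Lemma measurable_conv v f : measurable_fun setT f -> (forall y, (0 <= f y)%E) ->
  measurable_fun setT (conv v f).
Proof. exact: measurable_gauss_conv. Qed.

Lemma convD u v f x : 0 <= u -> 0 <= v -> measurable_fun setT f ->
  (forall y, (0 <= f y)%E) -> conv u (conv v f) x = conv (u + v) f x.
Proof.
move=> u0 v0 mf f0.
have mfx : measurable_fun setT (fun y : R => f (x + y)).
  by apply: (measurableT_comp mf); exact: measurable_funD.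
rewrite /conv -[RHS](gauss_conv u0 v0 mfx (fun=> f0 _)).
by apply: eq_integral => y _; apply: eq_integral => z _; rewrite addrA.
Qed.

Lemma gvec_conv n v l (f : 'I_n -> R -> \bar R) (x : 'I_n -> R) : 0 <= v ->
    (forall i, measurable_fun setT (f i)) -> (forall i y, (0 <= f i y)%E) ->
  (\int[gvec n v]_a \prod_(i < n) f i (x i + l * tnth a i)%R =
   \prod_(i < n) conv (l ^+ 2 * v) (f i) (x i))%E.
Proof.
move=> v0 mf f0.
have mfx i : measurable_fun setT (fun y : R => f i (x i + y)).
  by apply: (measurableT_comp (mf i)); exact: measurable_funD.
rewrite [LHS](@ge0_integral_tuple_prod _ _ _ _ _
    (fun i y => f i (x i + l * y)%R)); last 2 first.
- move=> i; apply: (measurableT_comp (mfx i)); exact: measurable_funM.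
- by move=> i y; exact: f0.
by apply: eq_bigr => i _; rewrite (gauss_scale l v0 (mfx i)).
Qed.

End gaussian_vectors.

Ltac measurable_proj :=
  repeat first [exact: measurable_fst | exact: measurable_snd | exact: measurable_id
    | apply: (measurableT_comp measurable_fst)
    | apply: (measurableT_comp measurable_snd)].

(** * Linear combinations of the channel variables *)

Section joint_law.
Context {R : realType} (n : nat).
Variables (Q vU N b : R).
Hypotheses (Q0 : 0 <= Q) (vU0 : 0 <= vU) (N0 : 0 <= N) (b0 : 0 <= b).

Let V := n.-tuple R.

Definition env : probability (V * V * V)%type R :=
  (((gvec n Q \x gvec n vU)%E : probability (V * V)%type R) \x gvec n N)%E.

Definition joint : probability (V * V * V * V)%type R := (env \x gvec n b)%E.

Definition lincomb (lS lU lZ lA : R) (z : V * V * V * V) (i : 'I_n) : R :=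
  lS * tnth z.1.1.1 i + lU * tnth z.1.1.2 i + lZ * tnth z.1.2 i + lA * tnth z.2 i.

Lemma measurable_lincomb lS lU lZ lA i :
  measurable_fun setT (fun z => lincomb lS lU lZ lA z i).
Proof.
by repeat (apply: measurable_funD); apply: measurable_funM => //;
  apply: measurable_comp_tnth; measurable_proj.
Qed.

(** Integrating out A, Z, U and S in turn convolves each factor with a Gaussian, and [convD] adds up
    the variances. Every tail estimate below concerns one linear combination at a time, so that no
    multivariate Gaussian law is needed. *)
Lemma joint_lincomb lS lU lZ lA (f : 'I_n -> R -> \bar R) :
    (forall i, measurable_fun setT (f i)) -> (forall i y, (0 <= f i y)%E) ->
  (\int[joint]_z \prod_(i < n) f i (lincomb lS lU lZ lA z i) =
   \prod_(i < n) \int[gauss (lS ^+ 2 * Q + lU ^+ 2 * vU + lZ ^+ 2 * N + lA ^+ 2 * b)]_x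
     f i x)%E.
Proof.
move=> mf f0.
have sq0 (l v : R) : 0 <= v -> 0 <= l ^+ 2 * v by move=> v0; apply: mulr_ge0 => //; exact: sqr_ge0.
rewrite [LHS]fubini_tonelli1; last 2 first.
- apply: measurable_prode => i; apply: (measurableT_comp (mf i)).
  exact: measurable_lincomb.
- by move=> z; exact: prode_ge0.
rewrite /fubini_F.
under [LHS]eq_integral => e _.
  rewrite (gvec_conv lA
    (fun i => lS * tnth e.1.1 i + lU * tnth e.1.2 i + lZ * tnth e.2 i) b0 mf f0).
  over.
pose f1 i := conv (lA ^+ 2 * b) (f i).
have mf1 i : measurable_fun setT (f1 i) by exact: (measurable_conv _ (mf i) (f0 i)).
have f10 i y : (0 <= f1 i y)%E by exact: (conv_ge0 _ _ (f0 i)).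
rewrite [LHS]fubini_tonelli1; last 2 first.
- apply: measurable_prode => i; apply: (measurableT_comp (mf1 i)).
  by repeat (apply: measurable_funD); apply: measurable_funM => //;
    apply: measurable_comp_tnth; measurable_proj.
- by move=> z; apply: prode_ge0 => i _; exact: f10.
rewrite /fubini_F.
under [LHS]eq_integral => e _.
  rewrite (gvec_conv lZ (fun i => lS * tnth e.1 i + lU * tnth e.2 i) N0 mf1 f10).
  over.
pose f2 i := conv (lZ ^+ 2 * N) (f1 i).
have mf2 i : measurable_fun setT (f2 i) by exact: (measurable_conv _ (mf1 i) (f10 i)).
have f20 i y : (0 <= f2 i y)%E by exact: (conv_ge0 _ _ (f10 i)).
rewrite [LHS]fubini_tonelli1; last 2 first.
- apply: measurable_prode => i; apply: (measurableT_comp (mf2 i)).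
  by repeat (apply: measurable_funD); apply: measurable_funM => //;
    apply: measurable_comp_tnth; measurable_proj.
- by move=> z; apply: prode_ge0 => i _; exact: f20.
rewrite /fubini_F.
under [LHS]eq_integral => e _.
  rewrite (gvec_conv lU (fun i => lS * tnth e i) vU0 mf2 f20).
  over.
pose f3 i := conv (lU ^+ 2 * vU) (f2 i).
have mf3 i : measurable_fun setT (f3 i) by exact: (measurable_conv _ (mf2 i) (f20 i)).
have f30 i y : (0 <= f3 i y)%E by exact: (conv_ge0 _ _ (f20 i)).
transitivity (\int[gvec n Q]_e \prod_(i < n) f3 i (0 + lS * tnth e i)%R)%E.
  by apply: eq_integral => e _; apply: eq_bigr => i _; rewrite add0r.
rewrite (gvec_conv lS (fun=> 0) Q0 mf3 f30); apply: eq_bigr => i _.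
have qN := sq0 lZ _ N0; have qb := sq0 lA _ b0.
have qU := sq0 lU _ vU0; have qQ := sq0 lS _ Q0.
have c2 : f2 i = conv (lZ ^+ 2 * N + lA ^+ 2 * b) (f i).
  by apply/funext => x; exact: (convD _ qN qb (mf i) (f0 i)).
have c3 : f3 i = conv (lU ^+ 2 * vU + (lZ ^+ 2 * N + lA ^+ 2 * b)) (f i).
  apply/funext => x; rewrite /f3 c2.
  by apply: (convD _ qU _ (mf i) (f0 i)); rewrite addr_ge0.
rewrite c3 (convD _ qQ _ (mf i) (f0 i)); last by rewrite !addr_ge0.
have -> : lS ^+ 2 * Q + (lU ^+ 2 * vU + (lZ ^+ 2 * N + lA ^+ 2 * b)) =
    lS ^+ 2 * Q + lU ^+ 2 * vU + lZ ^+ 2 * N + lA ^+ 2 * b by ring.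
by apply: eq_integral => x _; rewrite add0r.
Qed.

End joint_law.

Lemma pr_integral d (T : measurableType d) (R : realType) (P : probability T R)
    (b : T -> bool) : measurable_fun setT b ->
  ((pr P b)%:E = \int[P]_x ((b x)%:R)%:E)%E.
Proof.
move=> mb; rewrite -prE//.
rewrite -[[set x | b x]]setIT -(integral_indic P measurableT (measurable_pred mb)).
apply: eq_integral => x _; rewrite indicE; congr ((nat_of_bool _)%:R)%:E.
by apply/idP/idP; rewrite inE.
Qed.

Lemma measurable_natr_bool d (T : measurableType d) (R : realType) (b : T -> bool) :
  measurable_fun setT b -> measurable_fun setT (fun x => ((b x)%:R : R)%:E).
Proof.
move=> mb; apply/measurable_EFinP.
rewrite (_ : (fun x => _) = fun x => if b x then 1 else 0 : R).
  by apply: measurable_fun_ifT => //; exact: measurable_cst.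
by apply/funext => x; case: (b x).
Qed.

(** * Exponential tail and ball estimates *)

Section chernoff.
Context {R : realType} (n : nat).
Variables (Q vU N b : R).
Hypotheses (Q0 : 0 <= Q) (vU0 : 0 <= vU) (N0 : 0 <= N) (b0 : 0 <= b).
Variables (lS lU lZ lA : R).

Let L := @lincomb R n lS lU lZ lA.
Let sigma := lS ^+ 2 * Q + lU ^+ 2 * vU + lZ ^+ 2 * N + lA ^+ 2 * b.
Let J := @joint R n Q vU N b.

(** Markov's inequality for the exponential of the sum. The function [g] may vary with the
    coordinate so that [joint_hit] can centre a ball at an arbitrary vector. *)
Lemma joint_markov (g : 'I_n -> R -> R)
    (B : n.-tuple R * n.-tuple R * n.-tuple R * n.-tuple R -> bool) :
    (forall i, measurable_fun setT (g i)) -> measurable_fun setT B ->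
    (forall z, B z -> 0 <= \sum_(i < n) g i (L z i)) ->
  ((pr J B)%:E <= \prod_(i < n) \int[gauss sigma]_x (expR (g i x))%:E)%E.
Proof.
move=> mg mB Bg.
have me i : measurable_fun setT (fun x => (expR (g i x))%:E).
  by apply/measurable_EFinP; apply: measurableT_comp => //; exact: mg.
have e0 i x : (0 <= (expR (g i x))%:E)%E by rewrite lee_fin expR_ge0.
rewrite pr_integral// -(@joint_lincomb R n Q vU N b Q0 vU0 N0 b0 lS lU lZ lA
  (fun i x => (expR (g i x))%:E))//.
apply: ge0_le_integral => //.
- exact: measurable_natr_bool.
- apply: measurable_prode => i; apply: (measurableT_comp (me i)).
  exact: measurable_lincomb.
- move=> z _; rewrite prodEFin -expR_sum lee_fin.
  case: (boolP (B z)) => [/Bg|_]; last exact: expR_ge0.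
  by rewrite -ler_expR expR0.
Qed.

(** Minus the logarithm of this is (xi - ln (1 + xi)) / 2, the Cramer rate function of a squared
    standard Gaussian at 1 + xi. *)
Definition chernoff_rate (xi : R) : R := expR (- (xi / 2)) * Num.sqrt (1 + xi).

(* For [xi > 0] an upper tail bound, for [xi < 0] a lower tail bound. *)
Lemma joint_chernoff (v xi : R) : 0 < v -> -1 < xi -> 0 <= xi * (v - sigma) ->
  pr J (fun z => 0 <= xi * (\sum_(i < n) L z i ^+ 2 - n%:R * (v * (1 + xi)))) <=
  chernoff_rate xi ^+ n.
Proof.
move=> v0 xi1 xiv.
have xi0 : 0 < 1 + xi by lra.
(* The optimal exponent in the case [sigma = v], for which [1 - 2 * l * v] is the inverse of
   [1 + xi]. It has the sign of [xi], so the assumption on [v - sigma] makes the other cases only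
   better. *)
pose l := xi / (2 * v * (1 + xi)).
have vxi0 : 0 < (2 * v * (1 + xi))^-1 by rewrite invr_gt0 !mulr_gt0.
have lv : 2 * l * v = 1 - (1 + xi)^-1.
  by rewrite /l; field; rewrite !gt_eqF.
have lsigma : 2 * l * sigma <= 2 * l * v.
  rewrite -subr_ge0.
  have -> : 2 * l * v - 2 * l * sigma = xi * (v - sigma) * (2 * (2 * v * (1 + xi))^-1).
    by rewrite /l; ring.
  by rewrite mulr_ge0// mulr_ge0// ltW.
have l1 : 2 * l * sigma < 1.
  by apply: le_lt_trans lsigma _; rewrite lv ltrBlDr ltrDl invr_gt0.
have sigma0 : 0 <= sigma by rewrite !addr_ge0// mulr_ge0// sqr_ge0.
rewrite -lee_fin; apply: (le_trans (@joint_markov (fun _ x => l * x ^+ 2 - xi / 2) _ _ _ _)).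
- by move=> _ /=; apply: measurable_funB => //; apply: measurable_funM => //.
- apply: measurable_fun_ler => //; apply: measurable_funM => //.
  apply: measurable_funB => //; apply: measurable_sum => i.
  by apply: measurable_funX; exact: measurable_lincomb.
- move=> z Bz; rewrite big_split/= -mulr_sumr sumr_const card_ord -[X in _ + X]mulr_natr.
  set s := \sum_(i < n) _ in Bz *.
  have -> : l * s + - (xi / 2) * n%:R =
      (2 * v * (1 + xi))^-1 * (xi * (s - n%:R * (v * (1 + xi)))).
    by rewrite /l; field; rewrite !gt_eqF.
  by rewrite mulr_ge0// ltW.
rewrite (eq_bigr (fun=> (expR (- (xi / 2)) * (Num.sqrt (1 - 2 * l * sigma))^-1)%:E)); last first.
  move=> _ _.
  rewrite EFinM -(gauss_expR_sqr sigma0 l1) -ge0_integralZl; last 4 first.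
  - exact: measurableT.
  - apply/measurable_EFinP; apply: measurableT_comp => //.
    by apply: measurable_funM => //; exact: measurable_funX.
  - by move=> x _; rewrite lee_fin expR_ge0.
  - by rewrite lee_fin expR_ge0.
  by apply: eq_integral => x _; rewrite addrC expRD EFinM.
rewrite prodEFin prodr_const card_ord lee_fin lerXn2r
  ?nnegrE ?mulr_ge0 ?expR_ge0 ?invr_ge0 ?sqrtr_ge0//.
rewrite /chernoff_rate ler_wpM2l ?expR_ge0//.
rewrite -[1 + xi]invrK sqrtrV; last by rewrite invr_ge0 ltW.
rewrite lef_pV2 ?posrE ?sqrtr_gt0 ?invr_gt0 ?subr_gt0//.
by rewrite ler_sqrt ?invr_gt0//; lra.
Qed.

(** In the exponent x^2 / 2 sigma - (x - m)^2 / 2 rho the first term flattens the density of N(0,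
    sigma), which makes the bound independent of the centre [m]. The condition that the vector be
    long pays for that term. *)
Lemma joint_hit (rho y : R) (m : 'I_n -> R) : 0 < rho -> 0 < sigma ->
  pr J (fun z => (\sum_(i < n) (L z i - m i) ^+ 2 <= n%:R * rho) &&
                 (n%:R * y <= \sum_(i < n) L z i ^+ 2)) <=
  (expR ((1 - y / sigma) / 2) * Num.sqrt (rho / sigma)) ^+ n.
Proof.
move=> rho0 sigma0.
rewrite -lee_fin; apply: (le_trans (@joint_markov (fun i x =>
  (1 - y / sigma) / 2 + (x ^+ 2 / (2 * sigma) - (x - m i) ^+ 2 / (2 * rho))) _ _ _ _)).
- move=> i; apply: measurable_funD => //; apply: measurable_funB;
    apply: measurable_funM => //; apply: measurable_funX => //.
  exact: measurable_funB.
- apply: measurable_and; apply: measurable_fun_ler => //; apply: measurable_sum => i;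
    apply: measurable_funX; last exact: measurable_lincomb.
  by apply: measurable_funB => //; exact: measurable_lincomb.
- move=> z /andP[h1 h2].
  rewrite big_split/= sumrB -[X in _ + (X - _)]mulr_suml -[X in _ + (_ - X)]mulr_suml
    sumr_const card_ord -[X in X + _]mulr_natr.
  set s1 := \sum_(i < n) _ in h1 *; set s2 := \sum_(i < n) _ in h2 *.
  have -> : (1 - y / sigma) / 2 * n%:R + (s2 / (2 * sigma) - s1 / (2 * rho)) =
     (s2 - n%:R * y) / (2 * sigma) + (n%:R * rho - s1) / (2 * rho).
    by field; rewrite !gt_eqF.
  by rewrite addr_ge0// divr_ge0 ?subr_ge0// mulr_ge0// ltW.
rewrite (eq_bigr (fun=> (expR ((1 - y / sigma) / 2) * Num.sqrt (rho / sigma))%:E)).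
  by rewrite prodEFin prodr_const card_ord.
move=> i _; rewrite EFinM -(gauss_expR_sqr_shift (m i) sigma0 rho0) -ge0_integralZl; last 4 first.
- exact: measurableT.
- apply/measurable_EFinP; apply: measurableT_comp => //.
  apply: measurable_funB; apply: measurable_funM => //; apply: measurable_funX => //.
  exact: measurable_funB.
- by move=> x _; rewrite lee_fin expR_ge0.
- by rewrite lee_fin expR_ge0.
by apply: eq_integral => x _; rewrite expRD EFinM.
Qed.

End chernoff.

Lemma chernoff_rate_ge0 (R : realType) (xi : R) : 0 <= chernoff_rate xi.
Proof. by rewrite mulr_ge0 ?expR_ge0 ?sqrtr_ge0. Qed.

(** After squaring, this is the strict inequality 1 + xi < exp xi. *)
Lemma chernoff_rate_lt1 (R : realType) (xi : R) :
  -1 < xi -> xi != 0 -> chernoff_rate xi < 1.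
Proof.
move=> xi1 xi0; rewrite -(@expr_lt1 _ 2) ?chernoff_rate_ge0//.
rewrite /chernoff_rate exprMn sqr_sqrtr; last by lra.
have -> : expR (- (xi / 2)) ^+ 2 = (expR xi)^-1.
  by rewrite -expRM_natl -expRN; congr expR; field.
by rewrite mulrC ltr_pdivrMr ?expR_gt0// mul1r expR_gt1Dx.
Qed.

Lemma eq_ler (R : numDomainType) (x y : R) : x = y -> x <= y.
Proof. by move->. Qed.

Lemma pr_nand d (T : measurableType d) (R : realType) (P : probability T R)
    (a b : T -> bool) : measurable_fun setT a -> measurable_fun setT b ->
  pr P (fun x => ~~ (a x && b x)) <= pr P (fun x => ~~ a x) + pr P (fun x => ~~ b x).
Proof.
move=> ma mb; under eq_fun do rewrite negb_and.
by apply: pr_or; exact: measurable_neg.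
Qed.

Lemma pr_fst d1 d2 (T1 : measurableType d1) (T2 : measurableType d2) (R : realType)
    (P1 : probability T1 R) (P2 : probability T2 R) (b : T1 -> bool) :
  measurable_fun setT b ->
  pr (P1 \x P2)%E (fun z => b z.1) = pr P1 b.
Proof.
move=> mb; rewrite /pr.
have -> : [set z : T1 * T2 | b z.1] = [set x | b x] `*` setT.
  by apply/seteqP; split => z //= [].
transitivity (fine (P1 [set x | b x] * P2 setT)%E).
  by congr fine; apply: product_measure1E => //; exact: measurable_pred.
by rewrite probability_setT mule1.
Qed.

(** * Fitting, typicality and failure in the coding scheme *)

Section vectors.
Context {R : realType} {n : nat}.
Implicit Types x y : n.-tuple R.

Definition sqnorm x : R := \sum_(i < n) tnth x i ^+ 2.

Definition vlin (c1 : R) x (c2 : R) y : n.-tuple R :=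
  [tuple c1 * tnth x i + c2 * tnth y i | i < n].

Lemma measurable_vlin d (T : measurableType d) c1 c2 (f g : T -> n.-tuple R) :
  measurable_fun setT f -> measurable_fun setT g ->
  measurable_fun setT (fun t => vlin c1 (f t) c2 (g t)).
Proof.
move=> mf mg; apply: measurable_mktuple => i.
by apply: measurable_funD; apply: measurable_funM => //; exact: measurable_comp_tnth.
Qed.

Lemma measurable_sqnorm d (T : measurableType d) (f : T -> n.-tuple R) :
  measurable_fun setT f -> measurable_fun setT (fun t => sqnorm (f t)).
Proof.
move=> mf; apply: measurable_sum => i; apply: measurable_funX.
exact: measurable_comp_tnth.
Qed.

End vectors.

(* With A of variance [b], the auxiliary word is W = A + ka V, the input is
   X = W + kx V = A + kax V and the state estimate is k1 Y + k2 W. The decoder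
   tests that Y - c W, of variance at most [rho], is short; [Bm] and [Dm] bound
   the variances of the estimate and of its error. *)
Section scheme.
Context {R : realType} (n : nat).
Variables (P Q vU N b ka kx c k1 k2 rho Bm Dm eta xi : R).
Hypotheses (Q0 : 0 <= Q) (vU0 : 0 <= vU) (N0 : 0 < N) (b0 : 0 < b)
  (rho0 : 0 < rho) (Bm0 : 0 < Bm) (Dm0 : 0 < Dm)
  (eta01 : 0 < eta < 1) (xi01 : 0 < xi < 1).

Let V := n.-tuple R.
Let E := (V * V * V)%type.
Let J := joint n Q vU N b.
Implicit Types (w v y : V) (e : E).

Definition kax := ka + kx.
Definition sW := b + ka ^+ 2 * (Q + vU).
Definition sX := b + kax ^+ 2 * (Q + vU).
Definition sY := b + (1 + kax) ^+ 2 * Q + kax ^+ 2 * vU + N.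

Hypotheses (sX_lt : sX < P)
  (rho_ge : (1 - c) ^+ 2 * b + (1 + kax - c * ka) ^+ 2 * Q +
            (kax - c * ka) ^+ 2 * vU + N <= rho)
  (Bm_ge : (k1 + k2) ^+ 2 * b + (k1 * (1 + kax) + k2 * ka) ^+ 2 * Q +
            (k1 * kax + k2 * ka) ^+ 2 * vU + k1 ^+ 2 * N <= Bm)
  (Dm_ge : (k1 + k2) ^+ 2 * b + (1 - k1 * (1 + kax) - k2 * ka) ^+ 2 * Q +
            (k1 * kax + k2 * ka) ^+ 2 * vU + k1 ^+ 2 * N <= Dm).

Definition env_obs e : V := vadd e.1.1 e.1.2.

Definition input_of w v : V := vlin 1 w kx v.

Definition output_of w e : V :=
  [tuple tnth (input_of w (env_obs e)) i + tnth e.1.1 i + tnth e.2 i | i < n].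

Definition estimate_of w y : V := vlin k1 y k2 w.

(** The bounds are two-sided where they have to control a likelihood ratio. The last one concerns
    the input, so that the power constraint holds surely and not merely in expectation. *)
Definition fitv w v : bool :=
  [&& n%:R * (b * (1 - eta)) <= sqnorm (vlin 1 w (- ka) v),
      sqnorm (vlin 1 w (- ka) v) <= n%:R * (b * (1 + eta)),
      n%:R * (sW * (1 - eta)) <= sqnorm w,
      sqnorm w <= n%:R * (sW * (1 + eta)) &
      sqnorm (input_of w v) <= n%:R * P].

(** The lower bound on the power of [y] is what [joint_hit] asks for. The last test bounds the state
    estimate even when the accepted word is wrong. *)
Definition typ w y : bool :=
  [&& sqnorm (vlin 1 y (- c) w) <= n%:R * (rho * (1 + xi)),
      n%:R * (sY * (1 - xi)) <= sqnorm y &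
      sqnorm (estimate_of w y) <= n%:R * (Bm * (1 + xi))].

Definition accurate w e : bool :=
  sqnorm (vlin 1 e.1.1 (- 1) (estimate_of w (output_of w e))) <=
  n%:R * (Dm * (1 + xi)).

Definition fit (z : V * E) : bool := fitv z.1 (env_obs z.2).

Definition flaw (z : V * E) : bool :=
  ~~ (typ z.1 (output_of z.1 z.2) && accurate z.1 z.2).

Definition hit w (z : V * E) : bool := typ w (output_of z.1 z.2).

Lemma measurable_env_obs : measurable_fun setT env_obs.
Proof. by apply: measurable_vadd; measurable_proj. Qed.

Lemma measurable_fitv d (T : measurableType d) (f g : T -> V) :
  measurable_fun setT f -> measurable_fun setT g ->
  measurable_fun setT (fun t => fitv (f t) (g t)).
Proof.
move=> mf mg; have mA := measurable_sqnorm (measurable_vlin 1 (- ka) mf mg).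
have mW := measurable_sqnorm mf.
have mX := measurable_sqnorm (measurable_vlin 1 kx mf mg).
by repeat (apply: measurable_and; first exact: measurable_fun_ler);
  exact: measurable_fun_ler.
Qed.

Lemma measurable_typ d (T : measurableType d) (f g : T -> V) :
  measurable_fun setT f -> measurable_fun setT g ->
  measurable_fun setT (fun t => typ (f t) (g t)).
Proof.
move=> mf mg; have mA := measurable_sqnorm (measurable_vlin 1 (- c) mg mf).
have mW := measurable_sqnorm mg.
have mX := measurable_sqnorm (measurable_vlin k1 k2 mg mf).
by repeat (apply: measurable_and; first exact: measurable_fun_ler);
  exact: measurable_fun_ler.
Qed.

Lemma measurable_output_of d (T : measurableType d) (f : T -> V) (g : T -> E) :
  measurable_fun setT f -> measurable_fun setT g ->
  measurable_fun setT (fun t => output_of (f t) (g t)).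
Proof.
move=> mf mg; apply: measurable_mktuple => i.
have mi : measurable_fun setT (fun t => input_of (f t) (env_obs (g t))).
  by apply: measurable_vlin => //; exact: (measurableT_comp measurable_env_obs mg).
apply: measurable_funD; last first.
  by apply: measurable_comp_tnth; exact: (measurableT_comp measurable_snd mg).
apply: measurable_funD; first exact: (measurable_comp_tnth _ mi).
apply: measurable_comp_tnth.
exact: (measurableT_comp measurable_fst (measurableT_comp measurable_fst mg)).
Qed.

Lemma measurable_accurate d (T : measurableType d) (f : T -> V) (g : T -> E) :
  measurable_fun setT f -> measurable_fun setT g ->
  measurable_fun setT (fun t => accurate (f t) (g t)).
Proof.
move=> mf mg; apply: measurable_fun_ler => //; apply: measurable_sqnorm.
apply: measurable_vlin.
  exact: (measurableT_comp measurable_fst (measurableT_comp measurable_fst mg)).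
by apply: measurable_vlin => //; exact: measurable_output_of.
Qed.

Lemma measurable_fit : measurable_fun setT fit.
Proof.
by apply: measurable_fitv => //; exact: (measurableT_comp measurable_env_obs).
Qed.

Lemma measurable_hit w : measurable_fun setT (hit w).
Proof. by apply: measurable_typ => //; exact: measurable_output_of. Qed.

Lemma measurable_flaw : measurable_fun setT flaw.
Proof.
apply: measurable_neg; apply: measurable_and.
  by apply: measurable_typ => //; exact: measurable_output_of.
exact: measurable_accurate.
Qed.

Definition shift (z : E * V) : V * E := (vlin 1 z.2 ka (env_obs z.1), z.1).

Lemma measurable_shift_joint : measurable_fun setT shift.
Proof.
apply: measurable_fun_pair => //; apply: measurable_vlin => //.
exact: (measurableT_comp measurable_env_obs).
Qed.

Lemma sW_gt0 : 0 < sW.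
Proof.
by apply: ltr_wpDr => //; apply: mulr_ge0; [exact: sqr_ge0|exact: addr_ge0].
Qed.

Lemma sX_gt0 : 0 < sX.
Proof.
by apply: ltr_wpDr => //; apply: mulr_ge0; [exact: sqr_ge0|exact: addr_ge0].
Qed.

Lemma sY_gt0 : 0 < sY.
Proof.
have h1 := mulr_ge0 (sqr_ge0 (1 + kax)) Q0; have h2 := mulr_ge0 (sqr_ge0 kax) vU0.
by apply: ltr_wpDl => //; apply: addr_ge0 => //; apply: addr_ge0 => //; exact: ltW.
Qed.

Definition tilt (z : E * V) : R :=
  \prod_(i < n) gauss_ratio sW b (tnth z.2 i) (ka * tnth (env_obs z.1) i).

Lemma tilt_ge0 z : 0 <= tilt z.
Proof. by apply: prodr_ge0 => i _; exact: gauss_ratio_ge0. Qed.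

Lemma measurable_tilt : measurable_fun setT tilt.
Proof.
apply: measurable_prod => i _; apply: measurable_funM => //.
apply: measurableT_comp => //.
have m2 : measurable_fun setT (fun z : E * V => tnth z.2 i).
  by apply: measurable_comp_tnth; measurable_proj.
have mo : measurable_fun setT (fun z : E * V => tnth (env_obs z.1) i).
  by apply: measurable_comp_tnth; exact: (measurableT_comp measurable_env_obs).
apply: measurable_funB; apply: measurable_funM => //; apply: measurable_funX => //.
by apply: measurable_funD => //; exact: measurable_funM.
Qed.

(* Shifting w by ka v turns an independent pair (w, v) into the joint law of
   (W, V), at the price of the density [tilt]. *)
Lemma integral_pr_shift (B : V * E -> bool) : measurable_fun setT B ->
  (\int[gvec n sW]_w (pr (env n Q vU N) (fun e => B (w, e)))%:E =
   \int[J]_z (tilt z * (B (shift z))%:R)%:E)%E.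
Proof.
move=> mB; have mBr := @measurable_natr_bool _ _ R _ mB.
have B0 z : (0 <= ((B z)%:R : R)%:E)%E by rewrite lee_fin ler0n.
under eq_integral => w _.
  rewrite pr_integral; last exact: (measurableT_comp mB).
  over.
rewrite [LHS](@fubini_tonelli _ _ _ _ _ (gvec n sW) (env n Q vU N) _ mBr B0).
have mBs : measurable_fun setT (fun z => (tilt z * (B (shift z))%:R)%:E).
  under eq_fun do rewrite EFinM; apply: emeasurable_funM.
    by apply/measurable_EFinP; exact: measurable_tilt.
  exact: (measurableT_comp mBr measurable_shift_joint).
rewrite [RHS](fubini_tonelli1 _ mBs); last first.
  by move=> z; rewrite lee_fin mulr_ge0 ?tilt_ge0.
apply: eq_integral => e _; rewrite /fubini_G /fubini_F/=.
pose t : V := [tuple ka * tnth (env_obs e) i | i < n].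
have mBe : measurable_fun setT (fun w => ((B (w, e))%:R : R)%:E).
  exact: (measurableT_comp mBr).
rewrite [LHS](gvec_shift t sW_gt0 b0 mBe (fun w => B0 (w, e))).
apply: eq_integral => x _; rewrite EFinM prodEFin; congr (_%:E * (B (_, e))%:R%:E)%E.
  by apply: eq_bigr => i _; rewrite tnth_mktuple.
by apply: eq_from_tnth => i; rewrite !tnth_mktuple mul1r.
Qed.

Lemma tiltE z : tilt z = Num.sqrt (b / sW) ^+ n *
  expR (sqnorm z.2 / (2 * b) - sqnorm (shift z).1 / (2 * sW)).
Proof.
rewrite /tilt big_split/= prodr_const card_ord -expR_sum; congr (_ * expR _).
rewrite sumrB -!mulr_suml; congr (_ - _ / _); apply: eq_bigr => i _.
by rewrite [in RHS]tnth_mktuple mul1r.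
Qed.

Lemma fit_shift_noise z : vlin 1 (shift z).1 (- ka) (env_obs (shift z).2) = z.2.
Proof. by apply: eq_from_tnth => i; rewrite !tnth_mktuple; ring. Qed.

(* The fitting conditions fix the exponent of the density up to [n * eta]. *)
Lemma tilt_fit z : fit (shift z) ->
  Num.sqrt (b / sW) ^+ n * expR (- eta) ^+ n <= tilt z <=
  Num.sqrt (b / sW) ^+ n * expR eta ^+ n.
Proof.
rewrite /fit /fitv fit_shift_noise => /and5P[h1 h2 h3 h4 _].
have s0 := sW_gt0.
have c0 : 0 < Num.sqrt (b / sW) ^+ n by rewrite exprn_gt0// sqrtr_gt0 divr_gt0.
rewrite tiltE !(ler_pM2l c0) -!expRM_natl !ler_expR.
set sA := sqnorm z.2 in h1 h2 *; set sw := sqnorm _ in h3 h4 *.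
have b2 : 0 < 2 * b by rewrite mulr_gt0.
have s2 : 0 < 2 * sW by rewrite mulr_gt0.
have {}h1 : n%:R * (1 - eta) / 2 <= sA / (2 * b).
  by rewrite ler_pdivlMr//; apply: le_trans h1; apply: eq_ler; field.
have {}h2 : sA / (2 * b) <= n%:R * (1 + eta) / 2.
  by rewrite ler_pdivrMr//; apply: (le_trans h2); apply: eq_ler; field.
have {}h3 : n%:R * (1 - eta) / 2 <= sw / (2 * sW).
  by rewrite ler_pdivlMr//; apply: le_trans h3; apply: eq_ler; field.
have {}h4 : sw / (2 * sW) <= n%:R * (1 + eta) / 2.
  by rewrite ler_pdivrMr//; apply: (le_trans h4); apply: eq_ler; field.
by apply/andP; split; lra.
Qed.

(** Its [n]-th power is the lower end of the window for the density, and plays the part of [p] in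
    the greedy choice. *)
Definition rate_lo := Num.sqrt (b / sW) * expR (- eta).

Lemma integral_pr_shift_lb (B : V * E -> bool) : measurable_fun setT B ->
    (forall z, B z -> fit z) ->
  ((rate_lo ^+ n * pr J (fun z => B (shift z)))%:E <=
   \int[gvec n sW]_w (pr (env n Q vU N) (fun e => B (w, e)))%:E)%E.
Proof.
move=> mB Bfit; rewrite integral_pr_shift//.
have mBs := measurableT_comp mB measurable_shift_joint.
rewrite EFinM pr_integral// -ge0_integralZl; last 4 first.
- exact: measurableT.
- exact: measurable_natr_bool.
- by move=> z _; rewrite lee_fin.
- by rewrite lee_fin exprn_ge0// mulr_ge0 ?sqrtr_ge0 ?expR_ge0.
apply: ge0_le_integral => //.
- by move=> z _; rewrite lee_fin mulr_ge0 ?exprn_ge0 ?mulr_ge0 ?sqrtr_ge0 ?expR_ge0.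
- apply: emeasurable_funM => //; exact: measurable_natr_bool.
- under eq_fun do rewrite EFinM; apply: emeasurable_funM.
    by apply/measurable_EFinP; exact: measurable_tilt.
  exact: measurable_natr_bool.
- move=> z _; rewrite -EFinM lee_fin; case: (boolP (B (shift z))) => [/Bfit f|_].
    by rewrite !mulr1 exprMn; have /andP[] := tilt_fit f.
  by rewrite !mulr0.
Qed.

(** The upper end of the window is written as the lower end times exp(2 n eta), because the greedy
    choice compares all its bounds with one and the same [p]. *)
Lemma integral_pr_shift_ub (B : V * E -> bool) : measurable_fun setT B ->
    (forall z, B z -> fit z) ->
  (\int[gvec n sW]_w (pr (env n Q vU N) (fun e => B (w, e)))%:E <=
   (rate_lo ^+ n * (expR (2 * eta) ^+ n * pr J (fun z => B (shift z))))%:E)%E.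
Proof.
move=> mB Bfit; rewrite integral_pr_shift//.
have mBs := measurableT_comp mB measurable_shift_joint.
rewrite mulrA -exprMn.
have -> : rate_lo * expR (2 * eta) = Num.sqrt (b / sW) * expR eta.
  by rewrite /rate_lo -mulrA -expRD; congr (_ * expR _); ring.
rewrite EFinM pr_integral// -ge0_integralZl; last 4 first.
- exact: measurableT.
- exact: measurable_natr_bool.
- by move=> z _; rewrite lee_fin.
- by rewrite lee_fin exprn_ge0// mulr_ge0 ?sqrtr_ge0 ?expR_ge0.
apply: ge0_le_integral => //.
- by move=> z _; rewrite lee_fin mulr_ge0 ?tilt_ge0.
- under eq_fun do rewrite EFinM; apply: emeasurable_funM.
    by apply/measurable_EFinP; exact: measurable_tilt.
  exact: measurable_natr_bool.
- apply: emeasurable_funM => //; exact: measurable_natr_bool.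
- move=> z _; rewrite -EFinM lee_fin; case: (boolP (B (shift z))) => [/Bfit f|_].
    by rewrite !mulr1 exprMn; have /andP[] := tilt_fit f.
  by rewrite !mulr0.
Qed.

Section tails.
Variables (X : E * V -> V) (lS lU lZ lA v x : R).
Hypotheses (mX : measurable_fun setT X)
  (XE : forall z i, tnth (X z) i = lincomb lS lU lZ lA z i)
  (v0 : 0 < v) (x0 : 0 < x).
Let sigma := lS ^+ 2 * Q + lU ^+ 2 * vU + lZ ^+ 2 * N + lA ^+ 2 * b.

Let sqnormE z : sqnorm (X z) = \sum_(i < n) lincomb lS lU lZ lA z i ^+ 2.
Proof. by apply: eq_bigr => i _; rewrite XE. Qed.

Let mL :
  measurable_fun setT (fun z : E * V => \sum_(i < n) lincomb lS lU lZ lA z i ^+ 2).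
Proof.
by apply: measurable_sum => i; apply: measurable_funX; exact: measurable_lincomb.
Qed.

Lemma tail_up : sigma <= v ->
  pr J (fun z => ~~ (sqnorm (X z) <= n%:R * (v * (1 + x)))) <= chernoff_rate x ^+ n.
Proof.
move=> sv; apply: le_trans (@joint_chernoff R n Q vU N b Q0 vU0 (ltW N0) (ltW b0)
    lS lU lZ lA v x v0 _ _); last 2 first.
- by have h := x0; lra.
- by apply: mulr_ge0; rewrite ?subr_ge0// ltW.
apply: le_pr.
- by apply: measurable_neg; apply: measurable_fun_ler => //; exact: measurable_sqnorm.
- by apply: measurable_fun_ler => //; apply: measurable_funM => //; exact: measurable_funB.
- by move=> z; rewrite -ltNge sqnormE => h; rewrite mulr_ge0 ?subr_ge0// ltW.
Qed.

Lemma tail_lo : x < 1 -> v <= sigma ->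
  pr J (fun z => ~~ (n%:R * (v * (1 - x)) <= sqnorm (X z))) <= chernoff_rate (- x) ^+ n.
Proof.
move=> x1 sv; have xp := x0; apply: le_trans (@joint_chernoff R n Q vU N b Q0 vU0 (ltW N0) (ltW b0)
    lS lU lZ lA v (- x) v0 _ _); last 2 first.
- by lra.
- by rewrite mulr_le0// ?oppr_le0 ?subr_le0// ltW.
apply: le_pr.
- by apply: measurable_neg; apply: measurable_fun_ler => //; exact: measurable_sqnorm.
- by apply: measurable_fun_ler => //; apply: measurable_funM => //; exact: measurable_funB.
- by move=> z; rewrite -ltNge sqnormE => h; rewrite mulr_le0// ?oppr_le0 ?subr_le0// ltW.
Qed.

End tails.

Let mshift1 : measurable_fun setT (fun z => (shift z).1).
Proof. exact: (measurableT_comp measurable_fst measurable_shift_joint). Qed.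

Let mobs1 : measurable_fun setT (fun z : E * V => env_obs z.1).
Proof. exact: (measurableT_comp measurable_env_obs). Qed.

Let moutput : measurable_fun setT (fun z : E * V => output_of (shift z).1 z.1).
Proof. exact: (measurable_output_of mshift1). Qed.

Lemma output_shiftE z i :
  tnth (output_of (shift z).1 z.1) i = lincomb (1 + kax) kax 1 1 z i.
Proof. by rewrite !tnth_mktuple /lincomb /kax; ring. Qed.

Definition nofit_bound := chernoff_rate (- eta) ^+ n + (chernoff_rate eta ^+ n +
  (chernoff_rate (- eta) ^+ n + (chernoff_rate eta ^+ n + chernoff_rate (P / sX - 1) ^+ n))).

Lemma pr_nofit : pr J (fun z => ~~ fit (shift z)) <= nofit_bound.
Proof.
case/andP: (eta01) => e0 e1; have [bp Np] := (b0, N0).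
have sX0 := sX_gt0; have sW0 := sW_gt0.
have mN : measurable_fun setT (fun z => vlin 1 (shift z).1 (- ka) (env_obs z.1)).
  exact: measurable_vlin.
have mI : measurable_fun setT (fun z => input_of (shift z).1 (env_obs z.1)).
  exact: measurable_vlin.
have NE z i : tnth (vlin 1 (shift z).1 (- ka) (env_obs z.1)) i = lincomb 0 0 0 1 z i.
  by rewrite !tnth_mktuple /lincomb; ring.
have WE z i : tnth (shift z).1 i = lincomb ka ka 0 1 z i.
  by rewrite !tnth_mktuple /lincomb; ring.
have IE z i : tnth (input_of (shift z).1 (env_obs z.1)) i = lincomb kax kax 0 1 z i.
  by rewrite !tnth_mktuple /lincomb /kax; ring.
have mle (f g : E * V -> R) : measurable_fun setT f -> measurable_fun setT g ->
    measurable_fun setT (fun z : E * V => f z <= g z).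
  exact: measurable_fun_ler.
have mc (r : R) : measurable_fun setT (fun _ : E * V => r) by exact: measurable_cst.
have mNs := measurable_sqnorm mN; have mWs := measurable_sqnorm mshift1.
have mIs := measurable_sqnorm mI.
rewrite /fit /fitv.
apply: le_trans (pr_nand _ _ _) _; [exact: mle|by do ?[apply: measurable_and]; exact: mle|].
apply: lerD; first by apply: (tail_lo mN NE); rewrite // !expr0n expr1n/=; lra.
apply: le_trans (pr_nand _ _ _) _; [exact: mle|by do ?[apply: measurable_and]; exact: mle|].
apply: lerD; first by apply: (tail_up mN NE); rewrite // !expr0n expr1n/=; lra.
apply: le_trans (pr_nand _ _ _) _; [exact: mle|by do ?[apply: measurable_and]; exact: mle|].
apply: lerD; first by apply: (tail_lo mshift1 WE) => //; rewrite /sW; lra.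
apply: le_trans (pr_nand _ _ _) _; [exact: mle|exact: mle|].
apply: lerD; first by apply: (tail_up mshift1 WE) => //; rewrite /sW; lra.
(* The strict inequality [sX < P] is read as a relative excess [P / sX - 1 > 0], which turns the
   power test into an ordinary upper tail. *)
have -> : P = sX * (1 + (P / sX - 1)) by field; rewrite gt_eqF.
rewrite [X in chernoff_rate (X / _ - 1)](_ : _ = P); last by field; rewrite gt_eqF.
apply: (tail_up mI IE) => //; last by rewrite /sX; lra.
by rewrite subr_gt0 ltr_pdivlMr// mul1r.
Qed.

Definition flaw_bound := chernoff_rate xi ^+ n + (chernoff_rate (- xi) ^+ n +
  chernoff_rate xi ^+ n) + chernoff_rate xi ^+ n.

Lemma pr_flaw : pr J (fun z => flaw (shift z)) <= flaw_bound.
Proof.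
case/andP: (xi01) => x0 x1; have [Np bp] := (N0, b0).
have [hC hE hD] := And3 rho_ge Bm_ge Dm_ge.
have sY0 := sY_gt0.
have mC : measurable_fun setT (fun z =>
    vlin 1 (output_of (shift z).1 z.1) (- c) (shift z).1) by exact: measurable_vlin.
have CE z i : tnth (vlin 1 (output_of (shift z).1 z.1) (- c) (shift z).1) i =
    lincomb (1 + kax - c * ka) (kax - c * ka) 1 (1 - c) z i.
  by rewrite tnth_mktuple output_shiftE !tnth_mktuple /lincomb; ring.
have mEs : measurable_fun setT (fun z =>
    estimate_of (shift z).1 (output_of (shift z).1 z.1)) by exact: measurable_vlin.
have EE z i : tnth (estimate_of (shift z).1 (output_of (shift z).1 z.1)) i =
    lincomb (k1 * (1 + kax) + k2 * ka) (k1 * kax + k2 * ka) k1 (k1 + k2) z i.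
  by rewrite tnth_mktuple output_shiftE !tnth_mktuple /lincomb; ring.
have mS : measurable_fun setT (fun z : E * V => z.1.1.1) by measurable_proj.
have mD : measurable_fun setT (fun z =>
    vlin 1 z.1.1.1 (- 1) (estimate_of (shift z).1 (output_of (shift z).1 z.1))).
  exact: measurable_vlin.
have DE z i : tnth (vlin 1 z.1.1.1 (- 1) (estimate_of (shift z).1 (output_of (shift z).1 z.1))) i =
    lincomb (1 - k1 * (1 + kax) - k2 * ka) (- (k1 * kax + k2 * ka)) (- k1) (- (k1 + k2)) z i.
  by rewrite tnth_mktuple EE /lincomb; ring.
have mle (f g : E * V -> R) : measurable_fun setT f -> measurable_fun setT g ->
    measurable_fun setT (fun z : E * V => f z <= g z).
  exact: measurable_fun_ler.
have mc (r : R) : measurable_fun setT (fun _ : E * V => r) by exact: measurable_cst.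
have mCs := measurable_sqnorm mC; have mYs := measurable_sqnorm moutput.
have mEss := measurable_sqnorm mEs; have mDs := measurable_sqnorm mD.
rewrite /flaw /typ /accurate.
apply: le_trans (pr_nand _ _ _) _; [by do ?[apply: measurable_and]; exact: mle|exact: mle|].
apply: lerD; last by apply: (tail_up mD DE) => //; rewrite !sqrrN; lra.
apply: le_trans (pr_nand _ _ _) _; [exact: mle|by do ?[apply: measurable_and]; exact: mle|].
apply: lerD; first by apply: (tail_up mC CE) => //; lra.
apply: le_trans (pr_nand _ _ _) _; [exact: mle|exact: mle|].
apply: lerD; first by apply: (tail_lo moutput output_shiftE) => //; rewrite /sY; lra.
by apply: (tail_up mEs EE) => //; lra.
Qed.

Definition hit_rate := expR (xi / 2) * Num.sqrt (rho * (1 + xi) / sY).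

(** The earlier word [w] is a constant, so that being short of [c w] confines the Gaussian output to
    a fixed ball; the bound does not see its centre and hence is uniform in [w]. *)
Lemma pr_hit w : pr J (fun z => hit w (shift z)) <= hit_rate ^+ n.
Proof.
case/andP: (xi01) => x0 x1.
have sY0 := sY_gt0.
have r0 : 0 < rho * (1 + xi) by rewrite mulr_gt0//; lra.
have sE : (1 + kax) ^+ 2 * Q + kax ^+ 2 * vU + 1 ^+ 2 * N + 1 ^+ 2 * b = sY.
  by rewrite /sY; ring.
have := @joint_hit R n Q vU N b Q0 vU0 (ltW N0) (ltW b0) (1 + kax) kax 1 1
  (rho * (1 + xi)) (sY * (1 - xi)) (fun i => c * tnth w i) r0.
rewrite sE => /(_ sY0).
have -> : (1 - sY * (1 - xi) / sY) / 2 = xi / 2 by field; rewrite gt_eqF.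
apply: le_trans; apply: le_pr.
- exact: (measurableT_comp (measurable_hit w) measurable_shift_joint).
- apply: measurable_and; apply: measurable_fun_ler => //; apply: measurable_sum => i;
    apply: measurable_funX; last exact: measurable_lincomb.
  by apply: measurable_funB => //; exact: measurable_lincomb.
- move=> z /and3P[h1 h2 _]; apply/andP; split.
    apply: le_trans h1; apply: eq_ler; apply: eq_bigr => i _.
    by rewrite tnth_mktuple output_shiftE mul1r mulNr.
  apply: (le_trans h2); apply: eq_ler; apply: eq_bigr => i _.
  by rewrite output_shiftE.
Qed.

Lemma scheme_codebook (delta : R) (M L : nat) : 0 < delta -> nofit_bound <= delta ->
    1 < L%:R * (rate_lo ^+ n * delta) ->
    expR (2 * eta) ^+ n * flaw_bound +
      (M * L)%:R * (expR (2 * eta) ^+ n * hit_rate ^+ n) <= delta ^+ 2 ->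
  exists ws : nat -> seq V, forall m, (m < M)%N ->
    pr (env n Q vU N)
      (fail fit flaw hit true (flatten [seq ws j | j <- iota 0 m]) (ws m)) <= 4 * delta.
Proof.
move=> d0 nofit L1 small.
have p0 : 0 < rate_lo ^+ n.
  by rewrite exprn_gt0// mulr_gt0 ?expR_gt0// sqrtr_gt0 divr_gt0// sW_gt0.
have mfit := measurable_fit; have mflaw := measurable_flaw.
have mfs := measurableT_comp mfit measurable_shift_joint.
have e0 : 0 <= expR (2 * eta) ^+ n by rewrite exprn_ge0// expR_ge0.
have [||||ws wsP] := @greedy_codebook _ _ _ _ _ (gvec n sW) (env n Q vU N)
  fit flaw hit mfit mflaw measurable_hit (rate_lo ^+ n) delta _ _ p0 d0 _ _ _ M L L1 _ small.
- move=> U mU.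
  have mB : measurable_fun setT (fun z : V * E => U z.2 && fit z).
    by apply: measurable_and => //; exact: (measurableT_comp mU).
  apply: le_trans (integral_pr_shift_lb mB _); last by move=> z /andP[].
  rewrite lee_fin ler_pM2l//= lerBlDr.
  have mUJ : measurable_fun setT (fun z : E * V => U z.1) by exact: (measurableT_comp mU).
  (* Under [J] the environment keeps its own law, so that adding the fitting condition to [U] costs
     at most [nofit_bound], hence at most [delta]. *)
  rewrite -(@pr_fst _ _ _ _ _ (env n Q vU N) (gvec n b) U mU).
  apply: (@le_trans _ _ (pr J (fun z => (U z.1 && fit (shift z)) || ~~ fit (shift z)))).
    apply: le_pr => //.
      apply: measurable_or; last exact: measurable_neg.
      exact: measurable_and.
    by move=> z ->; rewrite orbN.
  apply: le_trans (pr_or _ _ _) _; [exact: measurable_and|exact: measurable_neg|].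
  by rewrite lerD2l (le_trans pr_nofit).
- have mB : measurable_fun setT (fun z : V * E => fit z && flaw z) by exact: measurable_and.
  apply: le_trans (integral_pr_shift_ub mB _) _; first by move=> z /andP[].
  rewrite lee_fin ler_pM2l// ler_wpM2l//; apply: le_trans pr_flaw.
  apply: le_pr.
  + exact: (measurableT_comp mB measurable_shift_joint).
  + exact: (measurableT_comp mflaw measurable_shift_joint).
  + by move=> z /andP[].
- move=> w'; have mB : measurable_fun setT (fun z : V * E => fit z && hit w' z).
    by apply: measurable_and => //; exact: measurable_hit.
  apply: le_trans (integral_pr_shift_ub mB _) _; first by move=> z /andP[].
  rewrite lee_fin ler_pM2l// ler_wpM2l//; apply: le_trans (pr_hit w').
  apply: le_pr.
  + exact: (measurableT_comp mB measurable_shift_joint).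
  + exact: (measurableT_comp (measurable_hit w') measurable_shift_joint).
  + by move=> z /andP[].
- by rewrite mulr_ge0 ?exprn_ge0// ?mulr_ge0 ?expR_ge0 ?sqrtr_ge0.
- by exists ws => m /wsP[].
Qed.

End scheme.

(** * The law of the blocks in a realization of the model *)

Section block_law.
Context d (Omega : measurableType d) (R : realType) (Pr : probability Omega R).
Implicit Types X : nat -> {RV Pr >-> R}.

Lemma measurable_block X n : measurable_fun setT (block X n).
Proof. by apply: measurable_mktuple => i; exact: measurable_funP. Qed.

Lemma mutually_independent_prod (I : choiceType) (F : I -> set_system Omega)
    (s : seq I) (A : I -> set Omega) :
    mutually_independent Pr F -> uniq s -> (forall i, i \in s -> F i (A i)) ->
  (Pr (\bigcap_(i in [set` s]) A i) = \prod_(i <- s) Pr (A i))%E.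
Proof.
move=> ind us FA; have := ind [fset i in s]%fset A.
have sE : [set` [fset i in s]%fset] = [set` s].
  by apply/seteqP; split => i /=; rewrite !inE.
rewrite sE => -> => [|i]; last by rewrite !inE; exact: FA.
apply: perm_big; apply: uniq_perm => //.
by move=> i; rewrite !inE.
Qed.

Lemma block_law X n v (B : set (n.-tuple R)) :
    (forall i, has_law (X i) (gaussian v)) ->
    mutually_independent Pr (fun i : nat => sigma_rv (X i)) ->
    measurable B ->
  Pr (block X n @^-1` B) = gvec n v B.
Proof.
move=> law ind mB.
pose m : {measure set (n.-tuple R) -> \bar R} :=
  measure_function_pushforward__canonical__measure_function_Measure Pr (@measurable_block X n).
rewrite -[LHS]/(m B); apply: tuple_prob_unique => // A mA.
pose A' i := if insub i is Some j then A j else setT.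
have mA' i : measurable (A' i) by rewrite /A'; case: insubP.
have A'E (i : 'I_n) : A' i = A i by rewrite /A' valK.
rewrite /m/= /pushforward.
have -> : block X n @^-1` tbox A = \bigcap_(i in [set` iota 0 n]) (X i @^-1` A' i).
  apply/seteqP; split => w /= H i.
    rewrite /= mem_iota/= add0n => ilt.
    by have := H (Ordinal ilt); rewrite tnth_mktuple -A'E.
  rewrite tnth_mktuple -A'E; apply: H => /=.
  by rewrite mem_iota/= add0n.
rewrite (mutually_independent_prod ind (iota_uniq 0 n)); last first.
  by move=> i _; exists (A' i) => //; rewrite setTI.
have -> : iota 0 n = index_iota 0 n by rewrite /index_iota subn0.
rewrite big_mkord.
by apply: eq_bigr => i _; rewrite A'E -gaussianE; exact: law.
Qed.

Lemma sigma_process_block X n (B : set (n.-tuple R)) : measurable B ->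
  sigma_process X (block X n @^-1` B).
Proof.
move=> mB; suff : measurable `<=` image_set_system setT (block X n) (sigma_process X).
  by move=> /(_ _ mB); rewrite /image_set_system/= setTI.
apply: smallest_sub.
  apply: sigma_algebra_image; exact: smallest_sigma_algebra.
move=> C; rewrite -bigcup_seq => -[i _ [A mA <-]].
rewrite /image_set_system/= setTI; apply: sub_sigma_algebra.
exists (nat_of_ord i) => //; exists A => //.
by rewrite !setTI; apply/seteqP; split => w /=; rewrite tnth_mktuple.
Qed.

Variables (Q N vU : R) (S U Z : nat -> {RV Pr >-> R}).
Hypothesis model : channel_model Q N vU S U Z.
Variable n : nat.

Definition env_block w := (block S n w, block U n w, block Z n w).

Lemma measurable_env_block : measurable_fun setT env_block.
Proof.
by apply: measurable_fun_pair; [apply: measurable_fun_pair|]; exact: measurable_block.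
Qed.

Let box3 (A B C : set (n.-tuple R)) : measurable A -> measurable B -> measurable C ->
  (Pr (block S n @^-1` A `&` block U n @^-1` B `&` block Z n @^-1` C) =
   gvec n Q A * gvec n vU B * gvec n N C)%E.
Proof.
move=> mA mB mC.
transitivity (Pr (block S n @^-1` A) * Pr (block U n @^-1` B) *
    Pr (block Z n @^-1` C))%E; last first.
  congr (_ * _ * _)%E.
  - exact: (block_law (state_law model) (state_indep model) mA).
  - exact: (block_law (obs_noise_law model) (obs_noise_indep model) mB).
  - exact: (block_law (noise_law model) (noise_indep model) mC).
(* The model lists the processes in the order S, Z, U, the blocks come in the order S, U, Z. *)
pose T := [tuple block S n @^-1` A; block Z n @^-1` C; block U n @^-1` B].
have FT i : i \in enum 'I_3 ->
    tnth [tuple sigma_process S; sigma_process Z; sigma_process U] i (tnth T i).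
  move=> _; rewrite (tnth_nth set0) (tnth_nth (sigma_process S)).
  by case: i => -[|[|[|//]]] i3 /=; exact: sigma_process_block.
have := mutually_independent_prod (processes_indep model) (enum_uniq _) FT.
rewrite big_enum !big_ord_recl big_ord0 !(tnth_nth set0)/= mule1 => H.
rewrite -muleA [X in (_ * X)%E]muleC -H.
congr (Pr _); apply/seteqP; split => w /=.
  move=> [[Aw Bw] Cw] i _; rewrite (tnth_nth set0).
  by case: i => -[|[|[|//]]].
move=> Tw; have mem i : [set` enum 'I_3] i by rewrite /= mem_enum.
split; first split.
- by have := Tw ord0 (mem _); rewrite (tnth_nth set0).
- by have := Tw (@Ordinal 3 2 isT) (mem _); rewrite (tnth_nth set0).
- by have := Tw (@Ordinal 3 1 isT) (mem _); rewrite (tnth_nth set0).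
Qed.

(** A product of three laws is a product of two twice over, so uniqueness of product measures is
    used twice. The second use is for the conditional law of (S^n, U^n) given that Z^n lies in [C],
    which makes sense only when that event is not null. *)
Lemma env_block_law (B : set (n.-tuple R * n.-tuple R * n.-tuple R)) :
  measurable B -> Pr (env_block @^-1` B) = env n Q vU N B.
Proof.
have mSU : measurable_fun setT (fun w => (block S n w, block U n w)).
  by apply: measurable_fun_pair; exact: measurable_block.
have preimX d' (T : measurableType d') (f : Omega -> T) A :
    measurable_fun setT f -> measurable A -> measurable (f @^-1` A).
  by move=> mf mA; rewrite -[X in measurable X]setTI; exact: mf.
pose m : {measure set (n.-tuple R * n.-tuple R * n.-tuple R) -> \bar R} :=
  measure_function_pushforward__canonical__measure_function_Measure Pr measurable_env_block.
move=> mB; rewrite -[LHS]/(m B); apply/esym.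
apply: (@product_measure_unique _ _ _ _ _
  ((gvec n Q \x gvec n vU)%E : probability _ R) (gvec n N) m) => // {B mB} A C mA mC.
have mD : measurable (block Z n @^-1` C) by exact: preimX (@measurable_block Z n) mC.
have PC : Pr (block Z n @^-1` C) = gvec n N C.
  exact: (block_law (noise_law model) (noise_indep model) mC).
have -> : m (A `*` C) = Pr ((fun w => (block S n w, block U n w)) @^-1` A `&`
    block Z n @^-1` C).
  by congr (Pr _); apply/seteqP; split.
transitivity ((gvec n Q \x gvec n vU)%E A * Pr (block Z n @^-1` C))%E; last first.
  by congr (_ * _)%E; exact: PC.
have finC : Pr (block Z n @^-1` C) \is a fin_num by exact: fin_num_measure.
have [c0|c0] := eqVneq (Pr (block Z n @^-1` C)) 0%E.
  rewrite c0 mule0; apply/eqP; rewrite eq_le measure_ge0 andbT -c0.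
  by apply: le_measure; rewrite ?inE; [apply: measurableI => //; exact: preimX| |exact: subIsetr].
pose r := fine (Pr (block Z n @^-1` C)).
have r0 : 0 < r by rewrite /r fine_gt0// lt0e c0 measure_ge0/= ltey_eq finC.
have rE : Pr (block Z n @^-1` C) = r%:E by rewrite /r fineK.
have ri : 0 <= r^-1 by rewrite invr_ge0 ltW.
pose restr : {measure set Omega -> \bar R} := mrestr Pr mD.
pose m' : {measure set (n.-tuple R * n.-tuple R) -> \bar R} :=
  mscale (NngNum ri)
    (measure_function_pushforward__canonical__measure_function_Measure restr mSU).
suff -> : ((gvec n Q \x gvec n vU) A = m' A)%E.
  rewrite rE /m'/= /mscale/= /pushforward/= /mrestr muleC muleA -EFinM divff ?gt_eqF//.
  by rewrite mul1e.
apply: product_measure_unique => // {A mA} A B mA mB.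
rewrite /m'/= /mscale/= /pushforward/= /mrestr.
have -> : (fun w => (block S n w, block U n w)) @^-1` (A `*` B) `&` block Z n @^-1` C =
    block S n @^-1` A `&` block U n @^-1` B `&` block Z n @^-1` C.
  by apply/seteqP; split.
have -> := box3 mA mB mC.
transitivity ((r^-1)%:E * (gvec n Q A * gvec n vU B * r%:E))%E.
  by congr (_ * (_ * _))%E; rewrite -rE PC.
by rewrite muleCA -EFinM mulVf ?gt_eqF// mule1.
Qed.

End block_law.

(** * Tolerances and lengths for which codebooks exist *)

Lemma geometric_small (R : realType) (r eps : R) : 0 <= r < 1 -> 0 < eps ->
  exists n0 : nat, forall n, (n0 <= n)%N -> r ^+ n <= eps.
Proof.
move=> /andP[r0 r1] eps0.
have : r ^+ n @[n --> \oo] --> 0 by apply: cvg_expr; rewrite ger0_norm.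
move=> /cvgrPdist_le /(_ _ eps0)[n0 _ n0P]; exists n0 => n nn0.
by have := n0P n nn0; rewrite sub0r normrN ger0_norm// exprn_ge0.
Qed.

Lemma expR_slack (R : realType) (a : R) : 0 <= a < 1 ->
  exists2 t : R, 0 < t & a * expR t < 1.
Proof.
move=> /andP[a0 a1]; exists ((1 - a) / 2); first by lra.
rewrite -ltr_pdivlMr ?expR_gt0// mul1r -expRN.
by apply: lt_le_trans (expR_ge1Dx _); lra.
Qed.

Lemma sqrt1D_le (R : realType) (x : R) : 0 <= x -> Num.sqrt (1 + x) <= expR (x / 2).
Proof.
move=> x0; rewrite -(@ger0_norm _ (expR (x / 2))) ?expR_ge0// -sqrtr_sqr.
rewrite ler_sqrt ?exprn_ge0 ?expR_ge0// -expRM_natl.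
have -> : 2%:R * (x / 2) = x by field.
exact: expR_ge1Dx.
Qed.

(** The order of choices matters: [xi] comes first, from the room left by the rate condition. Then
    [eta] is taken small against that room and against the decay of the flaw probability, which the
    factor exp(2 n eta) must not destroy. The length comes last, after [delta]. [G] stands for 2 to
    the power of the rate. *)
Lemma exists_codebooks (R : realType) (P Q vU N b ka kx c k1 k2 rho Bm Dm G x0 : R) :
    0 <= Q -> 0 <= vU -> 0 < N -> 0 < b -> 0 < rho -> 0 < Bm -> 0 < Dm ->
    sX Q vU b ka kx < P ->
    (1 - c) ^+ 2 * b + (1 + kax ka kx - c * ka) ^+ 2 * Q +
      (kax ka kx - c * ka) ^+ 2 * vU + N <= rho ->
    (k1 + k2) ^+ 2 * b + (k1 * (1 + kax ka kx) + k2 * ka) ^+ 2 * Q +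
      (k1 * kax ka kx + k2 * ka) ^+ 2 * vU + k1 ^+ 2 * N <= Bm ->
    (k1 + k2) ^+ 2 * b + (1 - k1 * (1 + kax ka kx) - k2 * ka) ^+ 2 * Q +
      (k1 * kax ka kx + k2 * ka) ^+ 2 * vU + k1 ^+ 2 * N <= Dm ->
    0 < G -> G ^+ 2 * (sW Q vU b ka * rho) < b * sY Q vU N b ka kx -> 0 < x0 ->
  exists eta xi : R, [/\ 0 < xi, xi < 1, xi <= x0 & forall delta, 0 < delta ->
    exists n0, forall n, (n0 <= n)%N -> forall M : nat, M%:R <= 2 * G ^+ n ->
    exists ws : nat -> seq (n.-tuple R), forall m, (m < M)%N ->
      pr (env n Q vU N)
        (fail (fit P Q vU b ka kx eta) (flaw Q vU N b ka kx c k1 k2 rho Bm Dm xi)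
           (hit Q vU N b ka kx c k1 k2 rho Bm xi) true
           (flatten [seq ws j | j <- iota 0 m]) (ws m)) <= 4 * delta].
Proof.
move=> Q0 vU0 N0 b0 rho0 Bm0 Dm0 sXP hrho hB hD G0 core x00.
have sW0 := @sW_gt0 R Q vU b ka Q0 vU0 b0.
have sX0 := @sX_gt0 R Q vU b ka kx Q0 vU0 b0.
have sY0 := @sY_gt0 R Q vU N b ka kx Q0 vU0 N0 b0.
set w := sW Q vU b ka in core sW0 *; set y := sY Q vU N b ka kx in core sY0 *.
have bw : b <= w.
  by rewrite /w /sW lerDl mulr_ge0 ?sqr_ge0 ?addr_ge0.
(* Without tolerances, this is the rate per letter of (number of messages) * (confusion probability)
   / (fitting probability); that it is below 1 is the rate condition. *)
pose base := G * Num.sqrt (rho / y / (b / w)).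
have base0 : 0 <= base by rewrite mulr_ge0 ?sqrtr_ge0// ltW.
have base1 : base < 1.
  rewrite -(@expr_lt1 _ 2)// /base exprMn sqr_sqrtr; last first.
    by rewrite !divr_ge0// ltW// divr_gt0.
  have -> : G ^+ 2 * (rho / y / (b / w)) = G ^+ 2 * (w * rho) / (b * y).
    by field; rewrite !gt_eqF.
  by rewrite ltr_pdivrMr ?mulr_gt0// mul1r.
have [|t t0 baset] := @expR_slack R base; first by rewrite base0.
pose xi := Num.min (t / 2) (Num.min x0 (1 / 2)).
have xi0 : 0 < xi by rewrite /xi !lt_min x00 !divr_gt0.
have xit : xi <= t / 2 by rewrite /xi ge_min lexx.
have xix : xi <= x0 by rewrite /xi !ge_min lexx orbT.
have xih : xi <= 1 / 2 by rewrite /xi !ge_min lexx !orbT.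
pose r := Num.max (chernoff_rate xi) (chernoff_rate (- xi)).
have r0 : 0 <= r by rewrite /r le_max chernoff_rate_ge0.
have r1 : r < 1.
  rewrite /r gt_max !chernoff_rate_lt1 ?oppr_eq0 ?gt_eqF//; lra.
have [|t2 t20 rt2] := @expR_slack R r; first by rewrite r0.
(* In [rb] the tolerances amount to at most exp(3 eta + xi) per letter: two [eta] from the window,
   one from [p], and half of [xi] from the bound on sqrt(1 + xi). The first entry makes this at most
   exp t; the second one keeps [q * r] below 1. *)
pose eta := Num.min (t / 6) (Num.min (t2 / 2) (1 / 2)).
have eta0 : 0 < eta by rewrite /eta !lt_min !divr_gt0.
have etat : eta <= t / 6 by rewrite /eta ge_min lexx.
have etat2 : eta <= t2 / 2 by rewrite /eta !ge_min lexx orbT.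
have etah : eta <= 1 / 2 by rewrite /eta !ge_min lexx !orbT.
pose q := expR (2 * eta); have q0 : 0 < q by exact: expR_gt0.
pose h := hit_rate Q vU N b ka kx rho xi.
have h0 : 0 <= h by rewrite mulr_ge0 ?expR_ge0 ?sqrtr_ge0.
pose p := rate_lo Q vU b ka eta.
have p0 : 0 < p by rewrite mulr_gt0 ?expR_gt0// sqrtr_gt0 divr_gt0.
have p1 : p <= 1.
  rewrite /p /rate_lo mulr_ile1 ?sqrtr_ge0 ?expR_ge0//.
    by rewrite -[leRHS]sqrtr1 ler_sqrt// ler_pdivrMr// mul1r.
  by rewrite -[leRHS]expR0 ler_expR oppr_le0 ltW.
pose ra := q * r.
have ra0 : 0 <= ra by rewrite mulr_ge0// ltW.
have ra1 : ra < 1.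
  apply: le_lt_trans rt2; rewrite /ra mulrC ler_wpM2l// ler_expR; lra.
pose rb := G * (q * h) / p.
have rb0 : 0 <= rb by rewrite divr_ge0 ?mulr_ge0// ltW.
have rb1 : rb < 1.
  apply: le_lt_trans baset.
  have -> : rb = G * (Num.sqrt (rho * (1 + xi) / y) / Num.sqrt (b / w)) *
      expR (3 * eta + xi / 2).
    rewrite /rb /h /hit_rate /p /rate_lo -/w -/y /q.
    have -> : 3 * eta + xi / 2 = 2 * eta + (xi / 2 + eta) by ring.
    rewrite !expRD expRN; field.
    by rewrite !lt0r_neq0 ?expR_gt0// sqrtr_gt0 divr_gt0.
  have -> : rho * (1 + xi) / y = rho / y * (1 + xi) by field; rewrite gt_eqF.
  have ry0 : 0 <= rho / y by rewrite divr_ge0// ltW.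
  have bw0 : 0 <= b / w by rewrite divr_ge0// ltW.
  rewrite (sqrtrM _ ry0) /base (sqrtrM _ ry0) sqrtrV//.
  have -> : G * (Num.sqrt (rho / y) * Num.sqrt (1 + xi) / Num.sqrt (b / w)) *
      expR (3 * eta + xi / 2) = G * (Num.sqrt (rho / y) / Num.sqrt (b / w)) *
      (Num.sqrt (1 + xi) * expR (3 * eta + xi / 2)).
    by field; rewrite gt_eqF// sqrtr_gt0 divr_gt0.
  apply: ler_wpM2l.
    by rewrite mulr_ge0 ?divr_ge0 ?sqrtr_ge0// ltW.
  apply: (@le_trans _ _ (expR (xi / 2) * expR (3 * eta + xi / 2))).
    by rewrite ler_wpM2r ?expR_ge0// sqrt1D_le// ltW.
  rewrite -expRD ler_expR; lra.
pose rc := Num.max (chernoff_rate (- eta)) (Num.max (chernoff_rate eta)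
  (chernoff_rate (P / sX Q vU b ka kx - 1))).
have rc0 : 0 <= rc by rewrite /rc le_max chernoff_rate_ge0.
have PX : 0 < P / sX Q vU b ka kx - 1 by rewrite subr_gt0 ltr_pdivlMr// mul1r.
have rc1 : rc < 1.
  rewrite /rc !gt_max !chernoff_rate_lt1 ?oppr_eq0 ?(gt_eqF PX) ?(gt_eqF eta0)//; lra.
exists eta, xi; split => //; first by lra.
move=> delta d0.
(* The 4 counts the terms of [flaw_bound]. The rest is the prefactor in the number of words: [M]
   contributes 2 and [L] contributes [delta^-1 + 1]. The 5 in [delta / 5] below counts the terms of
   [nofit_bound]. *)
pose C := 4 + 2 * (delta^-1 + 1).
have C0 : 0 < C by rewrite /C addr_gt0// mulr_gt0// addr_gt0// invr_gt0.
have [||na naP] := @geometric_small R ra (delta ^+ 2 / C).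
- by rewrite ra0.
- by rewrite divr_gt0// exprn_gt0.
have [||nb nbP] := @geometric_small R rb (delta ^+ 2 / C).
- by rewrite rb0.
- by rewrite divr_gt0// exprn_gt0.
have [||nc ncP] := @geometric_small R rc (delta / 5).
- by rewrite rc0.
- by rewrite divr_gt0.
exists (maxn na (maxn nb nc)) => n; rewrite !geq_max => /and3P[nna nnb nnc] M MG.
have {}naP := naP n nna; have {}nbP := nbP n nnb; have {}ncP := ncP n nnc.
have pn0 : 0 < p ^+ n * delta by rewrite mulr_gt0// exprn_gt0.
pose L := (Num.truncn (p ^+ n * delta)^-1).+1.
have /andP[L1 L2] := truncn_itv (ltW (eqbRL (invr_gt0 _) pn0)).
have le_pow (u v : R) : 0 <= u -> u <= v -> u ^+ n <= v ^+ n.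
  by move=> u0 uv; rewrite lerXn2r ?nnegrE// (le_trans u0).
have chr := @chernoff_rate_ge0 R.
apply: (@scheme_codebook R n P Q vU N b ka kx c k1 k2 rho Bm Dm eta xi Q0 vU0 N0 b0
  rho0 Bm0 Dm0 _ _ sXP hrho hB hD delta M L d0).
- by rewrite eta0; lra.
- by rewrite xi0; lra.
- have e1 : chernoff_rate (- eta) ^+ n <= rc ^+ n.
    by apply: le_pow => //; rewrite /rc le_max lexx.
  have e2 : chernoff_rate eta ^+ n <= rc ^+ n.
    by apply: le_pow => //; rewrite /rc !le_max lexx orbT.
  have e3 : chernoff_rate (P / sX Q vU b ka kx - 1) ^+ n <= rc ^+ n.
    by apply: le_pow => //; rewrite /rc !le_max lexx !orbT.
  rewrite /nofit_bound; lra.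
- by rewrite -ltr_pdivrMr// div1r.
have f1 : chernoff_rate xi ^+ n <= r ^+ n by apply: le_pow => //; rewrite /r le_max lexx.
have f2 : chernoff_rate (- xi) ^+ n <= r ^+ n.
  by apply: le_pow => //; rewrite /r le_max lexx orbT.
have f3 : q ^+ n * flaw_bound n xi <= 4 * ra ^+ n.
  rewrite /ra exprMn mulrCA; apply: ler_wpM2l; first by rewrite exprn_ge0// ltW.
  rewrite /flaw_bound; lra.
have f4 : (M * L)%:R * (q ^+ n * h ^+ n) <= 2 * (delta^-1 + 1) * rb ^+ n.
  have Lle : L%:R <= (delta^-1 + 1) / p ^+ n.
    rewrite /L -natr1; apply: (@le_trans _ _ ((p ^+ n * delta)^-1 + 1)).
      by rewrite lerD2r.
    rewrite mulrDl mul1r invfM mulrC lerD2l.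
    by rewrite -[leLHS]invr1 lef_pV2 ?posrE ?exprn_gt0// exprn_ile1// ltW.
  have -> : 2 * (delta^-1 + 1) * rb ^+ n =
      (2 * G ^+ n) * ((delta^-1 + 1) / p ^+ n) * (q ^+ n * h ^+ n).
    have := lt0r_neq0 (exprn_gt0 n p0); rewrite /rb.
    move: (p) (h) (q) => p' h' q'; rewrite !exprMn exprVn.
    move: (G ^+ n) (q' ^+ n) (h' ^+ n) (p' ^+ n) => a1 a2 a3 a4 a40.
    by field; rewrite a40 gt_eqF.
  rewrite natrM; apply: ler_wpM2r; first by rewrite mulr_ge0 ?exprn_ge0// ltW.
  by apply: ler_pM.
have f5 : C * (delta ^+ 2 / C) = delta ^+ 2 by field; rewrite gt_eqF.
rewrite -f5 [leRHS]mulrDl; apply: (le_trans (lerD f3 f4)); apply: lerD.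
  by rewrite ler_wpM2l.
by rewrite ler_wpM2l// mulr_ge0// addr_ge0// invr_ge0 ltW.
Qed.

(** * Encoder and decoder of a codebook *)

Lemma measurable_from_message d (T : measurableType d) d' (U : measurableType d')
    k (f : message k * T -> U) :
  (forall m, measurable_fun setT (fun t => f (m, t))) -> measurable_fun setT f.
Proof.
move=> mf _ B mB; rewrite setTI.
rewrite (_ : f @^-1` B = \big[setU/set0]_(m : message k)
    ([set m] `*` ((fun t => f (m, t)) @^-1` B))).
  apply: bigsetU_measurable => m _; apply: measurableX => //.
  by rewrite -[X in measurable X]setTI; exact: mf.
rewrite -bigcup_seq; apply/seteqP; split => [[m t] Bt|[m t] [m' _ [/= ->]]//].
by exists m => //=; exact: mem_index_enum.
Qed.

Section codebook_code.
Context {R : realType} (n k : nat).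
Variables (P Q vU N b ka kx c k1 k2 rho Bm Dm eta xi : R).
Variable ws : nat -> seq (n.-tuple R).

Let V := n.-tuple R.
Let fit := @fit R n P Q vU b ka kx eta.
Let flawed := @flaw R n Q vU N b ka kx c k1 k2 rho Bm Dm xi.
Let hit := @hit R n Q vU N b ka kx c k1 k2 rho Bm xi.
Let fitv := @fitv R n P Q vU b ka kx eta.
Let typ := @typ R n Q vU N b ka kx c k1 k2 rho Bm xi.

Definition zero_tuple : V := [tuple 0 | _ < n].

(** Labels are naturals since lists of words are indexed by naturals. Those in the decoder's list
    are below [2 ^ k], so the default is never reached. *)
Definition message_of (j : nat) : message k :=
  if insub j is Some i then i else Ordinal (message_gt0 k).

Definition enc_fun (mv : message k * V) : V :=
  first_match (fitv^~ mv.2) (fun w => input_of kx w mv.2) zero_tuple (ws mv.1).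

Definition labelled_words : seq (nat * V) :=
  flatten [seq [seq (j, w) | w <- ws j] | j <- iota 0 (2 ^ k)].

Definition dec_default : message k * V := (message_of 0, zero_tuple).

Definition dec_fun (y : V) : message k * V :=
  first_match (fun jw => typ jw.2 y)
    (fun jw => (message_of jw.1, estimate_of k1 k2 jw.2 y))
    dec_default labelled_words.

Lemma measurable_enc_fun : measurable_fun setT enc_fun.
Proof.
apply: measurable_from_message => m.
have ma w : measurable_fun setT (fitv w) by exact: measurable_fitv.
have mi w : measurable_fun setT (@input_of R n kx w) by exact: measurable_vlin.
exact: (measurable_first_match zero_tuple (ws m) ma mi).
Qed.

Lemma measurable_dec_fun : measurable_fun setT dec_fun.
Proof.
have ma (jw : nat * V) : measurable_fun setT (typ jw.2) by exact: measurable_typ.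
have mf (jw : nat * V) : measurable_fun setT
    (fun y => (message_of jw.1, estimate_of k1 k2 jw.2 y)).
  by apply: measurable_fun_pair => //; exact: measurable_vlin.
exact: (measurable_first_match dec_default labelled_words ma mf).
Qed.

Definition codebook_code : channel_code R k n :=
  @ChannelCode R k n
    (HB.pack enc_fun (isMeasurableFun.Build _ _ _ _ _ measurable_enc_fun))
    (HB.pack dec_fun (isMeasurableFun.Build _ _ _ _ _ measurable_dec_fun)).

Lemma sqnorm_zero : sqnorm zero_tuple = 0.
Proof. by apply: big1 => i _; rewrite tnth_mktuple expr0n. Qed.

(** Every word sent has passed the power test, and the default is zero: the bound holds for all
    lists [ws], even useless ones. *)
Lemma enc_fun_power mv : 0 <= P -> sqnorm (enc_fun mv) <= n%:R * P.
Proof.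
move=> P0; rewrite /enc_fun; elim: (ws _) => [|w s IH] /=.
  by rewrite sqnorm_zero mulr_ge0.
by case: ifPn => // /and5P[].
Qed.

Lemma dec_fun_bound y : 0 <= Bm -> 0 <= xi ->
  sqnorm (dec_fun y).2 <= n%:R * (Bm * (1 + xi)).
Proof.
move=> B0 x0; rewrite /dec_fun; elim: labelled_words => [|jw s IH] /=.
  by rewrite sqnorm_zero !mulr_ge0// addr_ge0.
by case: ifPn => // /and3P[].
Qed.

Lemma decoding (m : message k) (e : V * V * V) :
    ~~ fail fit flawed hit true (flatten [seq ws j | j <- iota 0 m]) (ws m) e ->
  let y := [tuple tnth (enc_fun (m, env_obs e)) i + tnth e.1.1 i + tnth e.2 i | i < n] in
  (dec_fun y).1 = m /\
  sqnorm (vlin 1 e.1.1 (- 1) (dec_fun y).2) <= n%:R * (Dm * (1 + xi)).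
Proof.
move=> nf.
pose gl j l := flatten [seq [seq (j', w) | w <- ws j'] | j' <- iota j l].
have glE : labelled_words = gl 0 m ++ [seq (nat_of_ord m, w) | w <- ws m] ++
    gl m.+1 (2 ^ k - m.+1)%N.
  have mk : (m < 2 ^ k)%N by exact: ltn_ord.
  have iE : iota 0 (2 ^ k) = iota 0 m ++ nat_of_ord m :: iota m.+1 (2 ^ k - m.+1).
    have := iotaD 0 m (2 ^ k - m); rewrite (subnKC (ltnW mk)) => ->.
    by rewrite add0n -(subnSK mk).
  by rewrite /labelled_words iE map_cat flatten_cat.
have glW : unzip2 (gl 0 m) = flatten [seq ws j | j <- iota 0 m].
  rewrite /gl /unzip2 map_flatten -map_comp; congr flatten; apply: eq_map => j /=.
  by rewrite -map_comp map_id_in.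
rewrite -glW in nf.
have typ_flaw w : ~~ typ w (output_of kx w e) -> flawed (w, e).
  by rewrite /flawed /flaw negb_and => ->.
have [w [_ nflaw encE decE]] := @fail_first_match _ _ _ _ V nat
  fit flawed typ (fun z => output_of kx z.1 z.2) m (gl 0 m) (gl m.+1 (2 ^ k - m.+1)%N)
  (ws m) e typ_flaw nf.
have {}encE : enc_fun (m, env_obs e) = input_of kx w (env_obs e) by exact: encE.
rewrite encE -/(output_of kx w e) /dec_fun glE decE/=; split.
  by rewrite /message_of valK.
by move: nflaw; rewrite /flawed /flaw negbK => /andP[].
Qed.

End codebook_code.

(** * Power, error and distortion on an arbitrary realization *)

Section sum_expectation.
Context d (T : measurableType d) (R : realType) (Pr : probability T R) (n : nat).
Variable f : 'I_n -> T -> R.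
Hypotheses (mf : forall i, measurable_fun setT (f i)) (f0 : forall i w, 0 <= f i w).

Lemma sum_expectation :
  (\sum_(i < n) 'E_Pr[f i] = \int[Pr]_w (\sum_(i < n) f i w)%:E)%E.
Proof.
under [RHS]eq_integral do rewrite -sumEFin.
rewrite ge0_integral_sum//.
- by apply: eq_bigr => i _; rewrite unlock.
- by move=> i; apply/measurable_EFinP.
- by move=> i w _; rewrite lee_fin.
Qed.

End sum_expectation.

Section performance.
Context {R : realType} (n k : nat).
Variables (P Q vU N B D1 p : R) (C : channel_code R k n).
Variable F : message k -> n.-tuple R * n.-tuple R * n.-tuple R -> bool.
Hypotheses (Q0 : 0 < Q) (B0 : 0 <= B) (D10 : 0 <= D1) (p0 : 0 <= p).
Hypothesis mF : forall m, measurable_fun setT (F m).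
Hypothesis enc_power : forall mv, sqnorm (enc C mv) <= n%:R * P.
Hypothesis dec_bound : forall y, sqnorm (dec C y).2 <= n%:R * B.
Hypothesis dec_ok : forall m e, ~~ F m e ->
  let y := [tuple tnth (enc C (m, env_obs e)) i + tnth e.1.1 i + tnth e.2 i | i < n] in
  (dec C y).1 = m /\ sqnorm (vlin 1 e.1.1 (- 1) (dec C y).2) <= n%:R * D1.
Hypothesis F_small : forall m, pr (env n Q vU N) (F m) <= p.

Context d (Omega : measurableType d) (Pr : probability Omega R).
Variables (S U Z : nat -> {RV Pr >-> R}) (M : {RV Pr >-> message k}).

Let env_block := env_block S U Z n.

Lemma measurable_observation : measurable_fun setT (observation S U n).
Proof. by apply: measurable_mktuple => i; exact: measurable_funD. Qed.

Lemma measurable_input : measurable_fun setT (input S U M C).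
Proof.
apply: (measurableT_comp (measurable_funP (enc C))).
by apply: measurable_fun_pair => //; exact: measurable_observation.
Qed.

Lemma measurable_output : measurable_fun setT (output S U Z M C).
Proof.
apply: measurable_mktuple => i; apply: measurable_funD => //.
apply: measurable_funD => //; exact: (measurable_comp_tnth _ measurable_input).
Qed.

Lemma measurable_decoded : measurable_fun setT (dec C \o output S U Z M C).
Proof. exact: (measurableT_comp (measurable_funP (dec C)) measurable_output). Qed.

Lemma average_power_le : 0 <= P -> (average_power S U M C <= P%:E)%E.
Proof.
move=> P0; rewrite /average_power.
have mi i : measurable_fun setT (fun w => tnth (input S U M C w) i ^+ 2).
  by apply: measurable_funX; exact: (measurable_comp_tnth _ measurable_input).
rewrite sum_expectation//; last by move=> i w; exact: sqr_ge0.
apply: (@le_trans _ _ ((n%:R^-1)%:E * (n%:R * P)%:E)%E).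
  apply: lee_wpmul2l; first by rewrite lee_fin invr_ge0.
  rewrite -[leRHS](integral_cst_prob Pr); apply: ge0_le_integral => //.
  - by move=> w _; rewrite lee_fin sumr_ge0// => i _; exact: sqr_ge0.
  - by apply/measurable_EFinP; apply: measurable_sum.
  - by move=> w _; rewrite lee_fin; exact: enc_power.
(* At length 0 the prefactor [n%:R^-1] is 0, and the bound is read as 0. *)
rewrite -EFinM lee_fin mulrA; have [->|n0] := posnP n; first by rewrite mulr0 mul0r.
by rewrite mulVf ?mul1r// pnatr_eq0 -lt0n.
Qed.

Hypothesis model : channel_model Q N vU S U Z.
Hypothesis msg : message_model S U Z n M.

Let event m := M @^-1` [set m] `&` env_block @^-1` [set e | F m e].

Let measurable_event m : measurable (event m).
Proof.
apply: measurableI.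
  by rewrite -[X in measurable X]setTI; exact: (measurable_funP M).
rewrite -[X in measurable X]setTI; apply: measurable_env_block => //.
exact: (measurable_pred (mF m)).
Qed.

Let Pr_event m : (Pr (event m) <= ((2 ^ k)%:R^-1 * p)%:E)%E.
Proof.
have mFm := measurable_pred (mF m).
pose A := tnth [tuple M @^-1` [set m]; env_block @^-1` [set e | F m e]].
have FA i : i \in enum 'I_2 ->
    tnth [tuple sigma_rv M; sigma_rv env_block] i (A i).
  move=> _; rewrite (tnth_nth set0) /A (tnth_nth set0).
  case: i => -[|[|//]] i2 /=.
    by exists [set m] => //; rewrite setTI.
  by exists [set e | F m e] => //; rewrite setTI.
have := mutually_independent_prod (message_indep msg) (enum_uniq _) FA.
rewrite big_enum !big_ord_recl big_ord0 /A !(tnth_nth set0)/= mule1.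
rewrite (_ : \bigcap_(i in _) _ = event m); last first.
  apply/seteqP; split => w /=.
    move=> H; have mem i : [set` enum 'I_2] i by rewrite /= mem_enum.
    split.
      by have := H ord0 (mem _); rewrite (tnth_nth set0).
    by have := H (@Ordinal 2 1 isT) (mem _); rewrite (tnth_nth set0).
  by move=> [H1 H2] i _; rewrite (tnth_nth set0); case: i => -[|[|//]].
move=> ->; rewrite (message_uniform msg).
have -> : Pr (env_block @^-1` [set e | F m e]) = (pr (env n Q vU N) (F m))%:E.
  by rewrite -prE//; exact: (env_block_law model).
rewrite -EFinM lee_fin ler_wpM2l// invr_ge0; exact: ler0n.
Qed.

Let Bad w := F (M w) (env_block w).

Let BadE : [set w | Bad w] = \big[setU/set0]_(m : message k) event m.
Proof.
rewrite -bigcup_seq; apply/seteqP; split => [w Bw|w [m _ [/= <-]]//].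
by exists (M w) => //=; exact: mem_index_enum.
Qed.

Let measurable_Bad : measurable [set w | Bad w].
Proof. by rewrite BadE; apply: bigsetU_measurable. Qed.

Let Pr_Bad : (Pr [set w | Bad w] <= p%:E)%E.
Proof.
rewrite BadE; apply: (@le_trans _ _ (\sum_(m : message k) Pr (event m))%E).
  have sub (s : seq (message k)) :
    (Pr (\big[setU/set0]_(m <- s) event m) <= \sum_(m <- s) Pr (event m))%E.
    elim: s => [|m s IH]; first by rewrite !big_nil measure0.
    rewrite !big_cons; apply: (le_trans (measureU2 _ _ _)) => //.
      by apply: bigsetU_measurable.
    by rewrite leeD2l.
  exact: sub.
apply: (@le_trans _ _ (\sum_(m : message k) ((2 ^ k)%:R^-1 * p)%:E)%E).
  by apply: lee_sum => m _; exact: Pr_event.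
rewrite sumEFin lee_fin sumr_const (_ : #|_| = (2 ^ k)%N); last exact: card_ord.
by rewrite -[leLHS]mulr_natl mulrA divff ?mul1r//.
Qed.

Let outputE w : output S U Z M C w =
  [tuple tnth (enc C (M w, env_obs (env_block w))) i + tnth (env_block w).1.1 i +
     tnth (env_block w).2 i | i < n].
Proof.
have obsE : observation S U n w = env_obs (env_block w).
  by apply: eq_from_tnth => i; rewrite !tnth_mktuple.
by apply: eq_from_tnth => i; rewrite !tnth_mktuple /input obsE.
Qed.

Lemma error_probability_le : (error_probability S U Z M C <= p%:E)%E.
Proof.
apply: le_trans Pr_Bad; apply: le_measure; rewrite ?inE//.
  rewrite (_ : [set w | _] = \big[setU/set0]_(m : message k)
      (M @^-1` [set m] `&` message_estimate S U Z M C @^-1` (~` [set m]))).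
    apply: bigsetU_measurable => m _; apply: measurableI.
      by rewrite -[X in measurable X]setTI; exact: (measurable_funP M).
    rewrite -[X in measurable X]setTI.
    exact: (measurableT_comp measurable_fst measurable_decoded).
  rewrite -bigcup_seq; apply/seteqP; split => [w ne|w [m _ [/= <-]]//].
  by exists (M w) => //=; exact: mem_index_enum.
move=> w /= ne; apply: contrapT => /negP /dec_ok[+ _].
by rewrite -outputE => /ne.
Qed.

(** The exponent 1 / 4Q is half of the critical value 1 / 2Q, so that the moment is finite and equal
    to the inverse root of 1 - 1/2. *)
Let expS i : (\int[Pr]_w (expR ((4 * Q)^-1 * S i w ^+ 2))%:E = (Num.sqrt 2)%:E)%E.
Proof.
have me : measurable_fun setT (fun x : R => (expR ((4 * Q)^-1 * x ^+ 2))%:E).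
  apply/measurable_EFinP; apply: measurableT_comp => //.
  by apply: measurable_funM => //; exact: measurable_funX.
rewrite -[LHS](ge0_integral_distribution (S i) me); last first.
  by move=> x; rewrite lee_fin expR_ge0.
rewrite (@eq_measure_integral _ _ _ _ (gauss Q)); last first.
  move=> A mA _; transitivity (gaussian Q A); last exact: gaussianE.
  exact: (state_law model).
have lt1 : 2 * (4 * Q)^-1 * Q < 1.
  by rewrite (_ : _ * _ = 1 / 2); [lra|field; rewrite gt_eqF].
rewrite (gauss_expR_sqr (ltW Q0) lt1); congr EFin.
rewrite -[in RHS](invrK 2) sqrtrV ?invr_ge0//; congr (Num.sqrt _)^-1.
by field; rewrite gt_eqF.
Qed.

(* On the error event, [x <= expR x] is applied to [(S_i ^ 2 - K) / 4 Q]. *)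
Let distortion_pointwise (K : R) w : 0 <= K ->
  \sum_(i < n) (S i w - tnth (state_estimate S U Z M C w) i) ^+ 2 <=
  n%:R * D1 + (n%:R * (2 * B + 2 * K) * (Bad w)%:R +
    \sum_(i < n) (8 * Q * expR (- ((4 * Q)^-1 * K))) *
      expR ((4 * Q)^-1 * S i w ^+ 2)).
Proof.
move=> K0.
have tail0 : 0 <= \sum_(i < n) (8 * Q * expR (- ((4 * Q)^-1 * K))) *
      expR ((4 * Q)^-1 * S i w ^+ 2).
  by apply: sumr_ge0 => i _; rewrite !mulr_ge0 ?expR_ge0// ltW.
case: (boolP (Bad w)) => [_|good]; last first.
  have [_] := dec_ok good; rewrite -outputE mulr0 add0r => h.
  rewrite -[leLHS]addr0; apply: lerD => //; apply: le_trans h.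
  apply: eq_ler; apply: eq_bigr => i _.
  by rewrite !tnth_mktuple mul1r mulN1r.
rewrite mulr1 -[leLHS]add0r; apply: lerD; first by rewrite mulr_ge0.
have := dec_bound (output S U Z M C w); rewrite -/(state_estimate S U Z M C w) => h.
apply: (@le_trans _ _ (\sum_(i < n) (2 * S i w ^+ 2 +
    2 * tnth (state_estimate S U Z M C w) i ^+ 2))).
  apply: ler_sum => i _; rewrite -subr_ge0.
  set x := S i w; set y := tnth _ _.
  have -> : 2 * x ^+ 2 + 2 * y ^+ 2 - (x - y) ^+ 2 = (x + y) ^+ 2 by ring.
  exact: sqr_ge0.
rewrite big_split/= -mulr_sumr -[X in _ + X]mulr_sumr.
have h2 : \sum_(i < n) S i w ^+ 2 <= n%:R * K + \sum_(i < n) (4 * Q *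
    expR (- ((4 * Q)^-1 * K))) * expR ((4 * Q)^-1 * S i w ^+ 2).
  rewrite mulr_natl -[X in K *+ X](card_ord n) -sumr_const -big_split/=.
  apply: ler_sum => i _; rewrite -mulrA -expRD.
  set x := S i w ^+ 2.
  have Q4 : 0 < 4 * Q by rewrite mulr_gt0.
  have h' := ler_wpM2l (ltW Q4) (expR_ge1Dx (- ((4 * Q)^-1 * K) + (4 * Q)^-1 * x)).
  have e4 : 4 * Q * (1 + (- ((4 * Q)^-1 * K) + (4 * Q)^-1 * x)) = 4 * Q - K + x.
    by field; rewrite gt_eqF.
  by rewrite e4 in h'; lra.
have -> : \sum_(i < n) 8 * Q * expR (- ((4 * Q)^-1 * K)) *
    expR ((4 * Q)^-1 * S i w ^+ 2) = 2 * \sum_(i < n) 4 * Q *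
    expR (- ((4 * Q)^-1 * K)) * expR ((4 * Q)^-1 * S i w ^+ 2).
  by rewrite mulr_sumr; apply: eq_bigr => i _; ring.
rewrite /sqnorm in h; lra.
Qed.

(** The truncation level [K] decouples two effects: the last term becomes small for large [K],
    uniformly in [n], and once [K] is fixed the middle term becomes small with the failure
    probability [p]. *)
Lemma average_distortion_le (K : R) : 0 <= K ->
  (average_distortion S U Z M C <=
   (D1 + ((2 * B + 2 * K) * p + 8 * Q * expR (- ((4 * Q)^-1 * K)) * Num.sqrt 2))%:E)%E.
Proof.
move=> K0; rewrite /average_distortion.
set c := 8 * Q * expR (- ((4 * Q)^-1 * K)).
have c0 : 0 <= c by rewrite /c !mulr_ge0 ?expR_ge0// ltW.
have mS i : measurable_fun setT (fun w => expR ((4 * Q)^-1 * S i w ^+ 2)).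
  apply: measurableT_comp => //; apply: measurable_funM => //.
  by apply: measurable_funX.
have mBad : measurable_fun setT Bad.
  move=> _; apply: (measurable_fun_bool true) => //.
  by rewrite setTI (_ : Bad @^-1` [set true] = [set w | Bad w])//; apply/seteqP; split.
have mest (i : 'I_n) :
    measurable_fun setT (fun w => (S i w - tnth (state_estimate S U Z M C w) i) ^+ 2).
  apply: measurable_funX; apply: measurable_funB => //; apply: measurable_comp_tnth.
  exact: (measurableT_comp measurable_snd measurable_decoded).
rewrite sum_expectation//; last by move=> i w; exact: sqr_ge0.
have nB0 : 0 <= n%:R * (2 * B + 2 * K) by rewrite mulr_ge0// addr_ge0// mulr_ge0.
apply: (@le_trans _ _ ((n%:R^-1)%:E *
  (n%:R * (D1 + ((2 * B + 2 * K) * p + c * Num.sqrt 2)))%:E)%E); last first.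
  rewrite -EFinM lee_fin mulrA; have [->|n0] := posnP n.
    rewrite mulr0 mul0r; apply: addr_ge0 => //; apply: addr_ge0.
      by apply: mulr_ge0 => //; apply: addr_ge0; exact: mulr_ge0.
    by apply: mulr_ge0 => //; exact: sqrtr_ge0.
  by rewrite mulVf ?mul1r// pnatr_eq0 -lt0n.
apply: lee_wpmul2l; first by rewrite lee_fin invr_ge0.
apply: (@le_trans _ _ (\int[Pr]_w ((n%:R * D1)%:E +
   ((n%:R * (2 * B + 2 * K))%:E * ((Bad w)%:R)%:E +
    \sum_(i < n) c%:E * (expR ((4 * Q)^-1 * S i w ^+ 2))%:E)))%E).
  apply: ge0_le_integral => //.
  - by move=> w _; rewrite lee_fin sumr_ge0// => i _; exact: sqr_ge0.
  - by apply/measurable_EFinP; apply: measurable_sum.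
  - apply: emeasurable_funD => //; apply: emeasurable_funD.
      by apply: emeasurable_funM => //; exact: measurable_natr_bool.
    apply: emeasurable_sum => i; apply: emeasurable_funM => //; exact/measurable_EFinP.
  - move=> w _.
    have -> : (\sum_(i < n) c%:E * (expR ((4 * Q)^-1 * S i w ^+ 2))%:E =
        (\sum_(i < n) c * expR ((4 * Q)^-1 * S i w ^+ 2))%:E)%E by rewrite -sumEFin.
    by rewrite -EFinM -!EFinD lee_fin; exact: distortion_pointwise.
have i1 : (\int[Pr]_w (\sum_(i < n) c%:E * (expR ((4 * Q)^-1 * S i w ^+ 2))%:E) =
    (n%:R * (c * Num.sqrt 2))%:E)%E.
  rewrite ge0_integral_sum//; last 2 first.
  - by move=> i; apply: emeasurable_funM => //; exact/measurable_EFinP.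
  - by move=> i w _; rewrite -EFinM lee_fin mulr_ge0 ?expR_ge0.
  rewrite (eq_bigr (fun=> (c * Num.sqrt 2)%:E)).
    by rewrite sumEFin sumr_const card_ord mulr_natl.
  move=> i _; rewrite ge0_integralZl; last 4 first.
  - exact: measurableT.
  - exact/measurable_EFinP.
  - by move=> w _; rewrite lee_fin expR_ge0.
  - by rewrite lee_fin.
  by rewrite expS EFinM.
have i2 : (\int[Pr]_w ((n%:R * (2 * B + 2 * K))%:E * ((Bad w)%:R)%:E) <=
    (n%:R * ((2 * B + 2 * K) * p))%:E)%E.
  rewrite ge0_integralZl; last 4 first.
  - exact: measurableT.
  - exact: measurable_natr_bool.
  - by move=> w _; rewrite lee_fin.
  - by rewrite lee_fin.
  rewrite -pr_integral// -EFinM lee_fin -[leLHS]mulrA; apply: ler_wpM2l => //.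
  apply: ler_wpM2l; first by rewrite addr_ge0// mulr_ge0.
  by rewrite -lee_fin -prE.
have mB1 : measurable_fun setT
    (fun w => (n%:R * (2 * B + 2 * K))%:E * ((Bad w)%:R)%:E)%E.
  by apply: emeasurable_funM => //; exact: measurable_natr_bool.
have mT1 : measurable_fun setT
    (fun w => \sum_(i < n) c%:E * (expR ((4 * Q)^-1 * S i w ^+ 2))%:E)%E.
  by apply: emeasurable_sum => i; apply: emeasurable_funM => //; exact/measurable_EFinP.
have T0 w : (0 <= \sum_(i < n) c%:E * (expR ((4 * Q)^-1 * S i w ^+ 2))%:E)%E.
  by apply: sume_ge0 => i _; rewrite mule_ge0 ?lee_fin ?expR_ge0.
have B1 w : (0 <= (n%:R * (2 * B + 2 * K))%:E * ((Bad w)%:R)%:E)%E.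
  by rewrite mule_ge0 ?lee_fin.
rewrite ge0_integralD; last 5 first.
- exact: measurableT.
- by move=> w _; rewrite lee_fin mulr_ge0.
- exact: measurable_cst.
- by move=> w _; rewrite adde_ge0.
- exact: emeasurable_funD.
rewrite integral_cst_prob ge0_integralD; last 5 first.
- exact: measurableT.
- by move=> w _; exact: B1.
- exact: mB1.
- by move=> w _; exact: T0.
- exact: mT1.
have -> : ((n%:R * (D1 + ((2 * B + 2 * K) * p + c * Num.sqrt 2)))%:E =
    (n%:R * D1)%:E + ((n%:R * ((2 * B + 2 * K) * p))%:E + (n%:R * (c * Num.sqrt 2))%:E))%E.
  by rewrite -!EFinD; congr EFin; ring.
by rewrite i1; apply: leeD2l; apply: leeD.
Qed.

End performance.

(** * From codes of large length to achievability *)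

(** Rounding up to whole bits costs less than one bit, hence the factor 2. *)
Lemma message_count (R : realType) (rate : R) n : 0 <= rate ->
  (2 ^ message_bits rate n)%:R <= 2 * expR (rate * ln 2) ^+ n :> R.
Proof.
move=> r0; have nr0 : 0 <= n%:R * rate by rewrite mulr_ge0.
have c0 : (0 <= Num.ceil (n%:R * rate))%R by rewrite ceil_ge0 (lt_le_trans _ nr0)// ltrN10.
have kE : (message_bits rate n)%:R = (Num.ceil (n%:R * rate))%:~R :> R.
  by rewrite /message_bits pmulrn gez0_abs.
have kle : (message_bits rate n)%:R <= n%:R * rate + 1.
  by have := ceilB1_lt (n%:R * rate); rewrite intrB -kE; lra.
have l2 : 0 <= ln 2 :> R by rewrite ln_ge0// ler1n.
have e2 : expR (ln 2) = 2 :> R by rewrite lnK// posrE.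
have -> : (2 ^ message_bits rate n)%:R = expR ((message_bits rate n)%:R * ln 2) :> R.
  by rewrite expRM_natl e2 natrX.
have -> : 2 * expR (rate * ln 2) ^+ n = expR (ln 2 + n%:R * (rate * ln 2)) :> R.
  by rewrite expRD e2 expRM_natl.
rewrite ler_expR.
have := ler_wpM2r l2 kle; lra.
Qed.

Section codes.
Context {R : realType} {k n : nat}.

(** Separate from [good_code] because the power constraint is required at every length, error and
    distortion only in the limit. *)
Definition power_limited (P : R) (C : channel_code R k n) :=
  forall mv, sqnorm (enc C mv) <= n%:R * P.

Definition good_code (Q N vU D eps : R) (C : channel_code R k n) :=
  forall d (Omega : measurableType d) (Pr : probability Omega R)
    (S U Z : nat -> {RV Pr >-> R}) (M : {RV Pr >-> message k}),
  channel_model Q N vU S U Z -> message_model S U Z n M ->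
  (error_probability S U Z M C <= eps%:E)%E /\
  (average_distortion S U Z M C <= (D + eps)%:E)%E.

Lemma good_code_le (Q N vU D eps eps' : R) C :
  eps <= eps' -> good_code Q N vU D eps C -> good_code Q N vU D eps' C.
Proof.
move=> le gC d Omega Pr S U Z M model msg.
have [e1 e2] := gC d Omega Pr S U Z M model msg; split.
  by apply: le_trans e1 _; rewrite lee_fin.
by apply: le_trans e2 _; rewrite lee_fin lerD2l.
Qed.

End codes.

Lemma exists_good_codes (R : realType)
    (rate P Q vU N b ka kx c k1 k2 rho Bm Dm D eps : R) :
    0 <= rate -> 0 < P -> 0 < Q -> 0 <= vU -> 0 < N -> 0 < b -> 0 < rho ->
    0 < Bm -> 0 < Dm ->
    sX Q vU b ka kx < P ->
    (1 - c) ^+ 2 * b + (1 + kax ka kx - c * ka) ^+ 2 * Q +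
      (kax ka kx - c * ka) ^+ 2 * vU + N <= rho ->
    (k1 + k2) ^+ 2 * b + (k1 * (1 + kax ka kx) + k2 * ka) ^+ 2 * Q +
      (k1 * kax ka kx + k2 * ka) ^+ 2 * vU + k1 ^+ 2 * N <= Bm ->
    (k1 + k2) ^+ 2 * b + (1 - k1 * (1 + kax ka kx) - k2 * ka) ^+ 2 * Q +
      (k1 * kax ka kx + k2 * ka) ^+ 2 * vU + k1 ^+ 2 * N <= Dm ->
    expR (rate * ln 2) ^+ 2 * (sW Q vU b ka * rho) < b * sY Q vU N b ka kx ->
    0 < eps -> Dm <= D + eps / 3 ->
  exists n0, forall n, (n0 <= n)%N ->
    exists C : channel_code R (message_bits rate n) n,
      power_limited P C /\ good_code Q N vU D eps C.
Proof.
move=> r0 P0 Q0 vU0 N0 b0 rho0 Bm0 Dm0 sXP hrho hB hD core eps0 DmD.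
(* The excess [eps] over [D] is divided into [eps / 3] already present in [Dm], [eps / 3] for the
   tolerance [xi], [eps / 6] for the tail beyond [K] and [eps / 6] for the term [w * p]. *)
pose x0 := Num.min 1 (eps / (3 * Dm)).
have x00 : 0 < x0 by rewrite lt_min ltr01 divr_gt0// mulr_gt0.
have [eta [xi [xi0 xi1 xix H]]] := exists_codebooks (ltW Q0) vU0 N0 b0 rho0 Bm0 Dm0
  sXP hrho hB hD (expR_gt0 _) core x00.
have xiD : Dm * (1 + xi) <= D + eps / 3 + eps / 3.
  have : xi <= eps / (3 * Dm) by rewrite (le_trans xix)// /x0 ge_min lexx orbT.
  rewrite ler_pdivlMr ?mulr_gt0// => h; lra.
pose B := Bm * (1 + xi); have B0 : 0 <= B by rewrite mulr_ge0// ?addr_ge0// ltW.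
(* Since exp(-t) <= 1 / t, this value brings the tail term below [8 * Q * Num.sqrt 2 / t], which is
   [eps / 6]. *)
pose t := 48 * Q * Num.sqrt 2 / eps.
have s0 : 0 < Num.sqrt 2 :> R by rewrite sqrtr_gt0.
have t0 : 0 < t by rewrite !mulr_gt0// invr_gt0.
pose K := 4 * Q * t; have K0 : 0 <= K.
  by apply: mulr_ge0; [rewrite mulr_ge0// ltW|exact: ltW].
have tail : 8 * Q * expR (- ((4 * Q)^-1 * K)) * Num.sqrt 2 <= eps / 6.
  have -> : (4 * Q)^-1 * K = t by rewrite /K; field; rewrite gt_eqF.
  rewrite expRN ler_pdivlMr//.
  rewrite (_ : _ * 6 = t * eps / expR t); last first.
    by rewrite /t; field; rewrite !gt_eqF// expR_gt0.
  rewrite ler_pdivrMr ?expR_gt0// mulrC ler_pM2l//.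
  by have := expR_ge1Dx t; lra.
pose w := 2 * B + 2 * K; have w0 : 0 <= w by rewrite addr_ge0// mulr_ge0.
have dw : 0 < 1 + 6 * w by rewrite ltr_wpDr// mulr_ge0.
pose p := eps / (1 + 6 * w); have p0 : 0 < p by rewrite divr_gt0.
have pE : p + 6 * w * p = eps by rewrite /p; field; rewrite gt_eqF.
have wp0 : 0 <= w * p by rewrite mulr_ge0// ltW.
(* The codebooks fail with probability at most four times their parameter. *)
have [|n0 H0] := H (p / 4); first by rewrite divr_gt0.
exists n0 => n nn0; have [ws wsP] := H0 n nn0 _ (message_count n r0).
exists (codebook_code (message_bits rate n) P Q vU N b ka kx c k1 k2 rho Bm eta xi ws).
split=> [mv|d Omega Pr S U Z M model msg]; first exact: (enc_fun_power _ _ _ _ _ _ _ _ (ltW P0)).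
set C := codebook_code _ _ _ _ _ _ _ _ _ _ _ _ _ _ _ _.
pose F (m : message (message_bits rate n)) := fail (fit P Q vU b ka kx eta)
  (flaw Q vU N b ka kx c k1 k2 rho Bm Dm xi) (hit Q vU N b ka kx c k1 k2 rho Bm xi)
  true (flatten [seq ws j | j <- iota 0 m]) (ws m).
have mF m : measurable_fun setT (F m).
  apply: measurable_fail => [||w'].
  - exact: measurable_fit.
  - exact: measurable_flaw.
  - exact: measurable_hit.
have dec_ok m e : ~~ F m e ->
    let y := [tuple tnth (enc C (m, env_obs e)) i + tnth e.1.1 i + tnth e.2 i | i < n] in
    (dec C y).1 = m /\ sqnorm (vlin 1 e.1.1 (- 1) (dec C y).2) <= n%:R * (Dm * (1 + xi)).
  exact: decoding.
have F_small m : pr (env n Q vU N) (F m) <= p.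
  have := wsP m (ltn_ord m); rewrite -/(F m) => h; lra.
have dec_bound y : sqnorm (dec C y).2 <= n%:R * B by apply: dec_fun_bound; exact: ltW.
split.
  apply: le_trans (error_probability_le mF dec_ok F_small model msg) _.
  by rewrite lee_fin; lra.
have D10 : 0 <= Dm * (1 + xi) by rewrite mulr_ge0// ?addr_ge0// ltW.
apply: le_trans (average_distortion_le Q0 B0 D10 (ltW p0) mF dec_bound dec_ok F_small
  model msg K0) _.
rewrite lee_fin -/w; lra.
Qed.

(** At index [n] one takes an [x] meeting the strictest attainable requirement among the first [n];
    by monotonicity it meets the weaker ones too. No sequence of thresholds has to be
    constructed. *)
Lemma diagonal_choice (T : nat -> Type) (p : nat -> forall n, T n -> Prop) :
  (forall i j n x, (i <= j)%N -> p j n x -> p i n x) ->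
  (forall n, exists x, p 0%N n x) ->
  (forall j, exists n0, forall n, (n0 <= n)%N -> exists x, p j n x) ->
  exists x : forall n, T n,
    (forall n, p 0%N n (x n)) /\
    (forall j, exists n0, forall n, (n0 <= n)%N -> p j n (x n)).
Proof.
move=> mono p0 ev.
have best m n : exists x, p 0%N n x /\
    forall j, (j < m)%N -> (exists y, p j n y) -> p j n x.
  elim: m => [|m [x [x0 xP]]]; first by have [x x0] := p0 n; exists x.
  have [[y py]|no] := pselect (exists y, p m n y).
    exists y; split=> [|j jm _]; first exact: mono py.
    exact: mono py.
  exists x; split=> // j; rewrite ltnS leq_eqVlt => /orP[/eqP->//|]; exact: xP.
pose x n := projT1 (cid (best n n)); exists x.
have xP n : _ := projT2 (cid (best n n)).
split=> [n|j]; first by case: (xP n).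
have [n0 n0P] := ev j; exists (maxn n0 j.+1) => n; rewrite geq_max => /andP[nn0 jn].
by have [_] := xP n; apply => //; exact: n0P.
Qed.

Lemma limn_esup_le (R : realType) (u : (\bar R)^nat) (l : \bar R) (n0 : nat) :
  (forall n, (n0 <= n)%N -> (u n <= l)%E) -> (limn_esup u <= l)%E.
Proof.
move=> ul; rewrite limn_esup_lim.
have cv : cvgn (esups u) by exact: is_cvg_esups.
apply: lime_le => //; near=> n.
apply: ub_ereal_sup => _ [m /= nm <-]; apply: ul; apply: leq_trans nm.
by near: n; exists n0.
Unshelve. all: by end_near. Qed.

Lemma achievable_good_codes (R : realType) (P Q N vU rate D : R) :
  0 <= P -> (forall eps : R, 0 < eps -> exists n0, forall n, (n0 <= n)%N ->
    exists C : channel_code R (message_bits rate n) n,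
      power_limited P C /\ good_code Q N vU D eps C) ->
  achievable P Q N vU rate D.
Proof.
move=> P0 codes.
(* Requirement 0 is the power constraint alone, so that it can be met at every length; requirement
   [j > 0] adds error and excess distortion at most 1 / j. *)
pose p j n (C : channel_code R (message_bits rate n) n) := power_limited P C /\
  (if j is i.+1 then good_code Q N vU D i.+1%:R^-1 C else True).
have [|n|j|C [C0 CP]] := @diagonal_choice _ p.
- move=> [|i] [|j] n x //=; rewrite /p; [by move=> _ []|rewrite ltnS => ij [px gx]].
  split=> //; apply: good_code_le gx.
  by rewrite lef_pV2 ?posrE ?ltr0n// ler_nat.
(* The empty codebook always sends the zero word. *)
- exists (codebook_code _ P 0 0 0 0 0 0 0 0 0 0 0 0 0 (fun=> [::])); split => // mv.
  exact: enc_fun_power.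
- case: j => [|j].
    have [n0 n0P] := codes 1 ltr01; exists n0 => n /n0P[C [pC gC]].
    by exists C; split.
  have [|n0 n0P] := codes j.+1%:R^-1; first by rewrite invr_gt0.
  by exists n0 => n /n0P.
exists C => d Omega Pr S U Z M model msg.
have small (eps : R) : 0 < eps -> exists j : nat, j.+1%:R^-1 <= eps.
  move=> eps0; have [j] := ltr_add_invr eps0; rewrite add0r => /ltW h.
  by exists j.
split.
- by move=> n; apply: average_power_le => //; case: (C0 n).
- apply: limn_esup_le_cvg => //; apply/lee_addgt0Pr => eps eps0.
  have [j je] := small _ eps0; rewrite add0e.
  have [n0 n0P] := CP j.+1; apply: (@limn_esup_le _ _ _ n0) => n nn0.
  have [_ gC] := n0P n nn0; have [el _] := gC _ _ _ _ _ _ _ model (msg n).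
  by apply: le_trans el _; rewrite lee_fin.
- apply/lee_addgt0Pr => eps eps0; have [j je] := small _ eps0.
  have [n0 n0P] := CP j.+1; apply: (@limn_esup_le _ _ _ n0) => n nn0.
  have [_ gC] := n0P n nn0; have [_ dl] := gC _ _ _ _ _ _ _ model (msg n).
  by apply: le_trans dl _; rewrite -EFinD lee_fin lerD2l.
Qed.

(* The variance of [l S + k1 Y + k2 W], once from the representation by independent
   variables and once from the covariances. *)
Lemma test_channel_form (F : fieldType) (Q vU N b g a l k1 k2 : F) : Q + vU != 0 ->
  let c0 := Q / (Q + vU) in let Q' := Q ^+ 2 / (Q + vU) in
  let N' := Q * vU / (Q + vU) in
  (k1 + k2) ^+ 2 * b + (l + k1 * (1 + g * c0) + k2 * (a * c0)) ^+ 2 * Q +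
    (k1 * (g * c0) + k2 * (a * c0)) ^+ 2 * vU + k1 ^+ 2 * N =
  l ^+ 2 * Q + 2 * l * (k1 * ((1 + g) * Q' + N') + k2 * (a * Q')) +
    (k1 ^+ 2 * (b + (1 + g) ^+ 2 * Q' + N' + N) +
     2 * k1 * k2 * (b + a * (1 + g) * Q') + k2 ^+ 2 * (b + a ^+ 2 * Q')).
Proof. by move=> QU /=; field. Qed.

(** * Linear estimation in the test channel and the choice of parameters *)

(** Solving [A k = r] replaces the explicit inverse. For the covariance matrix of (Y, W) these are
    the normal equations, and [k1], [k2] are the coefficients of the best linear estimate of S. *)
Lemma quadratic_form_inv2 (F : fieldType) (A : 'M[F]_2) (r : 'cV[F]_2) (k1 k2 : F) :
  A 0 0 * A 1 1 != A 0 1 * A 1 0 ->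
  A 0 0 * k1 + A 0 1 * k2 = r 0 0 -> A 1 0 * k1 + A 1 1 * k2 = r 1 0 ->
  (r^T *m invmx A *m r) 0 0 = r 0 0 * k1 + r 1 0 * k2.
Proof.
move=> dA e1 e2; have l0 : lift ord0 ord0 = 1 :> 'I_2 by exact: val_inj.
have A_unit : A \in unitmx.
  rewrite unitmxE unitfE (expand_det_row _ 0) !big_ord_recl big_ord0 addr0.
  rewrite /cofactor !det_mx11 !mxE/= l0.
  have -> : lift 1 0 = 0 :> 'I_2 by exact: val_inj.
  by rewrite /bump/= expr0 mul1r expr1 mulN1r mulrN subr_eq0.
have rE : r = A *m (\col_(i < 2) [:: k1; k2]`_i).
  apply/matrixP => i j; rewrite ord1 !mxE !big_ord_recl big_ord0 addr0 !mxE/= l0.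
  have [->|->] : i = 0 \/ i = 1; last 2 first.
  - by rewrite -e1.
  - by rewrite -e2.
  by case: i => -[|[|//]] i2; [left|right]; exact: val_inj.
by rewrite {2}rE -!mulmxA mulKmx// mxE !big_ord_recl big_ord0 addr0 !mxE/= l0.
Qed.

(* Reducing the variance of the random part of the input from [b] to [(1 - t) b]
   leaves room both in the power constraint and in the rate condition. *)
Lemma variance_slack (R : realFieldType) (b y H : R) :
  0 < b -> b <= y -> 0 <= H < b * y ->
  exists2 b' : R, 0 < b' < b & H < b' * (y - (b - b')).
Proof.
move=> b0 b_y /andP[H0 Hby]; have y0 := lt_le_trans b0 b_y.
have X0 : 0 < b * y by exact: mulr_gt0.
(* With this [t], the loss [2 * t * (b * y)] is half of the gap [b * y - H], which suffices because
   (1 - t)^2 >= 1 - 2 t. *)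
pose t := (b * y - H) / (4 * (b * y)).
have tE : 4 * t * (b * y) = b * y - H by rewrite /t; field; rewrite !gt_eqF.
have t0 : 0 < t by rewrite divr_gt0 ?subr_gt0// mulr_gt0.
have t1 : t < 1 by rewrite ltr_pdivrMr ?mulr_gt0// mul1r; lra.
exists ((1 - t) * b).
  by rewrite mulr_gt0 ?subr_gt0// gtr_pMl//; lra.
have h1 : (1 - t) * b * ((1 - t) * y) <= (1 - t) * b * (y - (b - (1 - t) * b)).
  apply: ler_wpM2l; first by rewrite mulr_ge0 ?subr_ge0 ?ltW.
  have := ler_wpM2l (ltW t0) b_y; lra.
apply: lt_le_trans h1.
have -> : (1 - t) * b * ((1 - t) * y) = b * y - 2 * t * (b * y) + t ^+ 2 * (b * y) by ring.
have := mulr_ge0 (sqr_ge0 t) (ltW X0); lra.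
Qed.

Lemma rate_bound_lt (R : realType) (P Q N vU alpha beta rate : R) :
  let Q' := Qprime Q vU in let N' := Nprime Q vU in
  let g := gain P Q vU beta in
  let X := beta * P * (beta * P + (1 + g) ^+ 2 * Q' + N' + N) in
  let W := (N' + N) * (beta * P + alpha ^+ 2 * (1 + g) ^+ 2 * Q') +
           (1 - alpha) ^+ 2 * beta * (1 + g) ^+ 2 * P * Q' in
  0 < X -> 0 < W -> (rate%:E < rate_bound P Q N vU alpha beta)%E ->
  beta != 0 /\ expR (rate * ln 2) ^+ 2 * W < X.
Proof.
move=> Q' N' g X W X0 W0; rewrite /rate_bound -/Q' -/N' -/g.
case: ifPn => // b0; rewrite lte_fin -/X -/W /log2 => h; split => //.
have l2 : 0 < ln 2 :> R by rewrite ln_gt0// ltr1n.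
rewrite -ltr_pdivlMr// -expRM_natl -[ltRHS]lnK ?posrE ?divr_gt0// ltr_expR.
by move: h; rewrite [ltRHS]mulrA (ltr_pdivlMr _ _ l2); lra.
Qed.

Lemma achievable_test_channel (R : realType) (P Q N vU rate D alpha beta : R) :
    0 < P -> 0 < Q -> 0 < N -> 0 <= vU -> 0 <= rate -> 0 <= beta <= 1 ->
    (rate%:E < rate_bound P Q N vU alpha beta)%E ->
    distortion_bound P Q N vU alpha beta <= D ->
  achievable P Q N vU rate D.
Proof.
move=> P0 Q0 N0 vU0 rate0 /andP[beta0 beta1] hrate hD.
have [beta00|betan0] := eqVneq beta 0.
  by move: hrate; rewrite /rate_bound beta00 eqxx ltNge leNye.
have bP : 0 < beta * P by rewrite mulr_gt0// lt0r betan0.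
have QU : 0 < Q + vU by exact: ltr_wpDr.
have QU0 : Q + vU != 0 by rewrite gt_eqF.
pose Q' := Qprime Q vU; pose N' := Nprime Q vU; pose g := gain P Q vU beta.
(* [c0] is the coefficient of E[S | V] = c0 V, whose variance is [Q']. Below, [y], [s] and [w] are
   Var Y, Cov(Y, W) and Var W for A of variance [beta * P]. *)
pose h := 1 + g; pose c0 := Q / (Q + vU); pose a := alpha * h.
have Q'0 : 0 < Q' by rewrite divr_gt0// exprn_gt0.
have N'0 : 0 <= N' by rewrite divr_ge0 ?mulr_ge0// ltW.
have QN : Q' + N' = Q by rewrite /Q' /N' /Qprime /Nprime; field.
have g2 : g ^+ 2 * Q' = (1 - beta) * P.
  rewrite sqr_sqrtr -/Q'; first by field; rewrite gt_eqF.
  by apply: divr_ge0 (ltW Q'0); apply: mulr_ge0 (ltW P0); rewrite subr_ge0.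
pose y := beta * P + h ^+ 2 * Q' + N' + N.
pose s := beta * P + a * h * Q'.
pose w := beta * P + a ^+ 2 * Q'.
have w0 : 0 < w by rewrite ltr_wpDr// mulr_ge0 ?sqr_ge0// ltW.
have by_ : beta * P <= y.
  rewrite /y -!addrA lerDl.
  exact: addr_ge0 (mulr_ge0 (sqr_ge0 _) (ltW Q'0)) (addr_ge0 N'0 (ltW N0)).
(* The denominator in the rate bound is the determinant of the covariance matrix of (Y, W). Divided
   by [w] it is the least variance of Y - c W, attained at c = s / w, which turns the rate condition
   into the one of [exists_good_codes]. *)
pose W := (N' + N) * w + (1 - alpha) ^+ 2 * beta * h ^+ 2 * P * Q'.
have WE : W = y * w - s ^+ 2 by rewrite /W /y /w /s /a; ring.
have W0 : 0 < W.
  apply: ltr_wpDr (mulr_gt0 (ltr_wpDl N'0 N0) w0).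
  exact: mulr_ge0 (mulr_ge0 (mulr_ge0 (mulr_ge0 (sqr_ge0 _) beta0) (sqr_ge0 _)) (ltW P0))
    (ltW Q'0).
have [_ core] : beta != 0 /\ expR (rate * ln 2) ^+ 2 * W < beta * P * y.
  have awE : alpha ^+ 2 * h ^+ 2 = a ^+ 2 by rewrite -exprMn.
  have := @rate_bound_lt _ P Q N vU alpha beta rate.
  rewrite /= -/Q' -/N' -/g -/h awE -/w -/y -/W; apply => //.
  exact: mulr_gt0 bP (lt_le_trans bP by_).
have [|b' /andP[b'0 b'P] core'] := @variance_slack _ _ _ (expR (rate * ln 2) ^+ 2 * W) bP by_.
  by rewrite core mulr_ge0 ?exprn_ge0 ?expR_ge0// ltW.
pose c := s / w; pose r1 := h * Q' + N'; pose r2 := a * Q'.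
pose k1 := (w * r1 - s * r2) / W; pose k2 := (y * r2 - s * r1) / W.
have e1 : y * k1 + s * k2 = r1 by rewrite /k1 /k2 WE; field; rewrite -WE gt_eqF.
have e2 : s * k1 + w * k2 = r2 by rewrite /k1 /k2 WE; field; rewrite -WE gt_eqF.
have DE : distortion_bound P Q N vU alpha beta = Q - (r1 * k1 + r2 * k2).
  rewrite /distortion_bound -/Q' -/N' QN; congr (_ - _).
  have swE : beta * P + alpha * (1 + g) ^+ 2 * Q' = s by rewrite /s /a /h; ring.
  have wE : beta * P + alpha ^+ 2 * (1 + g) ^+ 2 * Q' = w by rewrite /w /a /h; ring.
  have yE : (1 + g) ^+ 2 * Q' + beta * P + N' + N = y by rewrite /y /h; ring.
  rewrite (@quadratic_form_inv2 _ _ _ k1 k2); rewrite !mxE/= -/Q' -/N' -/g ?swE ?wE ?yE//.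
  by rewrite -subr_eq0 -expr2 -WE gt_eqF.
(* The variance of l S + k1 Y + k2 W when A has variance [b]. The coefficients stay those optimal
   for [beta * P]: lowering [b] to [b'] only decreases each of these variances, so nothing has to be
   optimized again. *)
pose form b l k1 k2 := (k1 + k2) ^+ 2 * b +
  (l + k1 * (1 + g * c0) + k2 * (a * c0)) ^+ 2 * Q +
  (k1 * (g * c0) + k2 * (a * c0)) ^+ 2 * vU + k1 ^+ 2 * N.
have formE b l i j : form b l i j = l ^+ 2 * Q + 2 * l * (i * r1 + j * r2) +
    (i ^+ 2 * (y - (beta * P - b)) + 2 * i * j * (s - (beta * P - b)) +
     j ^+ 2 * (w - (beta * P - b))).
  rewrite /form test_channel_form// -/(Qprime Q vU) -/(Nprime Q vU) -/Q' -/N'.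
  by rewrite /r1 /r2 /y /s /w /h; ring.
have form_le l i j : form b' l i j <= form (beta * P) l i j.
  by rewrite /form !lerD2r ler_wpM2l ?sqr_ge0// ltW.
have form_ge0 l i j : 0 <= form b' l i j.
  exact: addr_ge0 (addr_ge0 (addr_ge0 (mulr_ge0 (sqr_ge0 _) (ltW b'0))
    (mulr_ge0 (sqr_ge0 _) (ltW Q0))) (mulr_ge0 (sqr_ge0 _) vU0))
    (mulr_ge0 (sqr_ge0 _) (ltW N0)).
(* This [kx] makes the input W + kx V equal to A + g T with T = E[S | V]. Its power
   [b' + (1 - beta) * P] is then strictly below [P]. *)
have kaxE : kax (a * c0) (g * c0 - a * c0) = g * c0 by rewrite /kax addrC subrK.
have sXE : sX Q vU b' (a * c0) (g * c0 - a * c0) = b' + (1 - beta) * P.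
  by rewrite /sX kaxE -g2 /Q' /Qprime /c0; field.
have sWE : sW Q vU b' (a * c0) = w - (beta * P - b').
  by rewrite /sW /w /Q' /Qprime /c0; field.
have sYE : sY Q vU N b' (a * c0) (g * c0 - a * c0) = y - (beta * P - b').
  by rewrite /sY kaxE /y /h /Q' /N' /Qprime /Nprime /c0; field.
pose rho := W / w; have rho0 : 0 < rho by exact: divr_gt0.
have rhoE : form (beta * P) 0 1 (- c) = rho.
  by rewrite formE /rho WE /c; field; rewrite gt_eqF.
have DkE : form (beta * P) (- 1) k1 k2 = distortion_bound P Q N vU alpha beta.
  by rewrite DE formE -e1 -e2; ring.
apply: achievable_good_codes (ltW P0) _ => eps eps0.
(* The [+ 1] makes the bound on the variance of the estimate positive, which is all that is asked of
   it besides being a bound. The [eps / 3] makes [Dm] positive and is the share of the excess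
   reserved for it. *)
apply: (@exists_good_codes _ rate P Q vU N b' (a * c0) (g * c0 - a * c0) c k1 k2 rho
  (form b' 0 k1 k2 + 1) (form b' (- 1) k1 k2 + eps / 3) D eps) => //.
- exact: ltr_wpDl.
- by apply: ltr_wpDl => //; exact: divr_gt0.
- by rewrite sXE; lra.
- rewrite kaxE -rhoE; apply: le_trans (form_le 0 1 (- c)); apply: eq_ler.
  by rewrite /form; ring.
- rewrite kaxE; apply: (@le_trans _ _ (form b' 0 k1 k2)); last by rewrite lerDl.
  by apply: eq_ler; rewrite /form; ring.
- rewrite kaxE; apply: (@le_trans _ _ (form b' (- 1) k1 k2)).
    by apply: eq_ler; rewrite /form; ring.
  by rewrite lerDl divr_ge0// ltW.
- rewrite sWE sYE; apply: le_lt_trans core'.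
  apply: ler_wpM2l; first by rewrite exprn_ge0 ?expR_ge0.
  rewrite [leRHS](_ : W = w * rho); last by rewrite /rho mulrCA divff ?mulr1// gt_eqF.
  by apply: ler_wpM2r; [exact: ltW|rewrite gerBl subr_ge0 ltW].
- by rewrite lerD2r; apply: le_trans (form_le (- 1) k1 k2) _; rewrite DkE.
Qed.

Theorem theorem1 (R : realType) (P Q N vU : R)
    (hP : 0 < P) (hQ : 0 < Q) (hN : 0 < N) (hvU : 0 <= vU)
    (rate D : R) (hrate : 0 <= rate) :
  (exists alpha beta : R,
     [/\ 0 <= alpha, 0 <= beta <= 1,
         (rate%:E < rate_bound P Q N vU alpha beta)%E &
         distortion_bound P Q N vU alpha beta <= D]) ->
  achievable P Q N vU rate D.
Proof.
move=> [alpha [beta [_ hbeta hR hD]]].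
exact: (@achievable_test_channel _ P Q N vU rate D alpha beta).
Qed.
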